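(* Let $n\ge3$, $\gamma>0$, and suppose that $q\in L_{\gamma+n/2}(\mathbb{R}^n)$. Let $H$ be the Schrödinger operator in $L_2(\mathbb{R}^n)$ associated with $-\Delta+q$. Then every complex eigenvalue $\lambda$ of $H$ with $\operatorname{Im}\lambda\ne0$ satisfies $$|\operatorname{Im}\lambda|^{\gamma}\le(4\pi)^{-n/2}\,\Gamma\!\left(\frac{2\gamma}{2\gamma+n}\right)^{\gamma+n/2}\int_{\mathbb{R}^n}|q(x)|^{\gamma+n/2}\,dx.$$
   Context: $\Gamma$ is the gamma function. The complex-valued measurable potential $q$ is factorized as $q=ab$ with $a=|q|^{1/2}$, $b=(\operatorname{sgn}q)|q|^{1/2}$, where $\operatorname{sgn}q(x)=q(x)/|q(x)|$ if $q(x)\ne0$ and $\operatorname{sgn}q(x)=0$ otherwise. $H_0$ is the operator $-\Delta$ in $L_2(\mathbb{R}^n)$ with domain the Sobolev space $W_2^2(\mathbb{R}^n)$, and $A,B$ are the operators of multiplication by $a,b$ in $L_2(\mathbb{R}^n)$ with maximal domains. For $u\in L_{2,\mathrm{loc}}(\mathbb{R}^n)$ put $M_{\nu,2}(u)=\sup_{x}\int_{|x-y|<1}|u(y)|^2|x-y|^{\nu-n}\,dy$. Standing assumptions: $M_{\nu,2}(a)<\infty$ for some $0<\nu<2$; $M_{\mu,2}(b)<\infty$ for some $0<\mu<2$; and $\int_{|x-y|<1}|q(y)|\,dy\to0$ as $|x|\to\infty$. Under these assumptions, for $z\in\mathbb{C}\setminus[0,\infty)$ the operator $B(H_0-z)^{-1}A$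 is densely defined and has a unique bounded extension $Q(z)$ to $L_2(\mathbb{R}^n)$, which is compact, and $H_0+AB$ admits a closed extension $H$ with $\sigma_{ess}(H)=\sigma_{ess}(H_0)=[0,\infty)$ such that $\lambda\in\mathbb{C}\setminus[0,\infty)$ is an eigenvalue of $H$ if and only if $-1$ is an eigenvalue of $Q(\lambda)$. This $H$ is the Schrödinger operator associated with $-\Delta+q$. *)

(* Defs.v *)
From HB Require Import structures.
From mathcomp Require Import all_boot all_order all_algebra.
From mathcomp Require Import all_classical all_reals all_analysis.
From mathcomp Require Import complex.

Set Implicit Arguments.
Unset Strict Implicit.
Unset Printing Implicit Defensive.
Import Order.TTheory GRing.Theory Num.Theory.
Import numFieldNormedType.Exports.

Local Open Scope classical_set_scope.
Local Open Scope ring_scope.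
Local Open Scope complex_scope.

(* R^n is 'rV[R]_n with the product sigma-algebra, i.e. its Borel sets.       *)
Section measurable_rV.
Context (R : realType) (n : nat).

Let coord : 'I_n -> 'rV[R]_n -> R := fun i x => x ord0 i.

Let rV_set0 : g_sigma_preimage coord set0.
Proof. exact: sigma_algebra0. Qed.

Let rV_setC A : g_sigma_preimage coord A -> g_sigma_preimage coord (~` A).
Proof. exact: sigma_algebraC. Qed.

Let rV_bigcup (F : (set 'rV[R]_n)^nat) :
  (forall i, g_sigma_preimage coord (F i)) ->
  g_sigma_preimage coord (\bigcup_i (F i)).
Proof. exact: sigma_algebra_bigcup. Qed.

HB.instance Definition _ :=
  @isMeasurable.Build (measure_tuple_display default_measure_display)
    'rV[R]_n (g_sigma_preimage coord) rV_set0 rV_setC rV_bigcup.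

Lemma measurable_coord (i : 'I_n) :
  measurable_fun [set: 'rV[R]_n] (fun x : 'rV[R]_n => x ord0 i).
Proof.
move=> _ Y mY; rewrite setTI; apply: sub_sigma_algebra => /=.
rewrite -bigcup_seq/=; exists i => /=; first by rewrite mem_index_enum.
by exists Y => //; rewrite setTI.
Qed.

Lemma measurable_fun_coordP d (T : measurableType d) (f : T -> 'rV[R]_n) :
  (forall i, measurable_fun [set: T] (fun t => f t ord0 i)) ->
  measurable_fun [set: T] f.
Proof.
move=> mf _ A mA; rewrite setTI.
have : (g_sigma_preimage (fun i => coord i \o f)) `<=` measurable.
  apply: smallest_sub; first exact: sigma_algebra_measurable.
  rewrite -bigcup_seq; apply: bigcup_sub => i _.
  by move=> B [C mC <-]; exact: mf.
apply; rewrite g_sigma_preimage_comp; exists A => //.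
by rewrite setTI.
Qed.

End measurable_rV.

Section lebesgue_rV.
Context (R : realType).

Definition cons_rV n (p : R * 'rV[R]_n) : 'rV[R]_n.+1 :=
  \row_i (if unlift ord0 i is Some j then p.2 ord0 j else p.1).

Lemma measurable_cons_rV n : measurable_fun setT (@cons_rV n).
Proof.
apply: measurable_fun_coordP => i.
under eq_fun do rewrite mxE.
case: unliftP => [j _|_]; last exact: measurable_fst.
apply: (@measurableT_comp _ _ _ _ _ _ (fun x : 'rV[R]_n => x ord0 j)).
  exact: measurable_coord.
exact: measurable_snd.
Qed.

Definition uncons_rV n (x : 'rV[R]_n.+1) : R * 'rV[R]_n :=
  (x ord0 ord0, \row_j x ord0 (lift ord0 j)).

Lemma cons_rVK n : cancel (@cons_rV n) (@uncons_rV n).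
Proof.
move=> [a v]; rewrite /uncons_rV /cons_rV mxE unlift_none/=; congr pair.
by apply/rowP => j; rewrite !mxE liftK.
Qed.

Lemma measurable_uncons_rV n : measurable_fun setT (@uncons_rV n).
Proof.
apply/measurable_fun_pairP; split; first exact: measurable_coord.
apply: measurable_fun_coordP => i.
rewrite (_ : (fun t => _) = fun t : 'rV[R]_n.+1 => t ord0 (lift ord0 i)).
  exact: measurable_coord.
by apply/funext => t /=; rewrite mxE.
Qed.

Section lebesgue_rVS.
Variables (n : nat) (mu : {sigma_finite_measure set 'rV[R]_n -> \bar R}).
Local Open Scope ereal_scope.

Definition lebesgue_rVS : set 'rV[R]_n.+1 -> \bar R :=
  pushforward (@lebesgue_measure R \x mu) (@cons_rV n).

Let mcons A : measurable A -> measurable (@cons_rV n @^-1` A).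
Proof.
by move=> mA; rewrite -[X in measurable X]setTI; exact: measurable_cons_rV.
Qed.

Let lebesgue_rVS0 : lebesgue_rVS set0 = 0.
Proof. by rewrite /lebesgue_rVS /pushforward preimage_set0 measure0. Qed.

Let lebesgue_rVS_ge0 A : 0 <= lebesgue_rVS A.
Proof. by rewrite /lebesgue_rVS /pushforward; exact: measure_ge0. Qed.

Let lebesgue_rVS_sigma_additive : semi_sigma_additive lebesgue_rVS.
Proof.
move=> F mF tF mUF; rewrite /lebesgue_rVS /pushforward preimage_bigcup.
apply: measure_semi_sigma_additive.
- by move=> k; exact: mcons.
- apply/trivIsetP => /= i j _ _ ij; rewrite -preimage_setI.
  by move/trivIsetP : tF => /(_ _ _ _ _ ij) ->//; rewrite preimage_set0.
- by rewrite -preimage_bigcup; exact: mcons.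
Qed.

HB.instance Definition _ := isMeasure.Build _ _ _ lebesgue_rVS
  lebesgue_rVS0 lebesgue_rVS_ge0 lebesgue_rVS_sigma_additive.

Let lebesgue_rVS_sigma_finite : sigma_finite setT lebesgue_rVS.
Proof.
have /sigma_finiteP[F [TF ndF mF]] := sigma_finiteT (@lebesgue_measure R).
have /sigma_finiteP[G [TG ndG mG]] := sigma_finiteT mu.
exists (fun k => @uncons_rV n @^-1` (F k `*` G k)).
  apply/esym; rewrite -subTset => x _.
  have : setT (uncons_rV x).1 by []. rewrite TF => -[k _ Fk].
  have : setT (uncons_rV x).2 by []. rewrite TG => -[l _ Gl].
  exists (maxn k l) => //; split.
    by move: Fk; exact/subsetPset/ndF/leq_maxl.
  by move: Gl; exact/subsetPset/ndG/leq_maxr.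
move=> k; have [mFk Fkoo] := mF k; have [mGk Gkoo] := mG k.
have mFG : measurable (F k `*` G k) by exact: measurableX.
split.
  by rewrite -[X in measurable X]setTI; exact: measurable_uncons_rV.
rewrite /lebesgue_rVS /pushforward.
rewrite (_ : _ @^-1` _ = F k `*` G k).
  by rewrite product_measure1E// lte_mul_pinfty// ge0_fin_numE.
by rewrite -comp_preimage (_ : _ \o _ = id)// funeqE => p /=; exact: cons_rVK.
Qed.

HB.instance Definition _ := Measure_isSigmaFinite.Build _ _ _ lebesgue_rVS
  lebesgue_rVS_sigma_finite.
End lebesgue_rVS.

Fixpoint lebesgue_rV n : {sigma_finite_measure set 'rV[R]_n -> \bar R} :=
  match n with
  | 0 => \d_ (0 : 'rV[R]_0)
  | m.+1 => lebesgue_rVS (lebesgue_rV m)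
  end.

Lemma lebesgue_rV_box n (A : 'I_n -> set R) :
  (forall i, measurable (A i)) ->
  lebesgue_rV n [set x | forall i, A i (x ord0 i)] =
    (\prod_(i < n) lebesgue_measure (A i))%E.
Proof.
elim: n A => [|n IH] A mA.
  by rewrite big_ord0 /= diracE mem_set// => -[].
have mbox m (B : 'I_m -> set R) : (forall i, measurable (B i)) ->
    measurable [set x : 'rV[R]_m | forall i, B i (x ord0 i)].
  move=> mB; rewrite (_ : mkset _ =
      \bigcap_(i in [set: 'I_m]) [set x : 'rV[R]_m | B i (x ord0 i)]);
    last first.
    by apply/seteqP; split => [x Bx i _|x Bx i]; [exact: Bx|exact: (Bx i)].
  apply: fin_bigcap_measurable => // i _.
  by rewrite -[X in measurable X]setTI; exact: measurable_coord.
rewrite big_ord_recl /= /lebesgue_rVS /pushforward.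
have -> : @cons_rV n @^-1` [set x | forall i, A i (x ord0 i)] =
    A ord0 `*` [set x : 'rV[R]_n | forall i : 'I_n, A (lift ord0 i) (x ord0 i)];
  last first.
  rewrite product_measure1E; first last.
  - exact: (@mbox n (fun i => A (lift ord0 i))).
  - exact: mA.
  by congr (_ * _)%E; exact: (IH (fun i => A (lift ord0 i))).
apply/seteqP; split => [[a v] /= Av|[a v] /= [Aa Av] i].
  split=> [|i]; first by have := Av ord0; rewrite mxE unlift_none.
  by have := Av (lift ord0 i); rewrite mxE liftK.
by rewrite mxE; case: unliftP => [j ->|->].
Qed.

End lebesgue_rV.

Definition Gamma (R : realType) (x : R) : R :=
  \int[lebesgue_measure]_(t in `]0%R, +oo[) (t `^ (x - 1) * expR (- t)).

Section L2.
Context (R : realType) (n : nat).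

Notation leb := (@lebesgue_rV R n).
Notation cfun := ('rV[R]_n -> R[i]).
Implicit Types (f g u v : cfun) (z : R[i]).

(* The norm of 'rV[R]_n in the library is the sup norm, hence this one.       *)
Definition enorm (x : 'rV[R]_n) : R := Num.sqrt (\sum_i x ord0 i ^+ 2).

Definition cmeasurable f :=
  measurable_fun setT (fun x => complex.Re (f x)) /\
  measurable_fun setT (fun x => complex.Im (f x)).

Definition cabs f (x : 'rV[R]_n) : R := Normc.normc (f x).

Definition cintegral f : R[i] :=
  (\int[leb]_x complex.Re (f x)) +i* (\int[leb]_x complex.Im (f x)).

Definition inLp (p : R) f := cmeasurable f /\ finite_norm leb p%:E (cabs f).

Definition inL2 := inLp 2.

Definition L2norm f : R := fine (Lnorm leb 2%:E (EFin \o cabs f)).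

(* Elements of L_2 are represented by functions, up to equality a.e.  An      *)
(* unbounded operator is represented by its graph, a relation between         *)
(* functions; [T u v] reads: u is in the domain of T and T u = v a.e.         *)
Definition oper := cfun -> cfun -> Prop.
Implicit Types S T Q : oper.

Definition linear_operator T : Prop :=
  [/\ forall u v, T u v -> inL2 u /\ inL2 v,
      forall u v u' v', T u v -> inL2 u' -> inL2 v' ->
        u = u' %[ae leb] -> v = v' %[ae leb] -> T u' v',
      T (cst 0) (cst 0),
      forall z u v u' v', T u v -> T u' v' ->
        T (fun x => z * u x + u' x) (fun x => z * v x + v' x) &
      forall v, T (cst 0) v -> v = cst 0 %[ae leb] ].

Definition oper_add S T : oper := fun u h => inL2 h /\
  exists v w, [/\ S u v, T u w & h = (fun x => v x + w x) %[ae leb] ].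

Definition oper_comp S T : oper := fun u h => exists2 v, T u v & S v h.

Definition oper_sub_scalar T z : oper := fun u h => inL2 h /\
  exists2 v, T u v & h = (fun x => v x - z * u x) %[ae leb].

Definition oper_inv T : oper := fun u v => T v u.

Definition extends T S : Prop := forall u v, S u v -> T u v.

Definition closed_operator T : Prop :=
  forall (u_ v_ : nat -> cfun) u v, (forall k, T (u_ k) (v_ k)) ->
    inL2 u -> inL2 v ->
    (fun k => L2norm (fun x => u_ k x - u x)) @ \oo --> (0 : R) ->
    (fun k => L2norm (fun x => v_ k x - v x)) @ \oo --> (0 : R) ->
  T u v.

Definition densely_defined T : Prop := forall u (e : R), inL2 u -> 0 < e ->
  exists u' v', T u' v' /\ L2norm (fun x => u x - u' x) < e.

Definition bounded_operator Q : Prop :=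
  [/\ linear_operator Q, forall u, inL2 u -> exists v, Q u v &
      exists c : R, forall u v, Q u v -> L2norm v <= c * L2norm u].

Definition is_eigenvalue T z : Prop :=
  exists2 u, T u (fun x => z * u x) & ~ (u = cst 0 %[ae leb]).

Definition fredholm T : Prop :=
  [/\ exists (m : nat) (e : 'I_m -> cfun), forall u, T u (cst 0) ->
        exists c : 'I_m -> R[i], u = (fun x => \sum_i c i * e i x) %[ae leb],
      forall (v_ : nat -> cfun) v, (forall k, exists u, T u (v_ k)) -> inL2 v ->
        (fun k => L2norm (fun x => v_ k x - v x)) @ \oo --> (0 : R) ->
        exists u, T u v &
      exists (m : nat) (e : 'I_m -> cfun), (forall i, inL2 (e i)) /\
        forall h, inL2 h -> exists u v (c : 'I_m -> R[i]),
          T u v /\ h = (fun x => v x + \sum_i c i * e i x) %[ae leb] ].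

Definition essential_spectrum T : set R[i] :=
  [set z | ~ fredholm (oper_sub_scalar T z)].

Definition partial (i : 'I_n) (phi : 'rV[R]_n -> R) : 'rV[R]_n -> R :=
  fun x => 'D_(delta_mx ord0 i) phi x.

Definition partials (s : seq 'I_n) (phi : 'rV[R]_n -> R) := foldr partial phi s.

(* C_c^oo; real-valued test functions suffice, by linearity.                  *)
Definition test_function (phi : 'rV[R]_n -> R) : Prop :=
  [/\ forall s, continuous (partials s phi),
      forall s i x, derivable (partials s phi) x (delta_mx ord0 i) &
      exists r, forall x, r < enorm x -> phi x = 0].

Definition weak_partial (s : seq 'I_n) u v : Prop :=
  forall phi, test_function phi ->
    cintegral (fun x => u x * (partials s phi x)%:C) =
    (-1) ^+ size s * cintegral (fun x => v x * (phi x)%:C).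

Definition W22 u : Prop := inL2 u /\
  forall s : seq 'I_n, (size s <= 2)%N ->
    exists2 v, inL2 v & weak_partial s u v.

Definition oper_H0 : oper := fun u h => [/\ W22 u, inL2 h &
  exists2 v : 'I_n -> cfun,
    (forall i, inL2 (v i) /\ weak_partial [:: i; i] u (v i)) &
    h = (fun x => - \sum_i v i x) %[ae leb] ].

Definition mult_oper (m : cfun) : oper := fun u v =>
  [/\ inL2 u, inL2 v & v = (fun x => m x * u x) %[ae leb] ].

Definition csgn z : R[i] := if z == 0 then 0 else z / (Normc.normc z)%:C.

Section potential.
Variable q : cfun.

Definition fact_a : cfun := fun x => (Num.sqrt (cabs q x))%:C.
Definition fact_b : cfun := fun x => csgn (q x) * fact_a x.

Definition oper_A : oper := mult_oper fact_a.
Definition oper_B : oper := mult_oper fact_b.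

Definition unit_ball (x : 'rV[R]_n) : set 'rV[R]_n :=
  [set y | enorm (x - y) < 1].

(* The value of the integrand at y = x, where powR is 0, is irrelevant.       *)
Definition M2 (nu : R) u : \bar R :=
  ereal_sup (range (fun x => (\int[leb]_(y in unit_ball x)
    (cabs u y ^+ 2 * enorm (x - y) `^ (nu - n%:R))%:E)%E)).

Definition standing_assumptions : Prop :=
  [/\ exists2 nu : R, 0 < nu < 2 & (M2 nu fact_a < +oo)%E,
      exists2 mu : R, 0 < mu < 2 & (M2 mu fact_b < +oo)%E &
      forall e : R, 0 < e -> exists r : R, forall x, r < enorm x ->
        (\int[leb]_(y in unit_ball x) (cabs q y)%:E < e%:E)%E].

Definition birman_schwinger z : oper :=
  oper_comp oper_B (oper_comp (oper_inv (oper_sub_scalar oper_H0 z)) oper_A).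

(* Q is the bounded extension of B (H_0 - z)^-1 A, unique because the latter  *)
(* is densely defined.                                                        *)
Definition birman_schwinger_closure z Q : Prop :=
  [/\ densely_defined (birman_schwinger z), bounded_operator Q &
      extends Q (birman_schwinger z)].

(* In R[i], [0 <= z] means that z is a nonnegative real number.               *)
Definition schrodinger_operator (H : oper) : Prop :=
  [/\ linear_operator H,
      closed_operator H,
      extends H (oper_add oper_H0 (oper_comp oper_A oper_B)),
      essential_spectrum H = [set z | 0 <= z] &
      forall z, ~~ (0 <= z) -> is_eigenvalue H z <->
        exists2 Q, birman_schwinger_closure z Q & is_eigenvalue Q (-1)].

End potential.
End L2.

(* Main.v *)
(* Birman-Schwinger principle with rotated heat kernels.  An eigenvalue [lam] of
   [H] off the half-line makes [-1] an eigenvalue of the closure [Q] of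
   [B (H_0 - lam)^-1 A], hence [norm Q >= 1].  Let [e = c + i s] be a unit complex
   number with [c > 0].  The convolution with the kernel of [exp (e t Laplacian)]
   has norm at most 1 on [L_2] and at most [(4 pi t)^(-n/2)] from [L_1] to [L_oo],
   hence by interpolation at most [(4 pi t)^(-n/(2r))] from [L_p] to [L_p'], where
   [r = gamma + n/2] and [p = 2r/(r+1)].  When [kap = - Re (e lam) > 0],
   [(H_0 - lam)^-1] is [e] times the integral over [t > 0] of
   [exp (e lam t) exp (e t Laplacian)], so its norm from [L_p] to [L_p'] is at most
   [(4 pi)^(-n/(2r)) kap^(-gamma/r) Gamma (gamma/r)].  Hoelder's inequality with
   [a] and [b] turns this into a bound for [Q] in terms of the [L_r] norm of [q],
   so that [1 <= norm Q] bounds [kap]; finally [kap] tends to [|Im lam|] as [e]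
   tends to [+i] or [-i]. *)
Require Import Defs.
From HB Require Import structures.
From mathcomp Require Import all_boot all_order all_algebra.
From mathcomp Require Import all_classical all_reals all_analysis.
From mathcomp Require Import measurable_realfun complex.
From mathcomp Require Import ring lra.

Set Implicit Arguments.
Unset Strict Implicit.
Unset Printing Implicit Defensive.
Import Order.TTheory GRing.Theory Num.Theory.
Import numFieldNormedType.Exports.

Local Open Scope classical_set_scope.
Local Open Scope ring_scope.
Local Open Scope complex_scope.

(** * Complex-valued integration *)

(** The resolvent is never constructed. If [H0] sends u to h0 and w = h0 - lam u, the function X(t)
    = exp(e lam t) <exp(e t Laplacian) u, h> has derivative -e exp(e lam t) <exp(e t Laplacian) w,
    h>; it decays at infinity and tends at 0 to <u, h> times a factor of modulus 1, so a bound on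
    |X'| bounds <u, h>. Only bilinear pairings with bounded h supported in a set of finite measure
    are estimated, and the phase dropped from the kernel is harmless. Since |X'| is at most a
    multiple of t^(-n/(2r)) exp(-kap t), the Gamma function appears at 1 - n/(2r) = gamma/r. Two
    obstacles shape the rest. The domain of [H0] is described by real compactly supported test
    functions, so the heat kernel has to be reached as a limit of truncated wave packets. And the
    sharp constant leaves no room for loss in the L_2 bound or in the interpolation: the modulus of
    a rotated kernel has mass c^(-n/2), too large for a direct estimate, so the contraction is read
    off from T*T, whose kernel is a real heat kernel of mass 1. Taking c > 0 keeps every kernel
    Gaussian in modulus, hence integrable. *)

Section normc_theory.
Context {R : realType}.
Implicit Types z w : R[i].
Local Notation normc := Normc.normc.

Lemma normc_sq z : normc z ^+ 2 = complex.Re z ^+ 2 + complex.Im z ^+ 2.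
Proof. by case: z => a b /=; rewrite sqr_sqrtr// addr_ge0// sqr_ge0. Qed.

Lemma normc_ge0 z : 0 <= normc z.
Proof. by case: z => a b /=; rewrite sqrtr_ge0. Qed.

Lemma normc_eq0 z : (normc z == 0) = (z == 0).
Proof.
apply/eqP/eqP => [|->]; first exact: Normc.eq0_normc.
exact: Normc.normc0.
Qed.

Lemma normc_conj z : normc (conjc z) = normc z.
Proof. by case: z => a b /=; rewrite sqrrN. Qed.

Lemma mulcJ z : z * (conjc z) = (normc z ^+ 2)%:C.
Proof.
case: z => a b; rewrite normc_sq /=.
by apply/eqP; rewrite eq_complex /=; apply/andP; split; apply/eqP; ring.
Qed.

Lemma normc_real (x : R) : normc x%:C = `|x|.
Proof. by rewrite /= expr0n /= addr0 sqrtr_sqr. Qed.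

Lemma normc_Re z : `|complex.Re z| <= normc z.
Proof.
rewrite -(@ler_pXn2r _ 2)// ?nnegrE ?normc_ge0// normc_sq.
by rewrite real_normK ?num_real// lerDl sqr_ge0.
Qed.

Lemma normc_Im z : `|complex.Im z| <= normc z.
Proof.
rewrite -(@ler_pXn2r _ 2)// ?nnegrE ?normc_ge0// normc_sq.
by rewrite real_normK ?num_real// lerDr sqr_ge0.
Qed.

Lemma normc_le_ReIm z : normc z <= `|complex.Re z| + `|complex.Im z|.
Proof.
rewrite -(@ler_pXn2r _ 2)// ?nnegrE ?normc_ge0// ?addr_ge0// normc_sq.
rewrite sqrrD !real_normK ?num_real//.
by rewrite addrAC -addrA lerD2l lerDl mulrn_wge0// mulr_ge0.
Qed.

Lemma normc_sub z w : normc (z - w) = normc (w - z).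
Proof. by rewrite -opprB normcN. Qed.

Lemma normcX z k : normc (z ^+ k) = normc z ^+ k.
Proof. by elim: k => [|k IH]; rewrite ?Normc.normc1// !exprS Normc.normcM IH. Qed.

Lemma ReM z w : complex.Re (z * w) =
  complex.Re z * complex.Re w - complex.Im z * complex.Im w.
Proof. by case: z; case: w. Qed.

Lemma ImM z w : complex.Im (z * w) =
  complex.Re z * complex.Im w + complex.Im z * complex.Re w.
Proof. by case: z; case: w. Qed.

Lemma ReD z w : complex.Re (z + w) = complex.Re z + complex.Re w.
Proof. by case: z; case: w. Qed.

Lemma ImD z w : complex.Im (z + w) = complex.Im z + complex.Im w.
Proof. by case: z; case: w. Qed.

Lemma ReN z : complex.Re (- z) = - complex.Re z. Proof. by case: z. Qed.
Lemma ImN z : complex.Im (- z) = - complex.Im z. Proof. by case: z. Qed.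
Lemma ReJ z : complex.Re (conjc z) = complex.Re z. Proof. by case: z. Qed.
Lemma ImJ z : complex.Im (conjc z) = - complex.Im z. Proof. by case: z. Qed.

Lemma conjcM z w : conjc (z * w) = conjc z * conjc w.
Proof. by rewrite rmorphM. Qed.

Lemma complexP z w : complex.Re z = complex.Re w ->
  complex.Im z = complex.Im w -> z = w.
Proof. by case: z; case: w => a b c d /= -> ->. Qed.

End normc_theory.

Arguments Normc.normc : simpl never.

Section cmeas.
Context {R : realType} {d : measure_display} {T : measurableType d}.
Implicit Types f g : T -> R[i].
Local Notation normc := Normc.normc.

(** The notion [cmeasurable] on an arbitrary measurable space, since integrands also live on the
    line and on products. *)
Definition cmeas f :=
  measurable_fun setT (fun x => complex.Re (f x)) /\
  measurable_fun setT (fun x => complex.Im (f x)).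

Lemma cmeasM f g : cmeas f -> cmeas g -> cmeas (fun x => f x * g x).
Proof.
move=> [f1 f2] [g1 g2]; split.
  under eq_fun do rewrite ReM.
  by apply: measurable_funB; apply: measurable_funM.
under eq_fun do rewrite ImM.
by apply: measurable_funD; apply: measurable_funM.
Qed.

Lemma cmeasD f g : cmeas f -> cmeas g -> cmeas (fun x => f x + g x).
Proof.
move=> [f1 f2] [g1 g2]; split.
  by under eq_fun do rewrite ReD; exact: measurable_funD.
by under eq_fun do rewrite ImD; exact: measurable_funD.
Qed.

Lemma cmeasN f : cmeas f -> cmeas (fun x => - f x).
Proof.
move=> [f1 f2]; split.
  by under eq_fun do rewrite ReN; exact: measurableT_comp.
by under eq_fun do rewrite ImN; exact: measurableT_comp.
Qed.

Lemma cmeasB f g : cmeas f -> cmeas g -> cmeas (fun x => f x - g x).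
Proof. by move=> mf mg; exact/cmeasD/cmeasN. Qed.

Lemma cmeas_conj f : cmeas f -> cmeas (fun x => (conjc (f x))).
Proof.
move=> [f1 f2]; split; first by under eq_fun do rewrite ReJ.
by under eq_fun do rewrite ImJ; exact: measurableT_comp.
Qed.

Lemma cmeas_cst (z : R[i]) : cmeas (cst z).
Proof. by split; exact: measurable_cst. Qed.

Lemma cmeas_real (F : T -> R) : measurable_fun setT F -> cmeas (fun x => (F x)%:C).
Proof. by move=> mF; split => //=; exact: measurable_cst. Qed.

Lemma measurable_normc f : cmeas f -> measurable_fun setT (fun x => normc (f x)).
Proof.
move=> [f1 f2].
have -> : (fun x => normc (f x)) = fun x =>
    Num.sqrt (complex.Re (f x) ^+ 2 + complex.Im (f x) ^+ 2).
  by apply/funext => x; case: (f x).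
apply: measurableT_comp.
  by apply: continuous_measurable_fun; exact: sqrt_continuous.
by apply: measurable_funD; exact: measurable_funX.
Qed.

End cmeas.

Lemma cmeas_comp {R : realType} d d' (T : measurableType d)
    (U : measurableType d') (g : U -> T) (f : T -> R[i]) :
  measurable_fun setT g -> cmeas f -> cmeas (fun x => f (g x)).
Proof.
move=> mg [f1 f2]; split.
  exact: (@measurableT_comp _ _ _ _ _ _ (fun x => complex.Re (f x))).
exact: (@measurableT_comp _ _ _ _ _ _ (fun x => complex.Im (f x))).
Qed.

Section rint.
Context {R : realType} {d : measure_display} {T : measurableType d}.
Variable mu : {measure set T -> \bar R}.
Implicit Types F G : T -> R.

(** [Rintegral] is total and sends an infinite integral to 0, so the rules of calculus below have to
    ask for integrability. *)
Definition Lone F := mu.-integrable setT (EFin \o F).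

Lemma LoneP F : Lone F <->
  measurable_fun setT F /\ (\int[mu]_x `|F x|%:E < +oo)%E.
Proof.
split=> [/integrableP[mF iF]|[mF iF]].
  by split=> //; exact/measurable_EFinP.
by apply/integrableP; split => //; exact/measurable_EFinP.
Qed.

Lemma Lone_meas F : Lone F -> measurable_fun setT F.
Proof. by move=> /LoneP[]. Qed.

Lemma le_Lone F G : measurable_fun setT F -> (forall x, `|F x| <= G x) ->
  Lone G -> Lone F.
Proof.
move=> mF FG iG; apply: (le_integrable _ _ _ iG) => //.
  exact/measurable_EFinP.
move=> x _ /=; rewrite lee_fin; apply: (le_trans (FG x)); exact: ler_norm.
Qed.

Lemma LoneD F G : Lone F -> Lone G -> Lone (fun x => F x + G x).
Proof.
move=> iF iG; rewrite /Lone.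
have -> : EFin \o (fun x => F x + G x) = (EFin \o F) \+ (EFin \o G).
  by apply/funext => x /=; rewrite EFinD.
exact: integrableD.
Qed.

Lemma LoneN F : Lone F -> Lone (fun x => - F x).
Proof.
move=> iF; have := integrableN iF; congr (mu.-integrable _ _).
Qed.

Lemma LoneB F G : Lone F -> Lone G -> Lone (fun x => F x - G x).
Proof. by move=> iF iG; apply: LoneD => //; exact: LoneN. Qed.

Lemma LoneZ k F : Lone F -> Lone (fun x => k * F x).
Proof.
move=> iF; have := integrableZl measurableT k iF; congr (mu.-integrable _ _).
Qed.

Lemma Lone_norm F : Lone F -> Lone (fun x => `|F x|).
Proof. by move=> /integrable_norm. Qed.

Lemma rintD F G : Lone F -> Lone G ->
  \int[mu]_x (F x + G x) = \int[mu]_x F x + \int[mu]_x G x.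
Proof. by move=> iF iG; rewrite RintegralD. Qed.

Lemma rintB F G : Lone F -> Lone G ->
  \int[mu]_x (F x - G x) = \int[mu]_x F x - \int[mu]_x G x.
Proof. by move=> iF iG; rewrite RintegralB. Qed.

Lemma rintZ k F : Lone F -> \int[mu]_x (k * F x) = k * \int[mu]_x F x.
Proof. by move=> iF; rewrite RintegralZl. Qed.

Lemma le_rint F G : Lone F -> Lone G -> (forall x, F x <= G x) ->
  \int[mu]_x F x <= \int[mu]_x G x.
Proof. by move=> iF iG FG; apply: le_Rintegral => // x _; exact: FG. Qed.

Lemma rint_EFin F : Lone F -> (\int[mu]_x F x)%:E = (\int[mu]_x (F x)%:E)%E.
Proof. by move=> iF; rewrite /Rintegral fineK//; exact: integrable_fin_num. Qed.

Lemma rint_ge0 F : (forall x, 0 <= F x) -> 0 <= \int[mu]_x F x.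
Proof. by move=> F0; apply: Rintegral_ge0 => x _; exact: F0. Qed.

Lemma rint_ae F G : measurable_fun setT F -> measurable_fun setT G ->
  F = G %[ae mu] -> \int[mu]_x F x = \int[mu]_x G x.
Proof.
move=> mF mG FG; congr fine; apply: ae_eq_integral => //.
- exact/measurable_EFinP.
- exact/measurable_EFinP.
- by apply: filterS FG => x + _ => /= /(_ I) ->.
Qed.

Lemma rint_dominated (F_ : nat -> T -> R) F G :
  (forall k, measurable_fun setT (F_ k)) -> measurable_fun setT F ->
  {ae mu, forall x, F_ k x @[k --> \oo] --> F x} ->
  Lone G -> (forall k x, `|F_ k x| <= G x) ->
  Lone F /\ \int[mu]_x F_ k x @[k --> \oo] --> \int[mu]_x F x.
Proof.
move=> mF_ mF cF iG FG.
have [] := @dominated_convergence _ T R mu setT measurableT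
  (fun k => EFin \o F_ k) (EFin \o F) (EFin \o G).
- by move=> k; exact/measurable_EFinP.
- exact/measurable_EFinP.
- by apply: filterS cF => x Fx _; apply: cvg_EFin => //; exact: nearW.
- exact: iG.
- by apply: nearW => x k _ /=; rewrite lee_fin.
move=> iF _ cv; split => //.
have -> : (\int[mu]_x F_ k x)%R @[k --> \oo] = fine (\int[mu]_x (F_ k x)%:E)%E @[k --> \oo].
  by [].
apply: fine_cvg => //=; rewrite /Rintegral fineK; first exact: cv.
exact: integrable_fin_num.
Qed.

End rint.

Section cint.
Context {R : realType} {d : measure_display} {T : measurableType d}.
Variable mu : {measure set T -> \bar R}.
Implicit Types f g : T -> R[i].
Local Notation normc := Normc.normc.

(** For [lebesgue_rV] this is [cintegral] by conversion; the measure is a parameter so that products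
    and restrictions are covered. *)
Definition cint f : R[i] :=
  (\int[mu]_x complex.Re (f x)) +i* (\int[mu]_x complex.Im (f x)).

Definition cintegrable f := cmeas f /\ Lone mu (fun x => normc (f x)).

Lemma cintegrable_Re f : cintegrable f -> Lone mu (fun x => complex.Re (f x)).
Proof. by move=> [[m1 _] i]; apply: le_Lone i => // x; exact: normc_Re. Qed.

Lemma cintegrable_Im f : cintegrable f -> Lone mu (fun x => complex.Im (f x)).
Proof. by move=> [[_ m1] i]; apply: le_Lone i => // x; exact: normc_Im. Qed.

Lemma le_cintegrable f (G : T -> R) : cmeas f -> (forall x, normc (f x) <= G x) ->
  Lone mu G -> cintegrable f.
Proof.
move=> mf fG iG; split => //; apply: le_Lone iG; first exact: measurable_normc.
by move=> x; rewrite ger0_norm ?normc_ge0.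
Qed.

Lemma cintegrableD f g : cintegrable f -> cintegrable g ->
  cintegrable (fun x => f x + g x).
Proof.
move=> [mf if_] [mg ig]; apply: (@le_cintegrable _ (fun x => normc (f x) + normc (g x))).
- exact: cmeasD.
- by move=> x; exact: le_normcD.
- exact: LoneD.
Qed.

Lemma cintegrableZ z f : cintegrable f -> cintegrable (fun x => z * f x).
Proof.
move=> [mf if_]; apply: (@le_cintegrable _ (fun x => normc z * normc (f x))).
- by apply: cmeasM => //; exact: cmeas_cst.
- by move=> x; rewrite Normc.normcM.
- exact: LoneZ.
Qed.

Lemma cintegrableN f : cintegrable f -> cintegrable (fun x => - f x).
Proof.
move=> [mf if_]; split; first exact: cmeasN.
by under eq_fun do rewrite normcN.
Qed.

Lemma cintegrableB f g : cintegrable f -> cintegrable g ->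
  cintegrable (fun x => f x - g x).
Proof. by move=> i1 i2; exact/cintegrableD/cintegrableN. Qed.

Lemma cintD f g : cintegrable f -> cintegrable g ->
  cint (fun x => f x + g x) = cint f + cint g.
Proof.
move=> if_ ig; apply: complexP; rewrite /cint /=.
  under eq_Rintegral do rewrite ReD.
  by rewrite rintD//; exact: cintegrable_Re.
under eq_Rintegral do rewrite ImD.
by rewrite rintD//; exact: cintegrable_Im.
Qed.

Lemma cintZ z f : cintegrable f -> cint (fun x => z * f x) = z * cint f.
Proof.
move=> if_; have iR := cintegrable_Re if_; have iI := cintegrable_Im if_.
apply: complexP; rewrite ?ReM ?ImM /cint /=.
  under eq_Rintegral do rewrite ReM.
  by rewrite rintB ?rintZ//; exact: LoneZ.
under eq_Rintegral do rewrite ImM.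
by rewrite rintD ?rintZ//; exact: LoneZ.
Qed.

Lemma cintN f : cintegrable f -> cint (fun x => - f x) = - cint f.
Proof.
move=> if_; rewrite -mulN1r -cintZ//; congr cint.
by apply/funext => x; rewrite mulN1r.
Qed.

Lemma cintB f g : cintegrable f -> cintegrable g ->
  cint (fun x => f x - g x) = cint f - cint g.
Proof. by move=> i1 i2; rewrite cintD ?cintN//; exact: cintegrableN. Qed.

Lemma cint_real (F : T -> R) : cint (fun x => (F x)%:C) = (\int[mu]_x F x)%:C.
Proof.
apply: complexP => //; rewrite /cint /=.
by rewrite /Rintegral integral0.
Qed.

(** A factor [w] of modulus 1 rotates the integral onto the positive axis, where it equals the
    integral of a real part. *)
Lemma normc_cint f : cintegrable f -> normc (cint f) <= \int[mu]_x normc (f x).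
Proof.
move=> if_; have [c0|c0] := eqVneq (cint f) 0.
  by rewrite c0 Normc.normc0; apply: rint_ge0 => x; exact: normc_ge0.
have n0 : normc (cint f) != 0 by rewrite normc_eq0.
pose w := (conjc (cint f)) * ((normc (cint f))^-1)%:C.
have nw : normc w = 1.
  by rewrite /w Normc.normcM normc_conj normc_real ger0_norm ?invr_ge0 ?normc_ge0// divff.
have -> : normc (cint f) = complex.Re (cint (fun x => w * f x)).
  rewrite cintZ// /w mulrC mulrA mulcJ ReM /= mul0r subr0 expr2 -mulrA divff// mulr1//.
have iw := cintegrableZ w if_.
apply: le_rint; [exact: cintegrable_Re|exact: if_.2|] => x.
by apply: (le_trans (ler_norm _)); rewrite (le_trans (normc_Re _))// Normc.normcM nw mul1r.
Qed.

Lemma cint_ae f g : cmeas f -> cmeas g -> f = g %[ae mu] -> cint f = cint g.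
Proof.
move=> [f1 f2] [g1 g2] fg; apply: complexP; rewrite /cint /=; apply: rint_ae => //.
  by apply: filterS fg => x + _ => /= /(_ I) ->.
by apply: filterS fg => x + _ => /= /(_ I) ->.
Qed.

(** Here and below, convergence of complex numbers is phrased as convergence to 0 of the modulus of
    the difference. *)
Lemma cint_dominated (f_ : nat -> T -> R[i]) f (G : T -> R) :
  (forall k, cmeas (f_ k)) -> cmeas f ->
  {ae mu, forall x, normc (f_ k x - f x) @[k --> \oo] --> 0} ->
  Lone mu G -> (forall k x, normc (f_ k x) <= G x) ->
  normc (cint (f_ k) - cint f) @[k --> \oo] --> 0.
Proof.
move=> mf_ mf cf iG fG.
have cvgR (h : R[i] -> R) : (forall z w, `|h z - h w| <= normc (z - w)) ->
    {ae mu, forall x, h (f_ k x) @[k --> \oo] --> h (f x)}.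
  move=> hL; apply: filterS cf => x cx; apply/subr_cvg0/norm_cvg0P.
  apply: (@squeeze_cvgr _ _ _ _ (cst 0) (fun k => normc (f_ k x - f x))) => //.
    by apply: nearW => k; rewrite normr_ge0 hL.
  exact: cvg_cst.
have [z w|_ c1] := rint_dominated (fun k => (mf_ k).1) mf.1
    (cvgR (@complex.Re R) _) iG (fun k x => le_trans (normc_Re _) (fG k x)).
  by rewrite -ReN -ReD normc_Re.
have [z w|_ c2] := rint_dominated (fun k => (mf_ k).2) mf.2
    (cvgR (@complex.Im R) _) iG (fun k x => le_trans (normc_Im _) (fG k x)).
  by rewrite -ImN -ImD normc_Im.
apply: (@squeeze_cvgr _ _ _ _ (cst 0)
  (fun k => `|complex.Re (cint (f_ k)) - complex.Re (cint f)| +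
            `|complex.Im (cint (f_ k)) - complex.Im (cint f)|)).
- apply: nearW => k; apply/andP; split; first exact: normc_ge0.
  by apply: (le_trans (normc_le_ReIm _)); rewrite ReD ImD ReN ImN.
- exact: cvg_cst.
- by rewrite -[X in _ --> X]addr0; apply: cvgD; apply/norm_cvg0P/subr_cvg0.
Qed.

End cint.

Section cFubini.
Context {R : realType} d1 d2 (T1 : measurableType d1) (T2 : measurableType d2).
Variable m1 : {sigma_finite_measure set T1 -> \bar R}.
Variable m2 : {sigma_finite_measure set T2 -> \bar R}.

Lemma rint_Fubini1 (F : T1 * T2 -> R) : Lone (m1 \x m2)%E F ->
  \int[m1]_x \int[m2]_y F (x, y) = \int[(m1 \x m2)%E]_z F z.
Proof.
move=> iF; rewrite [RHS]/Rintegral -(integral12_prod_meas1 iF); congr fine.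
have mF : measurable_fun setT (fubini_F m2 (EFin \o F)) by exact: (measurable_fubini_F iF).
apply: ae_eq_integral => //.
  exact/measurable_EFinP/(measurableT_comp _ mF).
apply: filterS (ae_integrable1 iF) => x ix _ /=.
by rewrite /Rintegral fineK//; exact: integrable_fin_num.
Qed.

Lemma rint_Fubini2 (F : T1 * T2 -> R) : Lone (m1 \x m2)%E F ->
  \int[m2]_y \int[m1]_x F (x, y) = \int[(m1 \x m2)%E]_z F z.
Proof.
move=> iF; rewrite [RHS]/Rintegral -(integral21_prod_meas1 iF); congr fine.
have mF : measurable_fun setT (fubini_G m1 (EFin \o F)) by exact: (measurable_fubini_G iF).
apply: ae_eq_integral => //.
  exact/measurable_EFinP/(measurableT_comp _ mF).
apply: filterS (ae_integrable2 iF) => x ix _ /=.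
by rewrite /Rintegral fineK//; exact: integrable_fin_num.
Qed.

Lemma rint_meas1 (F : T1 * T2 -> R) : Lone (m1 \x m2)%E F ->
  measurable_fun setT (fun x => \int[m2]_y F (x, y)).
Proof.
move=> iF; apply: (@measurableT_comp _ _ _ _ _ _ fine) => //.
exact: (measurable_fubini_F iF).
Qed.

Lemma rint_meas2 (F : T1 * T2 -> R) : Lone (m1 \x m2)%E F ->
  measurable_fun setT (fun y => \int[m1]_x F (x, y)).
Proof.
move=> iF; apply: (@measurableT_comp _ _ _ _ _ _ fine) => //.
exact: (measurable_fubini_G iF).
Qed.

Lemma cint_Fubini1 (f : T1 * T2 -> R[i]) : cintegrable (m1 \x m2)%E f ->
  cint m1 (fun x => cint m2 (fun y => f (x, y))) = cint (m1 \x m2)%E f.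
Proof.
move=> if_; apply: complexP; rewrite /cint /=; apply: rint_Fubini1.
  exact: cintegrable_Re.
exact: cintegrable_Im.
Qed.

Lemma cint_Fubini2 (f : T1 * T2 -> R[i]) : cintegrable (m1 \x m2)%E f ->
  cint m2 (fun y => cint m1 (fun x => f (x, y))) = cint (m1 \x m2)%E f.
Proof.
move=> if_; apply: complexP; rewrite /cint /=; apply: rint_Fubini2.
  exact: cintegrable_Re.
exact: cintegrable_Im.
Qed.

Lemma cint_Fubini (f : T1 * T2 -> R[i]) : cintegrable (m1 \x m2)%E f ->
  cint m1 (fun x => cint m2 (fun y => f (x, y))) =
  cint m2 (fun y => cint m1 (fun x => f (x, y))).
Proof. by move=> if_; rewrite cint_Fubini1// cint_Fubini2. Qed.

Lemma cmeas_cint1 (f : T1 * T2 -> R[i]) : cintegrable (m1 \x m2)%E f ->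
  cmeas (fun x => cint m2 (fun y => f (x, y))).
Proof.
move=> if_; split; rewrite /cint /=.
  exact: (rint_meas1 (cintegrable_Re if_)).
exact: (rint_meas1 (cintegrable_Im if_)).
Qed.

Lemma cmeas_cint2 (f : T1 * T2 -> R[i]) : cintegrable (m1 \x m2)%E f ->
  cmeas (fun y => cint m1 (fun x => f (x, y))).
Proof.
move=> if_; split; rewrite /cint /=.
  exact: (rint_meas2 (cintegrable_Re if_)).
exact: (rint_meas2 (cintegrable_Im if_)).
Qed.

End cFubini.

Lemma powR_expln (R : realType) (a x : R) : 0 < a -> a `^ x = expR (x * ln a).
Proof. by move=> a0; rewrite /powR gt_eqF. Qed.

(** * Hölder's inequality and log-convexity of power integrals *)

Section Hoelder.
Context {R : realType} {d : measure_display} {T : measurableType d}.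
Variable mu : {measure set T -> \bar R}.
Implicit Types (F G : T -> R) (p q a b t e : R).

Lemma measurable_funpowR F e : measurable_fun setT F ->
  measurable_fun setT (fun x => F x `^ e).
Proof. by move=> mF; apply: (measurableT_comp (measurable_powR e)). Qed.

Lemma Lnorm_rint F p : (forall x, 0 <= F x) -> Lone mu (fun x => F x `^ p) ->
  Lnorm mu p%:E (EFin \o F) = ((\int[mu]_x (F x `^ p)) `^ p^-1)%:E.
Proof.
move=> F0 iF; rewrite unlock -poweR_EFin rint_EFin; last exact: iF.
congr poweR; by apply: eq_integral => x _ /=; rewrite ger0_norm.
Qed.

Lemma Lone_hoelder F G p q : 0 < p -> 0 < q -> p^-1 + q^-1 = 1 ->
  measurable_fun setT F -> measurable_fun setT G ->
  (forall x, 0 <= F x) -> (forall x, 0 <= G x) ->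
  Lone mu (fun x => F x `^ p) -> Lone mu (fun x => G x `^ q) ->
  Lone mu (fun x => F x * G x).
Proof.
move=> p0 q0 pq mF mG F0 G0 iF iG.
apply: (@le_Lone _ _ _ _ _ (fun x => p^-1 * F x `^ p + q^-1 * G x `^ q)).
- exact: measurable_funM.
- move=> x; rewrite ger0_norm ?mulr_ge0//.
  by have := conjugate_powR (F0 x) (G0 x) p0 q0 pq; rewrite ![_ / _]mulrC.
- by apply: LoneD; exact: LoneZ.
Qed.

Lemma rint_hoelder F G p q : 0 < p -> 0 < q -> p^-1 + q^-1 = 1 ->
  measurable_fun setT F -> measurable_fun setT G ->
  (forall x, 0 <= F x) -> (forall x, 0 <= G x) ->
  Lone mu (fun x => F x `^ p) -> Lone mu (fun x => G x `^ q) ->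
  \int[mu]_x (F x * G x) <=
    (\int[mu]_x (F x `^ p)) `^ p^-1 * (\int[mu]_x (G x `^ q)) `^ q^-1.
Proof.
move=> p0 q0 pq mF mG F0 G0 iF iG.
have iFG := Lone_hoelder p0 q0 pq mF mG F0 G0 iF iG.
have := hoelder mu mF mG p0 q0 pq; rewrite (Lnorm_rint F0)// (Lnorm_rint G0)//.
have -> : Lnorm mu 1 (EFin \o (F \* G)%R) = (\int[mu]_x (F x * G x))%:E.
  rewrite Lnorm1 rint_EFin//; apply: eq_integral => x _ /=.
  by rewrite ger0_norm// mulr_ge0.
by rewrite -EFinM lee_fin.
Qed.

(** The weights [a] and [b] are the inverse exponents; [P] and [Q] let the caller supply the
    integrands already simplified. *)
Lemma rint_hoelder_eq F G P Q a b : 0 < a -> 0 < b -> a + b = 1 ->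
  measurable_fun setT F -> measurable_fun setT G ->
  (forall x, 0 <= F x) -> (forall x, 0 <= G x) ->
  (forall x, F x `^ a^-1 = P x) -> (forall x, G x `^ b^-1 = Q x) ->
  Lone mu P -> Lone mu Q ->
  \int[mu]_x (F x * G x) <= (\int[mu]_x P x) `^ a * (\int[mu]_x Q x) `^ b.
Proof.
move=> a0 b0 ab mF mG F0 G0 /funext EP /funext EQ.
case: _ / EP; case: _ / EQ => iP iQ.
have p0 : 0 < a^-1 by rewrite invr_gt0.
have q0 : 0 < b^-1 by rewrite invr_gt0.
have pq : a^-1^-1 + b^-1^-1 = 1 by rewrite !invrK.
by have := rint_hoelder p0 q0 pq mF mG F0 G0 iP iQ; rewrite (invrK a) (invrK b).
Qed.

Lemma powR_interp (x a b t : R) : 0 <= t < 1 -> 0 < a -> 0 < b -> 0 <= x ->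
  x `^ (a * (1 - t) + b * t) = x `^ (a * (1 - t)) * x `^ (b * t).
Proof.
(* Since 0^0 = 1, the power rule can fail at base 0 when the exponents add up to 0; here their sum
   is positive. *)
move=> /andP[t0 t1] a0 b0 x0; rewrite powRD//; apply/implyP => /eqP e.
have a1 : 0 < a * (1 - t) by rewrite mulr_gt0// subr_gt0.
have b1 : 0 <= b * t by rewrite mulr_ge0// ltW.
lra.
Qed.

(** Lyapunov's inequality, from Hölder with weights 1 - t and t. The value t = 0 is separate because
    0 is not an admissible weight. *)
Lemma rint_interp F a b t : 0 <= t < 1 -> 0 < a -> 0 < b ->
  measurable_fun setT F -> (forall x, 0 <= F x) ->
  Lone mu (fun x => F x `^ a) -> Lone mu (fun x => F x `^ b) ->
  \int[mu]_x (F x `^ (a * (1 - t) + b * t)) <=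
    (\int[mu]_x (F x `^ a)) `^ (1 - t) * (\int[mu]_x (F x `^ b)) `^ t.
Proof.
move=> t01 a0 b0 mF F0 ia ib; have /andP[t0 t1] := t01.
have [->|tn0] := eqVneq t 0.
  rewrite subr0 mulr1 mulr0 addr0 powRr1; last by apply: rint_ge0 => x; exact: powR_ge0.
  by rewrite powRr0 mulr1.
have {}t0 : 0 < t by rewrite lt_neqAle eq_sym tn0.
have s0 : 0 < 1 - t by lra.
under eq_Rintegral do rewrite powR_interp//.
apply: rint_hoelder_eq => //.
- by rewrite subrK.
- exact: measurable_funpowR.
- exact: measurable_funpowR.
- by move=> x; exact: powR_ge0.
- by move=> x; exact: powR_ge0.
- by move=> x; rewrite -powRrM -mulrA mulfV ?mulr1// gt_eqF.
- by move=> x; rewrite -powRrM -mulrA mulfV ?mulr1// gt_eqF.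
Qed.

End Hoelder.

Section bounded_functions.
Context {R : realType} {d : measure_display} {T : measurableType d}.
Variable mu : {finite_measure set T -> \bar R}.
Local Notation normc := Normc.normc.

Definition bounded_meas (F : T -> R) :=
  measurable_fun setT F /\ exists C, forall x, `|F x| <= C.

Definition cbounded_meas (f : T -> R[i]) :=
  cmeas f /\ exists C, forall x, normc (f x) <= C.

Lemma bounded_Lone F : bounded_meas F -> Lone mu F.
Proof.
move=> [mF [C FC]]; apply: (le_Lone mF FC).
exact: finite_measure_integrable_cst.
Qed.

Lemma bounded_measM F G : bounded_meas F -> bounded_meas G ->
  bounded_meas (fun x => F x * G x).
Proof.
move=> [mF [C FC]] [mG [D GD]]; split; first exact: measurable_funM.
by exists (C * D) => x; rewrite normrM ler_pM.
Qed.

Lemma bounded_meas_powR F (e : R) : 0 <= e -> (forall x, 0 <= F x) ->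
  bounded_meas F -> bounded_meas (fun x => F x `^ e).
Proof.
move=> e0 F0 [mF [C FC]]; split; first exact: measurable_funpowR.
exists (C `^ e) => x; rewrite ger0_norm ?powR_ge0//.
have FxC : F x <= C by rewrite (le_trans _ (FC x))// ler_norm.
by rewrite ge0_ler_powR// nnegrE ?(le_trans (F0 x) FxC).
Qed.

Lemma cbounded_normc f : cbounded_meas f -> bounded_meas (fun x => normc (f x)).
Proof.
move=> [mf [C fC]]; split; first exact: measurable_normc.
by exists C => x; rewrite ger0_norm ?normc_ge0.
Qed.

Lemma cbounded_cintegrable f : cbounded_meas f -> cintegrable mu f.
Proof. by move=> bf; split; [exact: bf.1|exact/bounded_Lone/cbounded_normc]. Qed.

Lemma cbounded_measM f g : cbounded_meas f -> cbounded_meas g ->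
  cbounded_meas (fun x => f x * g x).
Proof.
move=> [mf [C fC]] [mg [D gD]]; split; first exact: cmeasM.
by exists (C * D) => x; rewrite Normc.normcM ler_pM ?normc_ge0.
Qed.

Lemma cbounded_real F : bounded_meas F -> cbounded_meas (fun x => (F x)%:C).
Proof.
move=> [mF [C FC]]; split; first exact: cmeas_real.
by exists C => x; rewrite normc_real.
Qed.

Lemma cbounded_conj f : cbounded_meas f -> cbounded_meas (fun x => (conjc (f x))).
Proof.
move=> [mf [C fC]]; split; first exact: cmeas_conj.
by exists C => x; rewrite normc_conj.
Qed.

Lemma bounded_lone_powR f (e : R) : 0 <= e -> cbounded_meas f ->
  Lone mu (fun x => normc (f x) `^ e).
Proof.
move=> e0 bf; apply/bounded_Lone/bounded_meas_powR => //.
  by move=> x; exact: normc_ge0.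
exact: cbounded_normc.
Qed.

End bounded_functions.

Fact lpow_key : unit. Proof. exact: tt. Qed.

Section lpow.
Context {R : realType} {d : measure_display} {T : measurableType d}.
Variable mu : {measure set T -> \bar R}.
Implicit Types (q : R) (f : T -> R[i]).

Definition lpow : R -> (T -> R[i]) -> R :=
  locked_with lpow_key (fun q f => \int[mu]_x (Normc.normc (f x) `^ q)).

Lemma lpowE q f : lpow q f = \int[mu]_x (Normc.normc (f x) `^ q).
Proof. by rewrite /lpow unlock. Qed.

Lemma lpow_ge0 q f : 0 <= lpow q f.
Proof. by rewrite lpowE; apply: rint_ge0 => x; exact: powR_ge0. Qed.

End lpow.
Arguments lpowE {R d T mu} q f.
Arguments lpow_ge0 {R d T mu} q f.

Lemma eq_ler (R : numDomainType) (x y : R) : x = y -> x <= y.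
Proof. by move=> ->. Qed.

Lemma conj_exponent (R : realType) (q : R) : 2 < q ->
  [/\ 0 < q, 0 < q - 1, 0 < q / (q - 1), q / (q - 1) < 2 &
      (q / (q - 1))^-1 + q^-1 = 1].
Proof.
move=> q2; have q0 : 0 < q by lra.
have q10 : 0 < q - 1 by lra.
split => //; first by rewrite divr_gt0.
  by rewrite ltr_pdivrMr//; lra.
by field; rewrite !gt_eqF.
Qed.

(* Sealed, since conversion would otherwise unfold the iterates. *)
Fact kop_key : unit. Proof. exact: tt. Qed.
Fact dual_map_key : unit. Proof. exact: tt. Qed.

(** * Interpolation for symmetric kernels *)

Section interpolation.
Context {R : realType} {d : measure_display} {T : measurableType d}.
Variable mu : {finite_measure set T -> \bar R}.
Variables (k : T -> T -> R[i]) (M : R).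
Local Notation normc := Normc.normc.
Hypothesis M0 : 0 < M.
Hypothesis mk : cmeas (fun z : T * T => k z.1 z.2).
Hypothesis kM : forall x y, normc (k x y) <= M.
Hypothesis ksym : forall x y, k x y = k y x.

Implicit Types (f g : T -> R[i]) (q : R).

Definition kop : (T -> R[i]) -> T -> R[i] :=
  locked_with kop_key (fun f x => cint mu (fun y => k x y * f y)).

Lemma kopE f x : kop f x = cint mu (fun y => k x y * f y).
Proof. by rewrite /kop unlock. Qed.

Hypothesis kL2 : forall f, cbounded_meas f ->
  \int[mu]_x (normc (kop f x) `^ 2) <= \int[mu]_x (normc (f x) `^ 2).

Lemma kop_bounded_kernel f x : cbounded_meas f ->
  cbounded_meas (fun y => k x y * f y).
Proof.
move=> bf; apply: cbounded_measM => //; split; last by exists M.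
apply: (@cmeas_comp _ _ _ _ _ (fun y => (x, y)) (fun z : T * T => k z.1 z.2)) => //.
exact: measurable_pair1.
Qed.

Lemma kop_prod f g : cbounded_meas f -> cbounded_meas g ->
  cintegrable (mu \x mu)%E (fun z : T * T => g z.1 * (k z.1 z.2 * f z.2)).
Proof.
move=> [mf [C fC]] [mg [D gD]].
apply: (@le_cintegrable _ _ _ _ _ (fun=> D * (M * C))).
- apply: cmeasM; first by apply: cmeas_comp => //; exact: measurable_fst.
  by apply: cmeasM => //; apply: cmeas_comp => //; exact: measurable_snd.
- move=> z; rewrite !Normc.normcM; apply: ler_pM => //; rewrite ?normc_ge0//.
    by rewrite mulr_ge0// normc_ge0.
  by apply: ler_pM => //; rewrite normc_ge0.
- apply/integrable12ltyP; first exact: measurable_cst.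
  under eq_integral do rewrite /= integral_cst//.
  rewrite integral_cst//; have muT : (mu setT < +oo)%E by rewrite -ge0_fin_numE// fin_num_measure.
  by rewrite -muleA lte_mul_pinfty// lte_mul_pinfty//; exact: fin_num_measure.
Qed.

Lemma kop_sup f x : cbounded_meas f ->
  normc (kop f x) <= M * \int[mu]_y normc (f y).
Proof.
move=> bf; have bk := kop_bounded_kernel x bf.
rewrite kopE; apply: (le_trans (normc_cint (cbounded_cintegrable mu bk))).
have iN : Lone mu (fun y => normc (f y)) by exact/bounded_Lone/cbounded_normc.
rewrite -rintZ//; apply: le_rint.
- exact/bounded_Lone/cbounded_normc.
- exact: LoneZ.
- by move=> y; rewrite Normc.normcM ler_wpM2r ?normc_ge0.
Qed.

Lemma kop_bounded f : cbounded_meas f -> cbounded_meas (kop f).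
Proof.
move=> bf; have b1 : cbounded_meas (cst 1 : T -> R[i]).
  by split; [exact: cmeas_cst|exists 1 => x; rewrite Normc.normc1].
split.
  have := cmeas_cint1 (kop_prod bf b1); congr cmeas.
  by apply/funext => x; rewrite kopE; congr cint; apply/funext => y /=; rewrite mul1r.
by exists (M * \int[mu]_y normc (f y)) => x; exact: kop_sup.
Qed.

(** The pairing is bilinear, without conjugation, so a symmetric kernel is its own transpose and the
    iteration below stays with the single operator [kop]. *)
Lemma kop_sym f g : cbounded_meas f -> cbounded_meas g ->
  cint mu (fun x => g x * kop f x) = cint mu (fun x => f x * kop g x).
Proof.
move=> bf bg.
transitivity (cint mu (fun x => cint mu (fun y => g x * (k x y * f y)))).
  congr cint; apply/funext => x; rewrite kopE cintZ//.
  exact/cbounded_cintegrable/kop_bounded_kernel.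
rewrite (cint_Fubini (kop_prod bf bg)); congr cint; apply/funext => y.
rewrite kopE -cintZ; last exact/cbounded_cintegrable/kop_bounded_kernel.
by congr cint; apply/funext => x /=; rewrite ksym; ring.
Qed.

Lemma kopZ z f : cbounded_meas f -> kop (fun x => z * f x) = fun x => z * kop f x.
Proof.
move=> bf; apply/funext => x; rewrite !kopE -cintZ; last first.
  exact/cbounded_cintegrable/kop_bounded_kernel.
by congr cint; apply/funext => y; ring.
Qed.

Local Notation lpow := (lpow mu).
Local Notation A q f := (lpow q (kop f)).
Local Notation J f := (lpow 2 f).

(** The extremal of Hölder's inequality for [kop f]: paired with [kop f] it gives the L_q norm of
    [kop f], and the last factor normalizes it in L_p, because (q - 1) p = q. *)
Definition dual_map : R -> (T -> R[i]) -> T -> R[i] :=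
  locked_with dual_map_key (fun q f x => (conjc (kop f x)) *
    (normc (kop f x) `^ (q - 2) * A q f `^ (- ((q - 1) / q)))%:C).

Lemma dual_mapE q f x : dual_map q f x =
  (conjc (kop f x)) * (normc (kop f x) `^ (q - 2) * A q f `^ (- ((q - 1) / q)))%:C.
Proof. by rewrite /dual_map unlock. Qed.

(* The Riesz-Thorin bound from [L_p] to [L_q], [p = q / (q - 1)], for a symmetric
   kernel bounded by [M] that is a contraction of [L_2]. It is proved without complex
   interpolation: [dual_map] sends the unit sphere of [L_p] to itself and does
   not decrease the [L_q] norm of the image, whereas if the bound failed at [f],
   the [L_2] norm would decay geometrically along its iterates at [f]; on a
   finite measure space, that norm is bounded below on the unit sphere of [L_p]. *)
Definition interpolates q := forall f, cbounded_meas f ->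
  lpow q (kop f) <= M `^ (q - 2) * lpow (q / (q - 1)) f `^ (q - 1).

Lemma normc_dual_map q f x : 2 < q -> normc (dual_map q f x) =
  normc (kop f x) `^ (q - 1) * A q f `^ (- ((q - 1) / q)).
Proof.
move=> q2; rewrite dual_mapE Normc.normcM normc_conj normc_real ger0_norm ?mulr_ge0 ?powR_ge0//.
rewrite mulrA (_ : q - 2 = q - 1 - 1); last by ring.
by rewrite mulr_powRB1//; [exact: normc_ge0|lra].
Qed.

Lemma dual_map_bounded q f : 2 < q -> cbounded_meas f -> cbounded_meas (dual_map q f).
Proof.
move=> q2 bf; have bk := kop_bounded bf.
rewrite (funext (dual_mapE q f)); apply: cbounded_measM; first exact: cbounded_conj.
apply: cbounded_real; apply: bounded_measM.
  apply: bounded_meas_powR; [lra|by move=> x; exact: normc_ge0|].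
  exact: cbounded_normc.
split; first exact: measurable_cst.
by exists `|A q f `^ (- ((q - 1) / q))| => x.
Qed.

Lemma dual_map_power q f (e : R) : 2 < q -> 0 < A q f -> cbounded_meas f -> 0 <= e ->
  lpow e (dual_map q f) =
  A q f `^ (- ((q - 1) * e / q)) * lpow ((q - 1) * e) (kop f).
Proof.
move=> q2 A0 bf e0; have [q0 q10 _ _ _] := conj_exponent q2.
rewrite (lpowE e) (lpowE ((q - 1) * e)) -rintZ; last first.
  by apply: bounded_lone_powR; [by rewrite mulr_ge0// ltW|exact: kop_bounded].
apply: eq_Rintegral => x _; rewrite normc_dual_map// powRM ?powR_ge0//.
rewrite -!powRrM mulrC; congr (_ `^ _ * _).
by field; rewrite gt_eqF.
Qed.

Lemma dual_map_unit q f : 2 < q -> 0 < A q f -> cbounded_meas f ->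
  lpow (q / (q - 1)) (dual_map q f) = 1.
Proof.
move=> q2 A0 bf; have [q0 q10 p0 _ _] := conj_exponent q2.
rewrite dual_map_power//; last exact: ltW.
rewrite (_ : (q - 1) * (q / (q - 1)) = q); last by field; rewrite gt_eqF.
by rewrite divff ?gt_eqF// powR_inv1 ?ltW// mulVf// gt_eqF.
Qed.

(** The pairing of [dual_map q f] with [kop f] is the L_q norm of [kop f]; by symmetry it is also
    the pairing of [f] with [kop (dual_map q f)], which Hölder bounds by the next L_q norm since [f]
    is a unit vector. *)
Lemma dual_map_incr q f : 2 < q -> 0 < A q f -> cbounded_meas f ->
  lpow (q / (q - 1)) f = 1 -> A q f <= A q (dual_map q f).
Proof.
move=> q2 A0 bf f1; have [q0 q10 p0 _ pq] := conj_exponent q2.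
have bd := dual_map_bounded q2 bf; have bkd := kop_bounded bd.
have bk := kop_bounded bf.
have E : cint mu (fun x => dual_map q f x * kop f x) = (A q f `^ q^-1)%:C.
  transitivity (cint mu (fun x => (A q f `^ (- ((q - 1) / q)) * normc (kop f x) `^ q)%:C)).
    congr cint; apply/funext => x; rewrite dual_mapE mulrAC (mulrC (conjc _)) mulcJ.
    rewrite -rmorphM/=; congr (_%:C); rewrite mulrA mulrC; congr (_ * _).
    rewrite -[_ ^+ 2]powR_mulrn ?normc_ge0// -powRD; last by apply/implyP => /eqP; lra.
    by congr powR; ring.
  rewrite cint_real rintZ; last by apply: bounded_lone_powR => //; exact: ltW.
  congr (_%:C); rewrite -lpowE -{2}[A q f]powRr1 ?ltW// -powRD.
    by congr powR; field; rewrite gt_eqF.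
  by rewrite (gt_eqF A0) implybT.
have := congr1 (fun z => normc z) E; rewrite (kop_sym bf bd) normc_real (ger0_norm (powR_ge0 _ _)) => {}E.
have h : A q f `^ q^-1 <= A q (dual_map q f) `^ q^-1.
  have iE : cintegrable mu (fun x => f x * kop (dual_map q f) x).
    exact: (cbounded_cintegrable mu (cbounded_measM bf bkd)).
  rewrite -E; apply: (le_trans (normc_cint iE)).
  under eq_Rintegral do rewrite Normc.normcM.
  rewrite lpowE in f1; rewrite (lpowE _ (kop (dual_map q f))).
  have := @rint_hoelder _ _ _ mu (fun x => normc (f x))
    (fun x => normc (kop (dual_map q f) x)) _ _ p0 q0 pq.
  rewrite f1 powR1 mul1r; apply.
  - by apply: measurable_normc; exact: bf.1.
  - by apply: measurable_normc; exact: bkd.1.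
  - by move=> x; exact: normc_ge0.
  - by move=> x; exact: normc_ge0.
  - by apply: bounded_lone_powR => //; exact: ltW.
  - by apply: bounded_lone_powR => //; exact: ltW.
have Ag0 : 0 <= A q (dual_map q f) by exact: lpow_ge0.
have := ge0_ler_powR (ltW q0) _ _ h; rewrite !nnegrE !powR_ge0 -!powRrM mulVf ?gt_eqF//.
by rewrite (powRr1 (ltW A0)) (powRr1 Ag0) => /(_ isT isT).
Qed.

(** Hölder against the constant 1 with weights p/2 and 1 - p/2: as p < 2 and the measure is finite,
    the L_2 norm controls the L_p norm. *)
Lemma unit_lower_bound q f : 2 < q -> cbounded_meas f ->
  lpow (q / (q - 1)) f = 1 ->
  1 <= J f `^ (q / (q - 1) / 2) * (\int[mu]_x (1 : R)) `^ (1 - q / (q - 1) / 2).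
Proof.
move=> q2 bf f1; have [_ _ p0 p2 _] := conj_exponent q2.
rewrite lpowE in f1; rewrite lpowE.
set p := q / (q - 1) in f1 p0 p2 *.
have t1 : 0 < p / 2 by rewrite divr_gt0.
have t2 : 0 < 1 - p / 2 by lra.
have := @rint_hoelder _ _ _ mu (fun x => normc (f x) `^ p) (cst 1) (p / 2)^-1
  (1 - p / 2)^-1.
have -> : (fun x => (normc (f x) `^ p) `^ (p / 2)^-1) = fun x => normc (f x) `^ 2.
  by apply/funext => x; rewrite -powRrM; congr powR; field; rewrite gt_eqF.
have -> : (fun x : T => (cst 1 x : R) `^ (1 - p / 2)^-1) = cst 1.
  by apply/funext => x; rewrite powR1.
have -> : (fun x => normc (f x) `^ p * cst 1 x) = fun x => normc (f x) `^ p.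
  by apply/funext => x; rewrite mulr1.
rewrite f1 !invr_gt0 !invrK; apply => //.
- by rewrite addrC subrK.
- by apply: measurable_funpowR; apply: measurable_normc; exact: bf.1.
- by move=> x; exact: powR_ge0.
- by apply: bounded_lone_powR.
- exact: finite_measure_integrable_cst.
Qed.

(** Hölder against 1 makes the L_1 norm of [f] vanish, and the kernel is bounded. *)
Lemma kop_zero q f : 2 < q -> cbounded_meas f ->
  lpow (q / (q - 1)) f = 0 -> kop f = fun=> 0.
Proof.
move=> q2 bf f0; have [q0 q10 p0 _ pq] := conj_exponent q2.
rewrite lpowE in f0.
have h : \int[mu]_x normc (f x) <= 0.
  have := @rint_hoelder _ _ _ mu (fun x => normc (f x)) (cst 1) _ _ p0 q0 pq.
  have -> : (fun x => normc (f x) * cst 1 x) = fun x => normc (f x).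
    by apply/funext => x; rewrite mulr1.
  have -> : (fun x : T => (cst 1 x : R) `^ q) = cst 1.
    by apply/funext => x; rewrite powR1.
  rewrite f0 powR0 ?mul0r; last by rewrite invr_eq0 gt_eqF.
  apply => //.
  - by apply: measurable_normc; exact: bf.1.
  - by move=> x; exact: normc_ge0.
  - by apply: bounded_lone_powR => //; exact: ltW.
  - exact: finite_measure_integrable_cst.
apply/funext => x; apply/eqP; rewrite -normc_eq0 eq_le normc_ge0 andbT.
by apply: (le_trans (kop_sup x bf)); rewrite pmulr_rle0.
Qed.

(** The L_2 norm of [dual_map q g] involves [kop g] with exponent 2(q - 1) > q. It is estimated
    through a norm of [g], and when [g] is itself [dual_map q f] this is a norm of [kop f] with
    exponent in [2, q), where the L_2 contraction can enter. Hence the step of length two. *)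
Lemma two_step_interpolates q (e : R) : 2 < q -> 0 < e ->
  (forall f, cbounded_meas f ->
    lpow (q / (q - 1)) f = 1 -> 0 < A q f ->
    J (dual_map q (dual_map q f)) <= (M `^ (q - 2) / A q f) `^ e * J f) ->
  interpolates q.
Proof.
move=> q2 e0 step; have [q0 q10 p0 p2 pq] := conj_exponent q2.
have unit_case f : cbounded_meas f ->
    lpow (q / (q - 1)) f = 1 -> A q f <= M `^ (q - 2).
  move=> bf f1; rewrite leNgt; apply/negP => AB.
  have B0 : 0 < M `^ (q - 2) by exact: powR_gt0.
  have A0 : 0 < A q f by exact: lt_trans AB.
  set rho := (M `^ (q - 2) / A q f) `^ e.
  have rho0 : 0 <= rho by exact: powR_ge0.
  have rho1 : rho < 1.
    rewrite -[ltRHS](_ : 1 `^ e = 1); last by rewrite powR1.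
    apply: gt0_ltr_powR => //; rewrite ?nnegrE ?ler01 ?divr_ge0 ?ltW//.
    by rewrite ltr_pdivrMr// mul1r.
  pose fk i := iter i (fun g => dual_map q (dual_map q g)) f.
  have fkP i : [/\ cbounded_meas (fk i),
      lpow (q / (q - 1)) (fk i) = 1,
      A q f <= A q (fk i) & J (fk i) <= rho ^+ i * J f].
    elim: i => [|i [bi i1 Ai Ji]]; first by rewrite expr0 mul1r; split; [exact: bf|exact: f1|exact: lexx|exact: lexx].
    have Ai0 := lt_le_trans A0 Ai.
    have b1 := dual_map_bounded q2 bi.
    have A1 := dual_map_incr q2 Ai0 bi i1.
    have A10 := lt_le_trans Ai0 A1.
    have u1 := dual_map_unit q2 Ai0 bi.
    split => /=.
    - exact: dual_map_bounded.
    - exact: dual_map_unit.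
    - by rewrite (le_trans Ai)// (le_trans A1)// dual_map_incr.
    (* The L_q norms of the images do not decrease along the iterates, so the initial ratio [rho]
       bounds every later contraction factor. *)
    - apply: (le_trans (step _ bi i1 Ai0)); rewrite exprS -mulrA ler_pM ?powR_ge0//.
        by exact: lpow_ge0.
      apply: ge0_ler_powR; rewrite ?nnegrE.
      + exact: ltW.
      + by apply: divr_ge0; exact: ltW.
      + by apply: divr_ge0; exact: ltW.
      by rewrite ler_pM2l// lef_pV2// posrE.
  set m := (\int[mu]_x (1 : R)) `^ (1 - q / (q - 1) / 2).
  set p := q / (q - 1) / 2.
  have p'0 : 0 < p by rewrite divr_gt0.
  have lb i : m^-1 <= (rho ^+ i * J f) `^ p.
    have [bi i1 _ Ji] := fkP i.
    have := unit_lower_bound q2 bi i1; rewrite -/m -/p => h.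
    have m0 : 0 < m.
      rewrite lt_neqAle powR_ge0 andbT eq_sym; apply/eqP => m0.
      by move: h; rewrite m0 mulr0 ler10.
    rewrite -[m^-1]mul1r ler_pdivrMr// (le_trans h)// ler_pM2r//.
    have J0 : 0 <= J (fk i) by exact: lpow_ge0.
    apply: ge0_ler_powR => //; first exact: ltW.
    by rewrite nnegrE (le_trans J0 Ji).
  have m0 : 0 < m^-1.
    rewrite invr_gt0 lt_neqAle powR_ge0 andbT eq_sym; apply/eqP => m0.
    by move: (unit_lower_bound q2 bf f1); rewrite -/m m0 mulr0 ler10.
  have cv : rho ^+ i * J f @[i --> \oo] --> 0 * J f.
    by apply: cvgMl; apply: cvg_expr; rewrite ger0_norm.
  rewrite mul0r in cv.
  have d0 : 0 < m^-1 `^ p^-1 by exact: powR_gt0.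
  have /cvgrPdist_lt/(_ _ d0)[N _ /(_ N (leqnn _))] := cv.
  have J0 : 0 <= J f by exact: lpow_ge0.
  rewrite sub0r normrN ger0_norm ?mulr_ge0 ?exprn_ge0// ltNge => /negP; apply.
  have := ge0_ler_powR (_ : 0 <= p^-1) _ _ (lb N).
  rewrite invr_ge0 !nnegrE powR_ge0 (ltW p'0) (ltW m0) => /(_ isT isT isT).
  by rewrite -powRrM divff ?gt_eqF// powRr1// mulr_ge0 ?exprn_ge0.
move=> f bf; set I := lpow (q / (q - 1)) f.
have I0 : 0 <= I by exact: lpow_ge0.
have [I0'|In0] := eqVneq I 0.
  rewrite [A q f](_ : _ = 0).
    by rewrite mulr_ge0 ?powR_ge0.
  rewrite lpowE (kop_zero q2 bf I0') Normc.normc0 powR0 ?gt_eqF//.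
  by rewrite /Rintegral integral0.
have {}I0 : 0 < I by rewrite lt_neqAle eq_sym In0.
(* The factor that brings [f] to the unit sphere of L_p; the claim is homogeneous of degree q on
   both sides. *)
set l := I `^ (- (q / (q - 1))^-1).
have l0 : 0 < l by exact: powR_gt0.
have bl : cbounded_meas (fun x => l%:C * f x).
  apply: cbounded_measM => //; split; first exact: cmeas_cst.
  by exists l => x; rewrite normc_real ger0_norm// ltW.
have := unit_case _ bl.
have -> : lpow (q / (q - 1)) (fun x => l%:C * f x) = 1.
  rewrite lpowE; under eq_Rintegral do rewrite Normc.normcM normc_real ger0_norm ?(ltW l0)// powRM ?normc_ge0 ?(ltW l0)//.
  rewrite rintZ; last by apply: bounded_lone_powR => //; exact: ltW.
  by rewrite -lpowE -/I -powRrM mulNr mulVf ?gt_eqF// powR_inv1 ?(ltW I0)// mulVf.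
have -> : A q (fun x => l%:C * f x) = l `^ q * A q f.
  rewrite !lpowE kopZ// -rintZ; last first.
    by apply: bounded_lone_powR; [exact: ltW|exact: kop_bounded].
  apply: eq_Rintegral => x _.
  by rewrite Normc.normcM normc_real ger0_norm ?(ltW l0)// powRM ?normc_ge0 ?(ltW l0).
move=> /(_ erefl); rewrite mulrC -ler_pdivlMr ?powR_gt0//.
move=> /le_trans; apply; rewrite -powRN -powRrM; apply: eq_ler; congr (_ * _ `^ _).
by field; rewrite !gt_eqF.
Qed.

Lemma ger_powR_neg (a b x : R) : 0 < a -> a <= b -> x <= 0 -> b `^ x <= a `^ x.
Proof.
move=> a0 ab x0; have b0 := lt_le_trans a0 ab.
by rewrite !powR_expln// ler_expR ler_wnM2l// ler_ln.
Qed.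

Lemma unit_sqint_gt0 q f : 2 < q -> cbounded_meas f ->
  lpow (q / (q - 1)) f = 1 -> 0 < J f.
Proof.
move=> q2 bf f1; have [_ _ p0 _ _] := conj_exponent q2.
rewrite lt_neqAle lpow_ge0 andbT eq_sym; apply/eqP => J0.
have := unit_lower_bound q2 bf f1.
by rewrite J0 powR0 ?mul0r ?ler10// gt_eqF// divr_gt0.
Qed.

Lemma kop_Lone f (e : R) : 0 <= e -> cbounded_meas f ->
  Lone mu (fun x => normc (kop f x) `^ e).
Proof. by move=> e0 /kop_bounded; exact: bounded_lone_powR. Qed.

Lemma lpow_kop_interp f (a b t : R) : 0 <= t < 1 -> 0 < a -> 0 < b ->
  cbounded_meas f ->
  lpow (a * (1 - t) + b * t) (kop f) <= A a f `^ (1 - t) * A b f `^ t.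
Proof.
move=> t01 a0 b0 bf; have bk := kop_bounded bf.
rewrite !lpowE; apply: (rint_interp t01 a0 b0).
- by apply: measurable_normc; exact: bk.1.
- by move=> x; exact: normc_ge0.
- by apply: kop_Lone => //; exact: ltW.
- by apply: kop_Lone => //; exact: ltW.
Qed.

(** For q >= 3 the exponent q - 1 lies in [2, q). The L_1 norm of [g], which is a power integral of
    [kop f] with this exponent, thus interpolates between L_2 and L_q, and the bound [M] of the
    kernel turns it into a supremum bound for [kop g]. *)
Lemma interpolates_ge3 q : 3 <= q -> interpolates q.
Proof.
move=> q3; have q2 : 2 < q by lra.
have [q0 q10 p0 p2 pq] := conj_exponent q2.
apply: (@two_step_interpolates q 1 q2 ltr01) => f bf f1 A0.
have J0 := unit_sqint_gt0 q2 bf f1.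
have bg := dual_map_bounded q2 bf.
have nm := dual_map_incr q2 A0 bf f1.
have m0 := lt_le_trans A0 nm.
set g := dual_map q f in bg nm m0 *.
have q20 : 0 < q - 2 by lra.
(* The solution of q - 1 = 2 (1 - t) + q t. *)
pose t := (q - 3) / (q - 2).
have t01 : 0 <= t < 1.
  by apply/andP; split; [apply: divr_ge0; lra|rewrite ltr_pdivrMr//; lra].
have h1 : \int[mu]_x normc (g x) <=
    A q f `^ (- ((q - 1) / q)) * (J f `^ (1 - t) * A q f `^ t).
  have -> : \int[mu]_x normc (g x) = lpow 1 g.
    by rewrite lpowE; apply: eq_Rintegral => x _; rewrite powRr1// normc_ge0.
  rewrite dual_map_power// !mulr1 ler_wpM2l ?powR_ge0//.
  have -> : q - 1 = 2 * (1 - t) + q * t by rewrite /t; field; rewrite gt_eqF.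
  apply: (le_trans (lpow_kop_interp t01 (ltr0n R 2) q0 bf)).
  rewrite ler_wpM2r ?powR_ge0//.
  have /andP[_ t1] := t01; apply: ge0_ler_powR; rewrite ?nnegrE ?lpow_ge0//; first by lra.
  by rewrite !lpowE; exact: kL2.
(* A supremum bound for [kop g]; it is spent on the q - 2 surplus powers in 2(q - 1) = (q - 2) +
   q. *)
set S := M * (A q f `^ (- ((q - 1) / q)) * (J f `^ (1 - t) * A q f `^ t)).
have S0 : 0 <= S by rewrite !mulr_ge0 ?powR_ge0// ltW.
have h2 : lpow ((q - 1) * 2) (kop g) <= S `^ (q - 2) * A q g.
  rewrite (lpowE _ (kop g)) (lpowE q (kop g)) -rintZ; last by apply: kop_Lone => //; exact: ltW.
  apply: le_rint.
  - by apply: kop_Lone => //; lra.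
  - by apply/LoneZ/kop_Lone => //; exact: ltW.
  - move=> x; have -> : (q - 1) * 2 = (q - 2) + q by ring.
    rewrite powRD; last by apply/implyP => /eqP; lra.
    rewrite ler_wpM2r ?powR_ge0//; apply: ge0_ler_powR; rewrite ?nnegrE ?normc_ge0//.
      exact: ltW.
    by apply: (le_trans (kop_sup x bg)); rewrite ler_wpM2l// ltW.
rewrite dual_map_power//.
apply: (@le_trans _ _ (A q g `^ (- ((q - 1) * 2 / q)) * (S `^ (q - 2) * A q g))).
  by rewrite ler_wpM2l ?powR_ge0.
have -> : A q g `^ (- ((q - 1) * 2 / q)) * (S `^ (q - 2) * A q g) =
    A q g `^ (- ((q - 2) / q)) * S `^ (q - 2).
  rewrite mulrA mulrAC; congr (_ * _); rewrite -{2}[A q g]powRr1 ?(ltW m0)// -powRD.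
    by congr powR; field; rewrite gt_eqF.
  by rewrite (gt_eqF m0) implybT.
apply: (@le_trans _ _ (A q f `^ (- ((q - 2) / q)) * S `^ (q - 2))).
  rewrite ler_wpM2r ?powR_ge0//; apply: ger_powR_neg => //.
  by rewrite oppr_le0 divr_ge0 ?ltW.
rewrite powRr1; last by rewrite divr_ge0 ?powR_ge0 ?ltW.
rewrite /S (powRM _ (ltW M0)) ?mulr_ge0 ?powR_ge0// (powRM _ (powR_ge0 _ _)) ?mulr_ge0 ?powR_ge0//.
rewrite (powRM _ (powR_ge0 _ _) (powR_ge0 _ _)) -!powRrM !powR_expln//.
(* With every base written as an exponential, the two sides have equal exponents: no loss is
   left. *)
have [a ->] : exists a, A q f = expR a by exists (ln (A q f)); rewrite lnK.
have [j ->] : exists j, J f = expR j by exists (ln (J f)); rewrite lnK.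
rewrite !expRK -expRN -!expRD ler_expR.
apply: eq_ler; rewrite /t; field.
by rewrite !gt_eqF.
Qed.

(* The exponent [2 / (3 - q)] is conjugate to [2 / (q - 1)], to which [dual_map]
   brings an [L_2] bound; it is larger than [q], so that finitely many steps reach
   [interpolates_ge3]. *)
Lemma interpolates_lt3 q : 2 < q < 3 -> interpolates (2 / (3 - q)) -> interpolates q.
Proof.
move=> /andP[q2 q3] P; have [q0 q10 p0 p2 pq] := conj_exponent q2.
have q30 : 0 < 3 - q by lra.
(* The exponent 2 / (q - 1) comes from the powers of [M]: with s = 2 / (3 - q) and t as below, (s -
   2) t = (q - 2) 2 / (q - 1). *)
apply: (@two_step_interpolates q (2 / (q - 1)) q2) => [|f bf f1 A0].
  by rewrite divr_gt0.
have J0 := unit_sqint_gt0 q2 bf f1.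
have bg := dual_map_bounded q2 bf.
have nm := dual_map_incr q2 A0 bf f1.
have m0 := lt_le_trans A0 nm.
set g := dual_map q f in bg nm m0 *.
set s := 2 / (3 - q) in P.
have s0 : 0 < s by rewrite divr_gt0.
(* The solution of 2(q - 1) = q (1 - t) + s t. *)
pose t := (3 - q) / (q - 1).
have t01 : 0 <= t < 1.
  by apply/andP; split; [apply: divr_ge0; lra|rewrite ltr_pdivrMr//; lra].
have h1 : lpow (s / (s - 1)) g <= A q f `^ (- (2 / q)) * J f.
  have -> : s / (s - 1) = 2 / (q - 1).
    rewrite /s; field; rewrite !gt_eqF//=; lra.
  rewrite dual_map_power ?divr_ge0 ?(ltW q10)//.
  have -> : (q - 1) * (2 / (q - 1)) = 2 by field; rewrite gt_eqF.
  by rewrite ler_wpM2l ?powR_ge0// !lpowE; exact: kL2.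
have s1 : 0 < s - 1.
  by rewrite subr_gt0 /s ltr_pdivlMr//; lra.
have h2 : A s g <= M `^ (s - 2) * (A q f `^ (- (2 / q)) * J f) `^ (s - 1).
  apply: (le_trans (P g bg)); rewrite ler_wpM2l ?powR_ge0//.
  by apply: ge0_ler_powR; rewrite ?nnegrE ?mulr_ge0 ?powR_ge0 ?lpow_ge0// ltW.
set S := M `^ (s - 2) * _ in h2.
have S0 : 0 <= S by rewrite mulr_ge0 ?powR_ge0.
have /andP[t0 t1] := t01.
have h3 : lpow ((q - 1) * 2) (kop g) <= A q g `^ (1 - t) * S `^ t.
  have -> : (q - 1) * 2 = q * (1 - t) + s * t.
    by rewrite /t /s; field; rewrite !gt_eqF.
  apply: (le_trans (lpow_kop_interp t01 q0 s0 bg)).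
  rewrite ler_wpM2l ?powR_ge0//.
  by apply: ge0_ler_powR; rewrite ?nnegrE ?lpow_ge0.
rewrite dual_map_power//.
apply: (@le_trans _ _ (A q g `^ (- ((q - 1) * 2 / q)) * (A q g `^ (1 - t) * S `^ t))).
  by rewrite ler_wpM2l ?powR_ge0.
have -> : A q g `^ (- ((q - 1) * 2 / q)) * (A q g `^ (1 - t) * S `^ t) =
    A q g `^ (- (2 / (q * (q - 1)))) * S `^ t.
  rewrite mulrA; congr (_ * _); rewrite -powRD.
    by congr powR; rewrite /t; field; rewrite !gt_eqF.
  by rewrite (gt_eqF m0) implybT.
apply: (@le_trans _ _ (A q f `^ (- (2 / (q * (q - 1)))) * S `^ t)).
  rewrite ler_wpM2r ?powR_ge0//; apply: ger_powR_neg => //.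
  by rewrite oppr_le0 divr_ge0 ?mulr_ge0 ?ltW.
rewrite /S powRM ?powR_ge0// (powRM _ (powR_ge0 _ _) (ltW J0)).
rewrite (powRM _ (powR_ge0 _ _) (powR_ge0 _ _)) (powRM _ (powR_ge0 _ _)) ?invr_ge0 ?(ltW A0)//.
rewrite -(powR_inv1 (ltW A0)) -!powRrM !powR_expln//.
rewrite -{2}(lnK (x := J f)) ?posrE// -!expRD ler_expR.
apply: eq_ler; rewrite /t /s; field.
by rewrite !gt_eqF.
Qed.

(** The quantity (q - 2) / (q - 1) doubles when q is replaced by 2 / (3 - q), and it is at least 1/2
    exactly when q >= 3; so [N] doublings lead from any q > 2 to the range of [interpolates_ge3]. *)
Lemma kop_interpolates q : 2 < q -> interpolates q.
Proof.
move=> q2; have [N] : exists N : nat, 2^-1 <= (q - 2) / (q - 1) * 2 ^+ N.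
  have q20 : 0 < (q - 2) / (q - 1) by apply: divr_gt0; lra.
  have [N hN] : exists N : nat, ((q - 2) / (q - 1))^-1 < N%:R.
    by exists (Num.truncn ((q - 2) / (q - 1))^-1).+1; rewrite truncnS_gt.
  exists N; rewrite -ler_pdivrMl//.
  apply: (@le_trans _ _ N%:R).
    have i0 : 0 <= ((q - 2) / (q - 1))^-1 by rewrite invr_ge0 ltW.
    by apply: le_trans (ltW hN); lra.
  by rewrite -natrX ler_nat ltnW// ltn_expl.
elim: N q q2 => [q q2|N IH q q2].
  rewrite expr0 mulr1 => h; apply: interpolates_ge3.
  by move: h; rewrite ler_pdivlMr; lra.
have [q3 _|q3 h] := leP 3 q; first exact: interpolates_ge3.
apply: interpolates_lt3; first by rewrite q2.
apply: IH; first by rewrite ltr_pdivlMr; lra.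
apply: (le_trans h); rewrite exprS mulrA; apply: eq_ler; congr (_ * _).
by field; rewrite !gt_eqF//; lra.
Qed.

Lemma kop_bilinear_interp q f g : 2 < q -> cbounded_meas f -> cbounded_meas g ->
  normc (cint mu (fun x => g x * kop f x)) <=
  M `^ ((q - 2) / q) * lpow (q / (q - 1)) f `^ ((q - 1) / q) *
    lpow (q / (q - 1)) g `^ ((q - 1) / q).
Proof.
move=> q2 bf bg; have [q0 q10 p0 p2 pq] := conj_exponent q2.
have bk := kop_bounded bf.
have iE : cintegrable mu (fun x => g x * kop f x).
  exact: (cbounded_cintegrable mu (cbounded_measM bg bk)).
apply: (le_trans (normc_cint iE)).
under eq_Rintegral do rewrite Normc.normcM.
apply: (@le_trans _ _ (lpow (q / (q - 1)) g `^ (q / (q - 1))^-1 * A q f `^ q^-1)).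
  rewrite !lpowE; apply: rint_hoelder => //.
  - by apply: measurable_normc; exact: bg.1.
  - by apply: measurable_normc; exact: bk.1.
  - by move=> x; exact: normc_ge0.
  - by move=> x; exact: normc_ge0.
  - by apply: bounded_lone_powR => //; exact: ltW.
  - by apply: bounded_lone_powR => //; exact: ltW.
rewrite invf_div mulrC ler_wpM2r ?powR_ge0//.
have := kop_interpolates q2 bf.
move=> /(ge0_ler_powR (_ : 0 <= q^-1)); rewrite !nnegrE invr_ge0 lpow_ge0 (ltW q0).
rewrite mulr_ge0 ?powR_ge0// => /(_ isT isT isT) /le_trans; apply.
by rewrite powRM ?powR_ge0// -!powRrM.
Qed.

End interpolation.

(** * Gaussian integrals *)

Section affine_line.
Context {R : realType}.
Local Notation mu := (@lebesgue_measure R).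

(** Uniqueness of Lebesgue measure: the rescaled image measure has the right value on half-open
    intervals. *)
Lemma lebesgue_measure_affine (a d : R) (A : set R) : 0 < d -> measurable A ->
  (d%:E * mu ((fun x : R => (a + d * x)%R) @^-1` A) = mu A)%E.
Proof.
move=> d0 mA; have mf : measurable_fun setT (fun x : measurableTypeR R => a + d * x : measurableTypeR R).
  by apply: measurable_funD => //; apply: measurable_funM.
pose nu := mscale (NngNum (ltW d0))
  (measure_function_pushforward__canonical__measure_function_Measure mu mf).
apply/esym/(@lebesgue_measure_unique R nu) => //= _ [[u v]] _ <-.
rewrite /nu /mscale /= /pushforward.
rewrite (_ : _ @^-1` _ = `](u - a) / d, (v - a) / d]%classic); last first.
  apply/seteqP; split => x /=; rewrite !in_itv/= ltr_pdivrMr// ler_pdivlMr//;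
    by rewrite ltrBlDl lerBrDl [x * d]mulrC.
rewrite !lebesgue_measure_itv/= !lte_fin ltr_pM2r ?invr_gt0// ltrD2r.
case: ifPn => _; last by rewrite mule0.
by rewrite -!EFinB -EFinM; congr EFin; field; rewrite gt_eqF.
Qed.

Lemma ge0_integral_line_affine (a d : R) (F : R -> \bar R) : 0 < d ->
  measurable_fun setT F -> (forall x, 0 <= F x)%E ->
  (\int[mu]_x F (a + d * x)%R = d^-1%:E * \int[mu]_x F x)%E.
Proof.
move=> d0 mF F0.
have mf : measurable_fun setT (fun x : measurableTypeR R => a + d * x : measurableTypeR R).
  by apply: measurable_funD => //; apply: measurable_funM.
pose nu := mscale (NngNum (ltW d0))
  (measure_function_pushforward__canonical__measure_function_Measure mu mf).
have -> : (\int[mu]_x F x = \int[nu]_x F x)%E.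
  by apply: eq_measure_integral => A mA _; exact/esym/lebesgue_measure_affine.
rewrite ge0_integral_mscale// ge0_integral_pushforward//= muleA -EFinM.
by rewrite mulVf ?gt_eqF// mul1e.
Qed.

End affine_line.

Section space.
Context {R : realType}.
Local Notation leb := (@lebesgue_rV R _).

(** The square of [enorm], kept without root so that it is polynomial in the coordinates. *)
Definition sqn n (x : 'rV[R]_n) : R := \sum_i x ord0 i ^+ 2.
Definition dotp n (x y : 'rV[R]_n) : R := \sum_i x ord0 i * y ord0 i.

Lemma measurable_fun_sumT d (T : measurableType d) (I : Type) (s : seq I)
    (F : I -> T -> R) : (forall i, measurable_fun setT (F i)) ->
  measurable_fun setT (fun x => \sum_(i <- s) F i x).
Proof.
move=> mF; elim: s => [|i s IH].
  by under eq_fun do rewrite big_nil; exact: measurable_cst.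
by under eq_fun do rewrite big_cons; exact: measurable_funD.
Qed.

Lemma measurable_sqn n : measurable_fun setT (@sqn n).
Proof.
apply: measurable_fun_sumT => i; apply: measurable_funX; exact: measurable_coord.
Qed.

Lemma measurable_dotp n (b : 'rV[R]_n) : measurable_fun setT (dotp b).
Proof.
apply: measurable_fun_sumT => i; apply: measurable_funM => //.
exact: measurable_coord.
Qed.

Lemma measurable_affine n (v : 'rV[R]_n) (d : R) :
  measurable_fun setT (fun x : 'rV[R]_n => v + d *: x).
Proof.
apply: measurable_fun_coordP => i; under eq_fun do rewrite !mxE.
apply: measurable_funD => //; apply: measurable_funM => //.
exact: measurable_coord.
Qed.

Lemma measurable_fun_sub d (T : measurableType d) n (f g : T -> 'rV[R]_n) :
  measurable_fun setT f -> measurable_fun setT g ->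
  measurable_fun setT (fun x => f x - g x).
Proof.
move=> mf mg; apply: measurable_fun_coordP => i; under eq_fun do rewrite !mxE.
apply: measurable_funB.
  exact: (measurableT_comp (measurable_coord i) mf).
exact: (measurableT_comp (measurable_coord i) mg).
Qed.

Lemma sqn_ge0 n (x : 'rV[R]_n) : 0 <= sqn x.
Proof. by apply: sumr_ge0 => i _; exact: sqr_ge0. Qed.

Lemma sqnN n (x : 'rV[R]_n) : sqn (- x) = sqn x.
Proof. by apply: eq_bigr => i _; rewrite mxE sqrrN. Qed.

Lemma sqnZ n (d : R) (x : 'rV[R]_n) : sqn (d *: x) = d ^+ 2 * sqn x.
Proof. by rewrite /sqn mulr_sumr; apply: eq_bigr => i _; rewrite mxE exprMn. Qed.

Lemma sqn_cons n (p : R * 'rV[R]_n) : sqn (cons_rV p) = p.1 ^+ 2 + sqn p.2.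
Proof.
rewrite /sqn big_ord_recl; congr (_ ^+ 2 + _); first by rewrite mxE unlift_none.
by apply: eq_bigr => i _; rewrite mxE liftK.
Qed.

Lemma dotp_cons n (b : 'rV[R]_n.+1) (p : R * 'rV[R]_n) :
  dotp b (cons_rV p) = b ord0 ord0 * p.1 + dotp (uncons_rV b).2 p.2.
Proof.
rewrite /dotp big_ord_recl; congr (_ * _ + _); first by rewrite mxE unlift_none.
by apply: eq_bigr => i _; rewrite !mxE liftK.
Qed.

Lemma ge0_integral_rVS n (F : 'rV[R]_n.+1 -> \bar R) :
  measurable_fun setT F -> (forall x, 0 <= F x)%E ->
  (\int[leb]_x F x =
   \int[@lebesgue_measure R]_a \int[leb]_x F (cons_rV (a, x)))%E.
Proof.
move=> mF F0.
have -> : (\int[lebesgue_rV R n.+1]_x F x =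
    \int[pushforward (@lebesgue_measure R \x lebesgue_rV R n) (@cons_rV R n)]_x F x)%E.
  by [].
have mc := @measurable_cons_rV R n.
rewrite ge0_integral_pushforward//=.
rewrite fubini_tonelli1//=.
exact: measurableT_comp.
Qed.

Lemma Lone_rVS n (F : 'rV[R]_n.+1 -> R) : Lone leb F ->
  Lone (@lebesgue_measure R \x lebesgue_rV R n)%E (fun p => F (cons_rV p)).
Proof.
move=> /LoneP[mF iF]; have mc := @measurable_cons_rV R n; apply/LoneP; split.
  exact: measurableT_comp.
rewrite fubini_tonelli1//=; last first.
  by apply/measurable_EFinP; apply: measurableT_comp => //; exact: measurableT_comp.
rewrite ge0_integral_rVS// in iF.
by apply/measurable_EFinP; exact: measurableT_comp.
Qed.

Lemma rint_rVS n (F : 'rV[R]_n.+1 -> R) : Lone leb F ->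
  \int[leb]_x F x = \int[(@lebesgue_measure R \x lebesgue_rV R n)%E]_p F (cons_rV p).
Proof.
move=> iF; have mc := @measurable_cons_rV R n; congr fine.
have -> : (\int[lebesgue_rV R n.+1]_x (F x)%:E =
    \int[pushforward (@lebesgue_measure R \x lebesgue_rV R n) (@cons_rV R n)]_x (F x)%:E)%E.
  by [].
rewrite integral_pushforward//=.
  by apply/measurable_EFinP; exact: Lone_meas iF.
exact: Lone_rVS iF.
Qed.

Lemma cint_rVS n (f : 'rV[R]_n.+1 -> R[i]) : cintegrable leb f ->
  cint leb f = cint (@lebesgue_measure R \x lebesgue_rV R n)%E (fun p => f (cons_rV p)).
Proof.
move=> if_; apply: complexP; rewrite /cint /= rint_rVS//.
  exact: cintegrable_Re.
exact: cintegrable_Im.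
Qed.

Lemma cintegrable_rVS n (f : 'rV[R]_n.+1 -> R[i]) : cintegrable leb f ->
  cintegrable (@lebesgue_measure R \x lebesgue_rV R n)%E (fun p => f (cons_rV p)).
Proof.
move=> [mf if_]; split; last exact: (Lone_rVS if_).
by apply: cmeas_comp => //; exact: measurable_cons_rV.
Qed.

(** Tonelli peels off one coordinate at a time, each contributing a factor 1/d; d = 1 gives
    translation invariance. *)
Lemma ge0_integral_affine n (v : 'rV[R]_n) (d : R) (F : 'rV[R]_n -> \bar R) :
  0 < d -> measurable_fun setT F -> (forall x, 0 <= F x)%E ->
  (\int[leb]_x F (v + d *: x)%R = ((d^-1) ^+ n)%:E * \int[leb]_x F x)%E.
Proof.
move=> d0; elim: n v F => [|n IH] v F mF F0.
  rewrite expr0 mul1e; apply: eq_integral => x _; congr F.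
  by apply/rowP => -[].
rewrite !ge0_integral_rVS//; last exact: (measurableT_comp mF (measurable_affine v d)).
have mFc a : measurable_fun setT (fun x : 'rV[R]_n => F (cons_rV (a, x))).
  apply: (measurableT_comp mF); apply: (measurableT_comp (@measurable_cons_rV R n)).
  exact: measurable_pair1.
have E a : (\int[leb]_x F (v + d *: cons_rV (a, x))%R =
    ((d^-1) ^+ n)%:E * \int[leb]_x F (cons_rV ((uncons_rV v).1 + d * a, x)%R))%E.
  rewrite -(IH (uncons_rV v).2)//; apply: eq_integral => x _; congr F.
  by apply/rowP => i; rewrite !mxE; case: unliftP => [j ->|->]; rewrite ?mxE.
pose G a := (\int[leb]_x F (cons_rV (a, x)))%E.
have mG : measurable_fun setT G.
  apply: (measurable_fun_fubini_tonelli_F (fun p => F (cons_rV p))) => //.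
  exact: (measurableT_comp mF (@measurable_cons_rV R n)).
have G0 a : (0 <= G a)%E by exact: integral_ge0.
pose Ga a := G ((uncons_rV v).1 + d * a).
have mGa : measurable_fun setT Ga.
  by apply: (measurableT_comp mG); apply: measurable_funD => //; apply: measurable_funM.
have dn0 : 0 <= d^-1 ^+ n by rewrite exprn_ge0// invr_ge0 ltW.
transitivity (\int[@lebesgue_measure R]_a ((d^-1 ^+ n)%:E * Ga a))%E.
  by apply: eq_integral => a _; exact: E.
have -> := ge0_integralZl_EFin (@lebesgue_measure R) measurableT
  (fun a _ => G0 ((uncons_rV v).1 + d * a)) mGa dn0.
rewrite /Ga (ge0_integral_line_affine (uncons_rV v).1 d0 mG G0).
by rewrite muleA -EFinM -exprSr.
Qed.

Lemma Lone_affine n (v : 'rV[R]_n) (d : R) (F : 'rV[R]_n -> R) : 0 < d ->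
  Lone leb F -> Lone leb (fun x => F (v + d *: x)).
Proof.
move=> d0 /LoneP[mF iF]; apply/LoneP; split.
  exact: (measurableT_comp mF (measurable_affine v d)).
rewrite (ge0_integral_affine v d0 (F := fun x => `|F x|%:E))//.
  by rewrite lte_mul_pinfty// lee_fin exprn_ge0// invr_ge0 ltW.
by apply/measurable_EFinP; exact: measurableT_comp.
Qed.

Lemma rint_affine n (v : 'rV[R]_n) (d : R) (F : 'rV[R]_n -> R) : 0 < d ->
  Lone leb F -> \int[leb]_x F (v + d *: x) = d^-1 ^+ n * \int[leb]_x F x.
Proof.
move=> d0 iF.
have pos G : Lone leb G -> (forall x, 0 <= G x) ->
    \int[leb]_x G (v + d *: x) = d^-1 ^+ n * \int[leb]_x G x.
  move=> iG G0; apply: EFin_inj; rewrite EFinM !rint_EFin//; last exact: Lone_affine.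
  apply: (ge0_integral_affine v d0 (F := fun x => (G x)%:E)) => //.
  by apply/measurable_EFinP; exact: Lone_meas iG.
have iN := Lone_norm iF; have iD := LoneD iF iN.
(* A difference of two nonnegative integrable functions, to which the nonnegative case applies. *)
have E x : F x = (F x + `|F x|) - `|F x| by rewrite addrK.
under eq_Rintegral do rewrite E.
under [in RHS]eq_Rintegral do rewrite E.
rewrite !rintB//; [|exact: (Lone_affine v d0 iD)|exact: (Lone_affine v d0 iN)].
rewrite mulrBr (pos _ iN)// (pos _ iD)// => x.
by rewrite -lerBlDr sub0r lerNnormlW.
Qed.

Lemma cintegrable_affine n (v : 'rV[R]_n) (d : R) (f : 'rV[R]_n -> R[i]) : 0 < d ->
  cintegrable leb f -> cintegrable leb (fun x => f (v + d *: x)).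
Proof.
move=> d0 [mf if_]; split; last exact: (Lone_affine v d0 if_).
exact: (cmeas_comp (measurable_affine v d) mf).
Qed.

Lemma cint_affine n (v : 'rV[R]_n) (d : R) (f : 'rV[R]_n -> R[i]) : 0 < d ->
  cintegrable leb f -> cint leb (fun x => f (v + d *: x)) = (d^-1 ^+ n)%:C * cint leb f.
Proof.
move=> d0 if_; apply: complexP; rewrite ?ReM ?ImM /cint /= mul0r ?subr0 ?addr0.
  by rewrite (rint_affine v d0 (cintegrable_Re if_)).
by rewrite (rint_affine v d0 (cintegrable_Im if_)).
Qed.

End space.

Lemma cvg0_squeeze {R : realType} (u v : nat -> R) :
  (\forall k \near \oo, `|u k| <= v k) -> v k @[k --> \oo] --> 0 ->
  u k @[k --> \oo] --> 0.
Proof.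
move=> uv v0; apply/norm_cvg0P; apply: (@squeeze_cvgr _ _ _ _ (cst 0) v) => //.
  by near=> k; rewrite normr_ge0/=; near: k.
exact: cvg_cst.
Unshelve. all: by end_near. Qed.

Section derivative_rules.
Context {R : realType}.
Implicit Types (f g : R -> R) (x a b : R).

Lemma is_derive_mulf f g x a b : is_derive x 1 f a -> is_derive x 1 g b ->
  is_derive x 1 (fun y => f y * g y) (a * g x + f x * b).
Proof.
move=> df dg; have := is_deriveM df dg => /is_derive_eq; apply.
by rewrite /GRing.scale /= addrC [g x * _]mulrC.
Qed.

Lemma is_derive_addf f g x a b : is_derive x 1 f a -> is_derive x 1 g b ->
  is_derive x 1 (fun y => f y + g y) (a + b).
Proof. by move=> df dg; have := is_deriveD df dg. Qed.

Lemma is_derive_compf f g x a b : is_derive (g x) 1 f a -> is_derive x 1 g b ->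
  is_derive x 1 (fun y => f (g y)) (a * b).
Proof. by move=> df dg; have := @is_derive1_comp _ f g x a b df dg; rewrite mulrC. Qed.

Lemma is_derive_scalef k f x a : is_derive x 1 f a ->
  is_derive x 1 (fun y => k * f y) (k * a).
Proof. by move=> df; have := @is_deriveZ _ _ _ f k x 1 a df. Qed.

Lemma is_derive_linear k x : is_derive x 1 (fun y => k * y) k.
Proof.
by have := is_derive_scalef k (is_derive_id x 1); rewrite mulr1.
Qed.

Lemma is_derive_sqrf x : is_derive x 1 (fun y => y ^+ 2) (2 * x).
Proof.
have := is_derive_mulf (is_derive_id x (1 : R)) (is_derive_id x (1 : R)).
by rewrite mul1r mulr1 -mulr2n mulr_natl.
Qed.

Lemma is_derive_gauss a x :
  is_derive x 1 (fun y => expR (- a * y ^+ 2)) (- (2 * a * x) * expR (- a * x ^+ 2)).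
Proof.
have := @is_derive_compf expR (fun y => - a * y ^+ 2) x _ _
  (is_derive_expR (- a * x ^+ 2)) (is_derive_scalef (- a) (is_derive_sqrf x)).
by move=> /is_derive_eq; apply; ring.
Qed.

Lemma is_derive_cosf f x a : is_derive x 1 f a ->
  is_derive x 1 (fun y => cos (f y)) (- a * sin (f x)).
Proof.
move=> df; have := is_derive_compf (is_derive_cos (f x)) df.
by move=> /is_derive_eq; apply; ring.
Qed.

Lemma is_derive_sinf f x a : is_derive x 1 f a ->
  is_derive x 1 (fun y => sin (f y)) (a * cos (f x)).
Proof.
move=> df; have := is_derive_compf (is_derive_sin (f x)) df.
by move=> /is_derive_eq; apply; ring.
Qed.

Lemma is_derive_phase (b c x : R) : is_derive x 1 (fun y => b * y + c) b.
Proof.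
have := is_derive_addf (is_derive_linear b x) (is_derive_cst c x 1).
by rewrite addr0.
Qed.

Lemma is_derive_continuous f (f' : R -> R) :
  (forall x, is_derive x 1 f (f' x)) -> continuous f.
Proof.
by move=> df x; apply: differentiable_continuous; apply/derivable1_diffP; case: (df x).
Qed.

Lemma is_derive_measurable f (f' : R -> R) :
  (forall x, is_derive x 1 f (f' x)) -> measurable_fun setT f.
Proof.
by move=> df; apply: continuous_measurable_fun; exact: is_derive_continuous df.
Qed.

End derivative_rules.

Section gauss1.
Context {R : realType}.
Local Notation mu := (@lebesgue_measure R).
Implicit Types a b c x : R.

(** The fundamental theorem of calculus on [-(k + 1), k + 1] and dominated convergence; the shift by
    one keeps the first interval nondegenerate. *)
Lemma rint_derivative_eq0 (H h : R -> R) :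
  (forall x, is_derive x 1 H (h x)) -> continuous h -> Lone mu h ->
  H k%:R @[k --> \oo] --> 0 -> H (- k%:R) @[k --> \oo] --> 0 ->
  \int[mu]_x h x = 0.
Proof.
move=> dH ch ih H1 H2.
have mh : measurable_fun setT h := Lone_meas ih.
pose D k : set R := `[- k.+1%:R, k.+1%:R]%classic.
pose F k := h \_ (D k).
have [|||_ cv] := @rint_dominated _ _ _ mu F h (fun x => `|h x|) _ mh _ (Lone_norm ih).
- move=> k; apply/(measurable_restrictT h) => //; first exact: measurable_itv.
  exact: measurable_funTS.
- apply: nearW => x; apply: cvg_near_cst.
  near=> k; rewrite /F patchE mem_set// /D /= in_itv/= -ler_norml.
  near: k; exists (Num.truncn `|x|) => // k /= kx.
  by rewrite (le_trans (ltW (truncnS_gt _)))// ler_nat.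
- by move=> k x; rewrite /F patchE; case: ifPn => // _; rewrite normr0.
have E k : \int[mu]_x F k x = H k.+1%:R - H (- k.+1%:R).
  have k0 : (- k.+1%:R : R) < k.+1%:R by rewrite gtrN// ltr0n.
  apply: EFin_inj; rewrite EFinB -(@continuous_FTC2 _ h H _ _ k0).
  - rewrite /F -Rintegral_mkcond /Rintegral fineK//.
    apply: integrable_fin_num => //; first exact: measurable_itv.
    by apply: integrableS ih => //; exact: measurable_itv.
  - exact: continuous_subspaceT.
  - split.
    + by move=> x _; case: (dH x).
    + by apply: cvg_at_right_filter; exact: (is_derive_continuous dH).
    + by apply: cvg_at_left_filter; exact: (is_derive_continuous dH).
  - by move=> x _; rewrite derive1E; case: (dH x).
move: cv; under eq_fun do rewrite E; move=> cv.
have cv0 : H k.+1%:R - H (- k.+1%:R) @[k --> \oo] --> 0 - 0.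
  apply: cvgB; first by rewrite (cvg_shiftS (fun k => H k%:R)).
  by rewrite (cvg_shiftS (fun k => H (- k%:R))).
by rewrite subrr in cv0; exact: (cvg_unique _ cv cv0).
Unshelve. all: by end_near. Qed.

Lemma rint_gauss1 a : 0 < a ->
  (\int[mu]_x (expR (- a * x ^+ 2))%:E = (Num.sqrt (pi / a))%:E)%E.
Proof.
move=> a0; have s0 : 0 < Num.sqrt a by rewrite sqrtr_gt0.
have := @ge0_integral_line_affine R 0 _ (fun x => (gauss_fun x)%:E) s0.
rewrite integralT_gauss -EFinM => E.
transitivity ((Num.sqrt a)^-1 * Num.sqrt pi)%:E; last first.
  by rewrite sqrtrM ?pi_ge0// mulrC sqrtrV// ltW.
rewrite -E; last by move=> x; rewrite lee_fin gauss_fun_ge0.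
  by apply: eq_integral => x _; rewrite /gauss_fun add0r exprMn sqr_sqrtr ?ltW// mulNr.
by apply/measurable_EFinP; exact: measurable_gauss_fun.
Qed.

Lemma Lone_gauss1 a : 0 < a -> Lone mu (fun x => expR (- a * x ^+ 2)).
Proof.
move=> a0; apply/LoneP; split; first exact: is_derive_measurable (is_derive_gauss a).
under eq_integral do rewrite ger0_norm ?expR_ge0//.
by rewrite rint_gauss1// ltry.
Qed.

(** Half of the Gaussian absorbs the linear factor: |x| <= 1 + x^2, and both 1 and (a/2) x^2 are at
    most exp((a/2) x^2). *)
Lemma gauss_linear_bound a x : 0 < a ->
  `|x| * expR (- a * x ^+ 2) <= (1 + 2 / a) * expR (- (a / 2) * x ^+ 2).
Proof.
move=> a0.
have -> : expR (- a * x ^+ 2) = expR (- (a / 2) * x ^+ 2) * expR (- (a / 2) * x ^+ 2).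
  by rewrite -expRD; congr expR; field.
rewrite mulrA ler_wpM2r ?expR_ge0//.
have e0 := expR_gt0 (a / 2 * x ^+ 2).
rewrite mulNr expRN -ler_pdivlMr ?invrK// ?invr_gt0//.
have h := expR_ge1Dx (a / 2 * x ^+ 2).
have h1 : `|x| <= 1 + x ^+ 2.
  by rewrite -[x ^+ 2]real_normK ?num_real//; have := normr_ge0 x; nra.
apply: (le_trans h1).
have x0 := sqr_ge0 x.
have h2 : 1 <= expR (a / 2 * x ^+ 2) by apply: le_trans h; rewrite lerDl mulr_ge0// divr_ge0// ltW.
have h3 : x ^+ 2 <= 2 / a * expR (a / 2 * x ^+ 2).
  rewrite -[leLHS](_ : 2 / a * (a / 2 * x ^+ 2) = _); last by field; rewrite gt_eqF.
  rewrite ler_wpM2l//; first by rewrite divr_ge0// ltW.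
  by apply: le_trans h; rewrite lerDr.
by rewrite mulrDl mul1r lerD.
Qed.

Lemma cvg_gauss_seq a (s : nat -> R) : 0 < a -> (forall k, k%:R <= `|s k|) ->
  expR (- a * s k ^+ 2) @[k --> \oo] --> 0.
Proof.
move=> a0 sk.
apply: (@cvg0_squeeze _ _ (fun k => a^-1 * k%:R^-1)).
- near=> k; rewrite ger0_norm ?expR_ge0// mulNr expRN -invfM lef_pV2 ?posrE ?expR_gt0//; last first.
    by rewrite mulr_gt0// ltr0n; near: k; exists 1%N.
  have k1 : 1 <= k%:R :> R by rewrite ler1n; near: k; exists 1%N.
  apply: (@le_trans _ _ (1 + a * s k ^+ 2)); last exact: expR_ge1Dx.
  have : k%:R ^+ 2 <= s k ^+ 2 by rewrite -(real_normK (num_real (s k))) ler_pXn2r// ?nnegrE.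
  move=> ks; apply: (@le_trans _ _ (a * s k ^+ 2)); last by rewrite lerDr.
  rewrite ler_pM2l//; apply: le_trans ks; rewrite expr2.
  by rewrite ler_peMr.
- rewrite -[X in _ --> X](mulr0 a^-1); apply: cvgMr.
  by apply/gtr0_cvgV0; [near=> k; rewrite ltr0n; near: k; exists 1%N|exact: cvgr_idn].
Unshelve. all: by end_near. Qed.

Lemma Lone_gauss1_bounded a (G : R -> R) : 0 < a -> measurable_fun setT G ->
  (forall x, `|G x| <= 1) -> Lone mu (fun x => G x * expR (- a * x ^+ 2)).
Proof.
move=> a0 mG G1; apply: (le_Lone _ _ (Lone_gauss1 a0)).
  by apply: measurable_funM => //; exact: is_derive_measurable (is_derive_gauss a).
by move=> x; rewrite normrM (ger0_norm (expR_ge0 _)) ler_piMl ?expR_ge0.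
Qed.

Lemma Lone_gauss1_linear a (G : R -> R) : 0 < a -> measurable_fun setT G ->
  (forall x, `|G x| <= 1) -> Lone mu (fun x => x * G x * expR (- a * x ^+ 2)).
Proof.
move=> a0 mG G1; have a2 : 0 < a / 2 by rewrite divr_gt0.
apply: (le_Lone _ _ (LoneZ (1 + 2 / a) (Lone_gauss1 a2))).
  apply: measurable_funM; first exact: measurable_funM.
  exact: is_derive_measurable (is_derive_gauss a).
move=> x; rewrite !normrM (ger0_norm (expR_ge0 _)).
apply: le_trans (gauss_linear_bound x a0).
by rewrite ler_wpM2r ?expR_ge0// ler_piMr.
Qed.

Lemma measurable_cos_phase b c : measurable_fun setT (fun x : R => cos (b * x + c)).
Proof. by apply: is_derive_measurable => x; exact: is_derive_cosf (is_derive_phase b c x). Qed.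

Lemma measurable_sin_phase b c : measurable_fun setT (fun x : R => sin (b * x + c)).
Proof. by apply: is_derive_measurable => x; exact: is_derive_sinf (is_derive_phase b c x). Qed.

Lemma norm_cos_le1 x : `|cos x| <= 1.
Proof. by rewrite ler_norml cos_geN1 cos_le1. Qed.

Lemma norm_sin_le1 x : `|sin x| <= 1.
Proof. by rewrite ler_norml sin_geN1 sin_le1. Qed.

(** The function sin(b x + c) exp(-a x^2) vanishes at infinity, so its derivative has integral 0. *)
Lemma gauss1_by_parts a b c : 0 < a ->
  \int[mu]_x (x * sin (b * x + c) * expR (- a * x ^+ 2)) =
  b / (2 * a) * \int[mu]_x (cos (b * x + c) * expR (- a * x ^+ 2)).
Proof.
move=> a0.
have ic := Lone_gauss1_bounded a0 (measurable_cos_phase b c) (fun x => norm_cos_le1 _).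
have is_ := Lone_gauss1_linear a0 (measurable_sin_phase b c) (fun x => norm_sin_le1 _).
pose H x := sin (b * x + c) * expR (- a * x ^+ 2).
pose h x := b * (cos (b * x + c) * expR (- a * x ^+ 2)) -
  2 * a * (x * sin (b * x + c) * expR (- a * x ^+ 2)).
have dH x : is_derive x 1 H (h x).
  have := is_derive_mulf (is_derive_sinf (is_derive_phase b c x)) (is_derive_gauss a x).
  by move=> /is_derive_eq; apply; rewrite /h; ring.
have ih : Lone mu h by apply: LoneB; exact: LoneZ.
have sH (s : nat -> R) : (forall k, k%:R <= `|s k|) -> H (s k) @[k --> \oo] --> 0.
  move=> sk; apply: (@cvg0_squeeze _ _ (fun k => expR (- a * s k ^+ 2))).
  - apply: nearW => k; rewrite /H normrM (ger0_norm (expR_ge0 _)).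
    by rewrite ler_piMl ?expR_ge0// norm_sin_le1.
  - exact: cvg_gauss_seq.
have : \int[mu]_x h x = 0.
  apply: (rint_derivative_eq0 dH _ ih).
  - move=> x; apply: cvgB; apply: cvgM; first exact: cvg_cst.
    + apply: cvgM; last exact: (is_derive_continuous (is_derive_gauss a)).
      by apply: (is_derive_continuous (fun x => is_derive_cosf (is_derive_phase b c x))).
    + exact: cvg_cst.
    + apply: cvgM; last exact: (is_derive_continuous (is_derive_gauss a)).
      apply: cvgM; first exact: cvg_id.
      by apply: (is_derive_continuous (fun x => is_derive_sinf (is_derive_phase b c x))).
  - by apply: sH => k; rewrite normr_nat.
  - by apply: sH => k; rewrite normrN normr_nat.
rewrite rintB ?rintZ//; [|exact: LoneZ|exact: LoneZ].
move=> /eqP; rewrite subr_eq0 => /eqP E.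
apply: (@mulfI _ (2 * a)); first by rewrite mulf_neq0// gt_eqF.
by rewrite -E mulrA; congr (_ * _); field; rewrite gt_eqF.
Qed.

(** As a function of the frequency t, the integral F satisfies F' = -(t / (2a)) F by differentiation
    under the integral and [gauss1_by_parts]; so F exp(t^2 / (4a)) is constant. The phase [c] gives
    the cosine and sine transforms at once. *)
Lemma rint_gauss1_cos a b c : 0 < a ->
  \int[mu]_x (cos (b * x + c) * expR (- a * x ^+ 2)) =
  cos c * Num.sqrt (pi / a) * expR (- (b ^+ 2 / (4 * a))).
Proof.
move=> a0.
pose f (t x : R) := cos (t * x + c) * expR (- a * x ^+ 2).
pose F t := \int[mu]_x f t x.
have if_ t : Lone mu (f t).
  exact: Lone_gauss1_bounded a0 (measurable_cos_phase t c) (fun x => norm_cos_le1 _).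
have df (t x : R) : is_derive t 1 (f^~ x) (- (x * sin (t * x + c) * expR (- a * x ^+ 2))).
  have h : is_derive t 1 (fun t : R => t * x + c) x.
    have := is_derive_phase x c t; congr is_derive.
    by apply/funext => s; rewrite mulrC.
  have := is_derive_mulf (is_derive_cosf h) (is_derive_cst (expR (- a * x ^+ 2)) t 1).
  by rewrite /cst => /is_derive_eq; apply; ring.
have a2 : 0 < a / 2 by rewrite divr_gt0.
have iG := LoneZ (1 + 2 / a) (Lone_gauss1 a2).
have dF (t : R) : is_derive t 1 F (- (t / (2 * a) * F t)).
  have It : (`]t - 1, t + 1[%classic : set R) t by rewrite /= in_itv/=; lra.
  have H1 s x : (`]t - 1, t + 1[%classic : set R) s -> setT x -> derivable (f^~ x) s 1.
    by move=> _ _; case: (df s x).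
  have H2 s x : (`]t - 1, t + 1[%classic : set R) s -> setT x ->
      `|partial1of2 f s x| <= (1 + 2 / a) * expR (- (a / 2) * x ^+ 2).
    move=> _ _; rewrite partial1of2E; case: (df s x) => _ ->.
    rewrite normrN !normrM (ger0_norm (expR_ge0 _)).
    apply: le_trans (gauss_linear_bound x a0).
    by rewrite ler_wpM2r ?expR_ge0// ler_piMr// norm_sin_le1.
  have G0 x : 0 <= (1 + 2 / a) * expR (- (a / 2) * x ^+ 2).
    by rewrite mulr_ge0 ?expR_ge0// addr_ge0// divr_ge0// ltW.
  have i1 s : (`]t - 1, t + 1[%classic : set R) s -> mu.-integrable setT (EFin \o f s).
    by move=> _; exact: if_.
  split.
    exact: (derivable_under_integral measurableT It i1 H1 G0 iG H2).
  rewrite -derive1E (differentiation_under_integral measurableT It i1 H1 G0 iG H2).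
  rewrite /F -gauss1_by_parts// -mulN1r -rintZ; last first.
    exact: Lone_gauss1_linear a0 (measurable_sin_phase t c) (fun x => norm_sin_le1 _).
  apply: eq_Rintegral => x _; rewrite partial1of2E; case: (df t x) => _ ->.
  by rewrite mulN1r.
pose E t := F t * expR ((4 * a)^-1 * t ^+ 2).
have dE (t : R) : is_derive t 1 E 0.
  have := is_derive_gauss (- (4 * a)^-1) t; rewrite !opprK => dg.
  have := is_derive_mulf (dF t) dg.
  by move=> /is_derive_eq; apply; field; rewrite gt_eqF.
have : E b = E 0 by apply: is_derive_0_is_cst.
have F0 : F 0 = cos c * Num.sqrt (pi / a).
  rewrite /F /f; under eq_Rintegral do rewrite mul0r add0r.
  by rewrite rintZ ?Lone_gauss1// /Rintegral rint_gauss1.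
rewrite /E F0 expr0n/= mulr0 expR0 mulr1 -/(F b) => <-.
rewrite -mulrA -expRD (_ : _ + _ = 0) ?expR0 ?mulr1//.
by field; rewrite gt_eqF.
Qed.

End gauss1.

Section cexp.
Context {R : realType}.
Implicit Types u w : R.
Local Notation normc := Normc.normc.

Definition cexp u w : R[i] := (expR u * cos w) +i* (expR u * sin w).

Lemma cexpD u w u' w' : cexp (u + u') (w + w') = cexp u w * cexp u' w'.
Proof.
by apply: complexP; rewrite ?ReM ?ImM /= expRD ?cosD ?sinD; ring.
Qed.

Lemma cexp0 : cexp 0 0 = 1.
Proof. by apply: complexP; rewrite /= expR0 ?cos0 ?sin0 ?mulr1 ?mulr0. Qed.

Lemma normc_cexp u w : normc (cexp u w) = expR u.
Proof.
apply/eqP; rewrite -(@eqrXn2 _ 2)// ?normc_ge0 ?expR_ge0// normc_sq /=.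
by rewrite !exprMn -mulrDr cos2Dsin2 mulr1.
Qed.

Lemma cexp_conj u w : (conjc (cexp u w)) = cexp u (- w).
Proof. by apply: complexP; rewrite /= ?cosN ?sinN ?mulrN. Qed.

Lemma cexp_real u : cexp u 0 = (expR u)%:C.
Proof. by apply: complexP; rewrite /= ?cos0 ?sin0 ?mulr1 ?mulr0. Qed.

Lemma measurable_cosT : measurable_fun setT (@cos R).
Proof. by apply: continuous_measurable_fun; exact: continuous_cos. Qed.

Lemma measurable_sinT : measurable_fun setT (@sin R).
Proof. by apply: continuous_measurable_fun; exact: continuous_sin. Qed.

Lemma cmeas_cexp d (T : measurableType d) (F G : T -> R) :
  measurable_fun setT F -> measurable_fun setT G ->
  cmeas (fun x => cexp (F x) (G x)).
Proof.
move=> mF mG; split => /=; apply: measurable_funM.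
- exact: (measurableT_comp (@measurable_expR R) mF).
- exact: (measurableT_comp measurable_cosT mG).
- exact: (measurableT_comp (@measurable_expR R) mF).
- exact: (measurableT_comp measurable_sinT mG).
Qed.

Lemma cint_gauss1 (a b : R) : 0 < a ->
  cint (@lebesgue_measure R) (fun x => cexp (- a * x ^+ 2) (b * x)) =
  (Num.sqrt (pi / a) * expR (- (b ^+ 2 / (4 * a))))%:C.
Proof.
move=> a0; apply: complexP; rewrite /cint /=.
  have := rint_gauss1_cos b 0 a0; rewrite cos0 mul1r => <-.
  by apply: eq_Rintegral => x _; rewrite addr0 mulrC.
(* The phase pi/2 turns the cosine into minus the sine, and cos(pi/2) = 0. *)
have := rint_gauss1_cos b (pi / 2) a0; rewrite cos_pihalf !mul0r => E.
have iS : Lone (@lebesgue_measure R) (fun x => expR (- a * x ^+ 2) * sin (b * x)).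
  have := Lone_gauss1_bounded a0 (measurable_sin_phase b 0) (fun x => norm_sin_le1 _).
  by congr Lone; apply/funext => x; rewrite addr0 mulrC.
apply/eqP; rewrite -oppr_eq0 -mulN1r -rintZ//; apply/eqP; rewrite -[RHS]E.
by apply: eq_Rintegral => x _; rewrite cosDpihalf; ring.
Qed.

End cexp.

Section gauss_space.
Context {R : realType}.
Local Notation leb := (@lebesgue_rV R _).
Local Notation normc := Normc.normc.

Lemma measurable_gauss n (a : R) :
  measurable_fun setT (fun x : 'rV[R]_n => expR (- a * sqn x)).
Proof.
apply: (measurableT_comp (@measurable_expR R)); apply: measurable_funM => //.
exact: measurable_sqn.
Qed.

Lemma integral_gauss n (a : R) : 0 < a ->
  (\int[lebesgue_rV R n]_x (expR (- a * sqn x))%:E = (Num.sqrt (pi / a) ^+ n)%:E)%E.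
Proof.
move=> a0.
have G0 m (x : 'rV[R]_m) : setT x -> (0 <= (expR (- a * sqn x))%:E)%E.
  by rewrite lee_fin expR_ge0.
have mG m : measurable_fun setT (fun x : 'rV[R]_m => (expR (- a * sqn x))%:E).
  by apply/measurable_EFinP; exact: measurable_gauss.
have H0 (x : measurableTypeR R) : setT x -> (0 <= (expR (- a * x ^+ 2))%:E)%E.
  by rewrite lee_fin expR_ge0.
have mH : measurable_fun setT (fun x : measurableTypeR R => (expR (- a * x ^+ 2))%:E).
  by apply/measurable_EFinP; exact: is_derive_measurable (is_derive_gauss a).
elim: n => [|n IH].
  rewrite integral_dirac//; last by apply/measurable_EFinP; exact: measurable_gauss.
  by rewrite diracT mul1e /sqn big_ord0 mulr0 expR0 expr0.
rewrite (ge0_integral_rVS (mG _)); last by move=> x; exact: G0.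
have s0 : 0 <= Num.sqrt (pi / a) ^+ n by rewrite exprn_ge0// sqrtr_ge0.
transitivity (\int[@lebesgue_measure R]_t
    ((Num.sqrt (pi / a) ^+ n)%:E * (expR (- a * t ^+ 2))%:E))%E.
  apply: eq_integral => t _; rewrite -IH muleC.
  rewrite -(ge0_integralZl_EFin (lebesgue_rV R n) measurableT (G0 n) (mG n))//.
  by apply: eq_integral => x _; rewrite sqn_cons/= -EFinM -expRD mulrDr.
rewrite (ge0_integralZl_EFin (@lebesgue_measure R) measurableT H0 mH s0).
by rewrite rint_gauss1// -EFinM exprSr.
Qed.

Lemma Lone_gauss n (a : R) : 0 < a -> Lone leb (fun x : 'rV[R]_n => expR (- a * sqn x)).
Proof.
move=> a0; apply/LoneP; split; first exact: measurable_gauss.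
under eq_integral do rewrite ger0_norm ?expR_ge0//.
by rewrite integral_gauss// ltry.
Qed.

Lemma rint_gauss n (a : R) : 0 < a ->
  \int[lebesgue_rV R n]_x expR (- a * sqn x) = Num.sqrt (pi / a) ^+ n.
Proof. by move=> a0; rewrite /Rintegral integral_gauss. Qed.

Lemma cintegrable_gauss n (a : R) (G : 'rV[R]_n -> R) : 0 < a ->
  measurable_fun setT G ->
  cintegrable leb (fun x : 'rV[R]_n => cexp (- a * sqn x) (G x)).
Proof.
move=> a0 mG; apply: (@le_cintegrable _ _ _ _ _ (fun x => expR (- a * sqn x))).
- by apply: cmeas_cexp => //; apply: measurable_funM => //; exact: measurable_sqn.
- by move=> x; rewrite normc_cexp.
- exact: Lone_gauss.
Qed.

(** The Fourier transform of a Gaussian: both the Gaussian and the phase factor over the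
    coordinates. *)
Lemma cint_gauss n (a : R) (b : 'rV[R]_n) : 0 < a ->
  cint leb (fun x : 'rV[R]_n => cexp (- a * sqn x) (dotp b x)) =
  (Num.sqrt (pi / a) ^+ n * expR (- (sqn b / (4 * a))))%:C.
Proof.
move=> a0; elim: n b => [|n IH] b.
  have -> : (fun x : 'rV[R]_0 => cexp (- a * sqn x) (dotp b x)) = fun=> (1 : R)%:C.
    by apply/funext => x; rewrite /sqn /dotp !big_ord0 mulr0 cexp0.
  rewrite cint_real expr0 mul1r /sqn big_ord0 mul0r oppr0 expR0; congr (_%:C).
  have -> : (\int[lebesgue_rV R 0]_x 1 = \int[lebesgue_rV R 0]_x expR (- a * sqn x)).
    by apply: eq_Rintegral => x _; rewrite /sqn big_ord0 mulr0 expR0.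
  by rewrite rint_gauss.
have if_ := cintegrable_gauss a0 (measurable_dotp b).
rewrite cint_rVS// -cint_Fubini1; last exact: (cintegrable_rVS if_).
have E (t : R) : cint leb (fun x : 'rV[R]_n =>
      cexp (- a * sqn (cons_rV (t, x))) (dotp b (cons_rV (t, x)))) =
    (Num.sqrt (pi / a) ^+ n * expR (- (sqn (uncons_rV b).2 / (4 * a))))%:C *
    cexp (- a * t ^+ 2) (b ord0 ord0 * t).
  rewrite -IH mulrC -cintZ; last by apply: cintegrable_gauss => //; exact: measurable_dotp.
  congr cint; apply/funext => x; rewrite sqn_cons dotp_cons/= mulrDr.
  by rewrite cexpD.
under [X in cint _ X]funext do rewrite E.
have ig : cintegrable (@lebesgue_measure R)
    (fun x => cexp (- a * x ^+ 2) (b ord0 ord0 * x)).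
  split; last by under eq_fun do rewrite normc_cexp; exact: Lone_gauss1.
  apply: cmeas_cexp; last exact: measurable_funM.
  by apply: measurable_funM => //; exact: measurable_funX.
rewrite (cintZ _ ig).
rewrite cint_gauss1// -rmorphM/=; congr (_%:C).
have -> : sqn b = b ord0 ord0 ^+ 2 + sqn (uncons_rV b).2.
  rewrite /sqn big_ord_recl; congr (_ + _).
  by apply: eq_bigr => i _; rewrite mxE.
rewrite [_ ^+ n.+1]exprSr mulrACA -expRD; congr (_ * expR _).
by field; rewrite gt_eqF.
Qed.

End gauss_space.

Section product_integrability.
Context {R : realType} d1 d2 (T1 : measurableType d1) (T2 : measurableType d2).
Variable m1 : {sigma_finite_measure set T1 -> \bar R}.
Variable m2 : {sigma_finite_measure set T2 -> \bar R}.
Implicit Types F : T1 * T2 -> R.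

Lemma Lone_prod1 F : measurable_fun setT F -> (forall z, 0 <= F z) ->
  (forall x, Lone m2 (fun y => F (x, y))) ->
  Lone m1 (fun x => \int[m2]_y F (x, y)) -> Lone (m1 \x m2)%E F.
Proof.
move=> mF F0 iF /LoneP[_ iF2]; apply/integrable12ltyP; first exact/measurable_EFinP.
apply: le_lt_trans iF2; rewrite le_eqVlt; apply/orP; left; apply/eqP.
apply: eq_integral => x _ /=.
rewrite ger0_norm; last exact: rint_ge0.
by rewrite rint_EFin//; apply: eq_integral => y _; rewrite /= ger0_norm.
Qed.

Lemma Lone_prod2 F : measurable_fun setT F -> (forall z, 0 <= F z) ->
  (forall y, Lone m1 (fun x => F (x, y))) ->
  Lone m2 (fun y => \int[m1]_x F (x, y)) -> Lone (m1 \x m2)%E F.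
Proof.
move=> mF F0 iF /LoneP[_ iF2]; apply/integrable21ltyP; first exact/measurable_EFinP.
apply: le_lt_trans iF2; rewrite le_eqVlt; apply/orP; left; apply/eqP.
apply: eq_integral => x _ /=.
rewrite ger0_norm; last exact: rint_ge0.
by rewrite rint_EFin//; apply: eq_integral => y _; rewrite /= ger0_norm.
Qed.

Lemma Lone_Fubini1 F : Lone (m1 \x m2)%E F -> Lone m1 (fun x => \int[m2]_y F (x, y)).
Proof.
move=> iF; have := integrable_fubini_F iF => iFF.
apply/LoneP; split; first exact: (rint_meas1 iF).
have /integrableP[_] := iFF; apply: le_lt_trans; rewrite le_eqVlt; apply/orP; left; apply/eqP.
apply: ae_eq_integral => //.
- by apply/measurable_EFinP; apply: measurableT_comp => //; exact: (rint_meas1 iF).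
- by apply: measurableT_comp => //; exact: measurable_int iFF.
- apply: filterS (ae_integrable1 iF) => x ix _ /=.
  rewrite -abse_EFin; congr abse.
  by rewrite /Rintegral fineK//; exact: integrable_fin_num.
Qed.

Lemma Lone_tensor (F : T1 -> R) (G : T2 -> R) : Lone m1 F -> Lone m2 G ->
  Lone (m1 \x m2)%E (fun z => F z.1 * G z.2).
Proof.
move=> iF iG.
have mFG : measurable_fun setT (fun z : T1 * T2 => F z.1 * G z.2).
  apply: measurable_funM.
    exact: (measurableT_comp (Lone_meas iF) measurable_fst).
  exact: (measurableT_comp (Lone_meas iG) measurable_snd).
have h : Lone (m1 \x m2)%E (fun z => `|F z.1| * `|G z.2|).
  apply: Lone_prod1.
  - have := measurableT_comp (@normr_measurable R setT) mFG.
    by congr measurable_fun; apply/funext => z /=; rewrite normrM.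
  - by move=> z; rewrite mulr_ge0.
  - by move=> x /=; apply: LoneZ; exact: Lone_norm.
  - have := LoneZ (\int[m2]_y `|G y|) (Lone_norm iF).
    congr Lone; apply/funext => x /=; rewrite mulrC rintZ//.
    exact: (Lone_norm iG).
by apply: le_Lone h => // z; rewrite normrM.
Qed.

End product_integrability.

Section conj_integral.
Context {R : realType} d (T : measurableType d) (mu : {measure set T -> \bar R}).

Lemma cintegrable_conj (f : T -> R[i]) : cintegrable mu f -> cintegrable mu (fun x => (conjc (f x))).
Proof.
move=> [mf if_]; split; first exact: cmeas_conj.
by under eq_fun do rewrite normc_conj.
Qed.

Lemma cint_conj (f : T -> R[i]) : cintegrable mu f ->
  cint mu (fun x => (conjc (f x))) = (conjc (cint mu f)).
Proof.
move=> if_; apply: complexP; rewrite ?ReJ ?ImJ /cint /=.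
  by under eq_Rintegral do rewrite ReJ.
under eq_Rintegral do rewrite ImJ -mulN1r.
by rewrite rintZ ?mulN1r//; exact: cintegrable_Im.
Qed.

End conj_integral.

Section translation.
Context {R : realType} {n : nat}.
Local Notation leb := (lebesgue_rV R n).

Lemma Lone_translate (F : 'rV[R]_n -> R) y : Lone leb F -> Lone leb (fun x => F (x - y)).
Proof.
move=> /(Lone_affine (- y) ltr01); congr Lone.
by apply/funext => x; rewrite scale1r addrC.
Qed.

Lemma rint_translate (F : 'rV[R]_n -> R) y : Lone leb F ->
  \int[leb]_x F (x - y) = \int[leb]_x F x.
Proof.
move=> /(rint_affine (- y) ltr01); rewrite invr1 expr1n mul1r => <-.
by apply: eq_Rintegral => x _; rewrite scale1r addrC.
Qed.

Lemma cintegrable_translate (f : 'rV[R]_n -> R[i]) y : cintegrable leb f ->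
  cintegrable leb (fun x => f (x - y)).
Proof.
move=> /(cintegrable_affine (- y) ltr01); congr cintegrable.
by apply/funext => x; rewrite scale1r addrC.
Qed.

Lemma cint_translate (f : 'rV[R]_n -> R[i]) y : cintegrable leb f ->
  cint leb (fun x => f (x - y)) = cint leb f.
Proof.
move=> /(cint_affine (- y) ltr01); rewrite invr1 expr1n mul1r => <-.
by congr cint; apply/funext => x; rewrite scale1r addrC.
Qed.

End translation.

Section gauss_autocorrelation.
Context {R : realType} {n : nat}.
Local Notation leb := (lebesgue_rV R n).
Implicit Types (x y v : 'rV[R]_n).

(* Substituting x = (y + y') / 2 + w leaves a real Gaussian in w times a phase
   linear in w. *)
Lemma gauss_autocorrelation (a b : R) y y' : 0 < a ->
  cint leb (fun x => cexp (- a * sqn (x - y)) (b * sqn (x - y)) *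
                     (conjc (cexp (- a * sqn (x - y')) (b * sqn (x - y'))))) =
  (Num.sqrt (pi / (2 * a)) ^+ n *
     expR (- ((a ^+ 2 + b ^+ 2) / (2 * a)) * sqn (y - y')))%:C.
Proof.
move=> a0; have a20 : 0 < 2 * a by rewrite mulr_gt0.
pose d := y - y'; pose m := 2^-1 *: (y + y').
pose f w := cexp (- (2 * a) * sqn w) (dotp (- (2 * b) *: d) w).
have if_ : cintegrable leb f by apply: cintegrable_gauss => //; exact: measurable_dotp.
have dotZ k v w : dotp (k *: v) w = k * dotp v w.
  by rewrite /dotp mulr_sumr; apply: eq_bigr => i _; rewrite mxE mulrA.
have E x : cexp (- a * sqn (x - y)) (b * sqn (x - y)) *
      (conjc (cexp (- a * sqn (x - y')) (b * sqn (x - y')))) =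
    (expR (- (a / 2) * sqn d))%:C * f (x - m).
  rewrite cexp_conj -cexpD -cexp_real /f -cexpD add0r.
  have H1 : sqn (x - y) + sqn (x - y') = 2 * sqn (x - m) + 2^-1 * sqn d.
    rewrite /sqn !mulr_sumr -!big_split/=; apply: eq_bigr => i _.
    by rewrite !mxE; field.
  have H2 : sqn (x - y) - sqn (x - y') = - 2 * dotp d (x - m).
    rewrite /sqn /dotp !mulr_sumr -sumrB; apply: eq_bigr => i _.
    by rewrite !mxE; field.
  congr cexp; last by rewrite dotZ -mulrBr H2; ring.
  by rewrite -mulrDr H1; field.
under [X in cint _ X]funext do rewrite E.
rewrite cintZ; last exact: cintegrable_translate.
rewrite (cint_translate m if_) cint_gauss// -rmorphM/=; congr (_%:C).
rewrite mulrCA -expRD; congr (_ * expR _).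
by rewrite sqnZ -/d; field; rewrite gt_eqF.
Qed.

End gauss_autocorrelation.

(** [inLp] with a real integral and over any measure; [inLp_Lp] and [Lp_inLp] translate. *)
Definition Lp {R : realType} d (T : measurableType d) (mu : {measure set T -> \bar R})
    (p : R) (f : T -> R[i]) : Prop :=
  cmeas f /\ Lone mu (fun x => Normc.normc (f x) `^ p).

Section Lp2.
Context {R : realType} d (T : measurableType d) (mu : {measure set T -> \bar R}).
Implicit Types f g : T -> R[i].
Local Notation normc := Normc.normc.

Let half_conj : (2 : R)^-1 + 2^-1 = 1.
Proof. by field. Qed.

Lemma powR2_sqr (x : R) : 0 <= x -> x `^ 2 = x ^+ 2.
Proof. by move=> x0; rewrite powR_mulrn. Qed.

Lemma Lp2_mul f g : Lp mu 2 f -> Lp mu 2 g -> cintegrable mu (fun x => f x * g x).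
Proof.
move=> [mf if_] [mg ig]; split; first exact: cmeasM.
under eq_fun do rewrite Normc.normcM.
apply: (Lone_hoelder (ltr0n R 2) (ltr0n R 2) half_conj) => //.
- exact: measurable_normc.
- exact: measurable_normc.
- by move=> x; exact: normc_ge0.
- by move=> x; exact: normc_ge0.
Qed.

Lemma cauchy_schwarz f g : Lp mu 2 f -> Lp mu 2 g ->
  \int[mu]_x (normc (f x) * normc (g x)) <= lpow mu 2 f `^ 2^-1 * lpow mu 2 g `^ 2^-1.
Proof.
move=> [mf if_] [mg ig]; rewrite !lpowE.
apply: (rint_hoelder (ltr0n R 2) (ltr0n R 2) half_conj) => //.
- exact: measurable_normc.
- exact: measurable_normc.
- by move=> x; exact: normc_ge0.
- by move=> x; exact: normc_ge0.
Qed.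

Lemma Lp2_Lone_sqr f : Lp mu 2 f -> Lone mu (fun x => normc (f x) ^+ 2).
Proof.
move=> [_]; congr Lone; apply/funext => x; rewrite powR2_sqr//; exact: normc_ge0.
Qed.

Lemma Lone_sqr_Lp2 f : cmeas f -> Lone mu (fun x => normc (f x) ^+ 2) -> Lp mu 2 f.
Proof.
move=> mf if_; split => //; move: if_; congr Lone; apply/funext => x.
by rewrite powR2_sqr//; exact: normc_ge0.
Qed.

Lemma lpow2E f : lpow mu 2 f = \int[mu]_x (normc (f x) ^+ 2).
Proof.
by rewrite lpowE; apply: eq_Rintegral => x _; rewrite powR2_sqr//; exact: normc_ge0.
Qed.

End Lp2.

Fact hk_key : unit. Proof. exact: tt. Qed.
Fact hop_key : unit. Proof. exact: tt. Qed.

(** * Rotated heat kernels *)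

Section heat_kernel.
Context {R : realType} {n : nat}.
Local Notation leb := (lebesgue_rV R n).
Local Notation normc := Normc.normc.
Implicit Types (c s t : R) (x y v : 'rV[R]_n) (f g : 'rV[R]_n -> R[i]).

(* The kernel of exp ((c + i s) t Delta), up to a constant phase. *)
Definition hk : R -> R -> R -> 'rV[R]_n -> R[i] :=
  locked_with hk_key (fun c s t v => ((Num.sqrt (4 * pi * t))^-1 ^+ n)%:C *
    cexp (- (c / (4 * t)) * sqn v) (s / (4 * t) * sqn v)).

Lemma hkE c s t v : hk c s t v = ((Num.sqrt (4 * pi * t))^-1 ^+ n)%:C *
  cexp (- (c / (4 * t)) * sqn v) (s / (4 * t) * sqn v).
Proof. by rewrite /hk unlock. Qed.

Lemma normc_hk c s t v : normc (hk c s t v) =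
  (Num.sqrt (4 * pi * t))^-1 ^+ n * expR (- (c / (4 * t)) * sqn v).
Proof.
rewrite hkE Normc.normcM normc_cexp normc_real ger0_norm// exprn_ge0// invr_ge0 sqrtr_ge0.
Qed.

Lemma hkN c s t v : hk c s t (- v) = hk c s t v.
Proof. by rewrite !hkE sqnN. Qed.

Lemma hk_sym c s t x y : hk c s t (x - y) = hk c s t (y - x).
Proof. by rewrite -hkN opprB. Qed.

Lemma normc_hk_le c s t v : 0 < c -> 0 < t ->
  normc (hk c s t v) <= (Num.sqrt (4 * pi * t))^-1 ^+ n.
Proof.
move=> c0 t0; rewrite normc_hk ler_piMr ?exprn_ge0 ?invr_ge0 ?sqrtr_ge0//.
rewrite -[leRHS]expR0 ler_expR mulNr oppr_le0 mulr_ge0 ?sqn_ge0// divr_ge0 ?ltW//.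
by rewrite mulr_gt0.
Qed.

Lemma cmeas_hk c s t : cmeas (hk c s t).
Proof.
rewrite (funext (hkE c s t)); apply: cmeasM; first exact: cmeas_cst.
by apply: cmeas_cexp; apply: measurable_funM => //; exact: measurable_sqn.
Qed.

Let ct c t : 0 < c -> 0 < t -> 0 < c / (4 * t).
Proof. by move=> c0 t0; rewrite divr_gt0// mulr_gt0. Qed.

Lemma Lone_hk c s t : 0 < c -> 0 < t -> Lone leb (fun v => normc (hk c s t v)).
Proof.
move=> c0 t0; under eq_fun do rewrite normc_hk.
by apply: LoneZ; apply: Lone_gauss; exact: ct.
Qed.

Lemma cintegrable_hk c s t : 0 < c -> 0 < t -> cintegrable leb (hk c s t).
Proof. by move=> c0 t0; split; [exact: cmeas_hk|exact: Lone_hk]. Qed.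

Lemma cmeas_hk_shift c s t x : cmeas (fun y => hk c s t (x - y)).
Proof.
apply: (@cmeas_comp _ _ _ _ _ (fun y : 'rV[R]_n => x - y)); last exact: cmeas_hk.
by apply: measurable_fun_sub => //; exact: measurable_cst.
Qed.

Lemma Lone_hk_shift c s t x : 0 < c -> 0 < t ->
  Lone leb (fun y => normc (hk c s t (x - y))).
Proof.
move=> c0 t0; have := Lone_translate x (Lone_hk s c0 t0); congr Lone.
by apply/funext => y; rewrite hk_sym.
Qed.

Lemma Lp2_hk_shift c s t x : 0 < c -> 0 < t -> Lp leb 2 (fun y => hk c s t (x - y)).
Proof.
move=> c0 t0; apply: Lone_sqr_Lp2; first exact: cmeas_hk_shift.
set M := (Num.sqrt (4 * pi * t))^-1 ^+ n.
apply: (le_Lone _ _ (LoneZ M (Lone_hk_shift s x c0 t0))).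
  by apply: measurable_funX; apply: measurable_normc; exact: cmeas_hk_shift.
move=> y; rewrite ger0_norm ?exprn_ge0 ?normc_ge0// expr2.
by rewrite ler_wpM2r ?normc_ge0// normc_hk_le.
Qed.

Lemma cmeas_hk_sub c s t :
  cmeas (fun z : 'rV[R]_n * 'rV[R]_n => hk c s t (z.1 - z.2)).
Proof.
apply: (@cmeas_comp _ _ _ _ _ (fun z : 'rV[R]_n * 'rV[R]_n => z.1 - z.2)).
  exact: (measurable_fun_sub measurable_fst measurable_snd).
exact: cmeas_hk.
Qed.

Lemma cintegrable_hk_pair c s t y y' : 0 < c -> 0 < t ->
  cintegrable leb (fun x => hk c s t (x - y) * conjc (hk c s t (x - y'))).
Proof.
move=> c0 t0.
have L2 z : Lp leb 2 (fun x => hk c s t (x - z)).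
  by under eq_fun do rewrite hk_sym; exact: Lp2_hk_shift.
apply: Lp2_mul; first exact: L2.
have [m1 i1] := L2 y'; split; first exact: cmeas_conj.
by under eq_fun do rewrite normc_conj.
Qed.

(** In [gauss_autocorrelation] with a = c/(4t) and b = s/(4t), the relation c^2 + s^2 = 1 makes the
    rate (a^2 + b^2)/(2a) equal to 1/(8tc): the result is the real heat kernel at time 2tc. *)
Lemma hk_autocorrelation c s t y y' : 0 < c -> 0 < t -> c ^+ 2 + s ^+ 2 = 1 ->
  cint leb (fun x => hk c s t (x - y) * conjc (hk c s t (x - y'))) =
  ((Num.sqrt (8 * pi * (t * c)))^-1 ^+ n *
     expR (- (8 * (t * c))^-1 * sqn (y - y')))%:C.
Proof.
move=> c0 t0 cs1; have a0 := ct c0 t0.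
have tc0 : 0 < t * c by rewrite mulr_gt0.
set M := (Num.sqrt (4 * pi * t))^-1 ^+ n.
have E x : hk c s t (x - y) * conjc (hk c s t (x - y')) = (M ^+ 2)%:C *
    (cexp (- (c / (4 * t)) * sqn (x - y)) (s / (4 * t) * sqn (x - y)) *
     conjc (cexp (- (c / (4 * t)) * sqn (x - y')) (s / (4 * t) * sqn (x - y')))).
  rewrite !hkE -/M conjcM (conjc_real M) expr2 rmorphM /=; ring.
under [X in cint _ X]funext do rewrite E.
have i0 := cintegrable_hk_pair s y y' c0 t0.
have M0 : 0 < M.
  by rewrite exprn_gt0// invr_gt0 sqrtr_gt0 !mulr_gt0// pi_gt0.
rewrite cintZ; last first.
  have := cintegrableZ ((M ^+ 2)^-1)%:C i0; congr cintegrable.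
  apply/funext => x; rewrite E mulrA -rmorphM/= mulVf ?mul1r//.
  by rewrite expf_neq0// gt_eqF.
rewrite gauss_autocorrelation// -rmorphM/=; congr (_%:C).
have -> : ((c / (4 * t)) ^+ 2 + (s / (4 * t)) ^+ 2) / (2 * (c / (4 * t))) =
    (8 * (t * c))^-1.
  by rewrite !expr_div_n -mulrDl cs1; field; rewrite !gt_eqF.
suff h : M ^+ 2 * Num.sqrt (pi / (2 * (c / (4 * t)))) ^+ n =
    (Num.sqrt (8 * pi * (t * c)))^-1 ^+ n by rewrite -h; ring.
rewrite -[M ^+ 2]exprM mulnC exprM -exprMn; congr (_ ^+ n).
have l0 : 0 <= (Num.sqrt (4 * pi * t))^-1 ^+ 2 * Num.sqrt (pi / (2 * (c / (4 * t)))).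
  by rewrite mulr_ge0 ?sqrtr_ge0// exprn_ge0// invr_ge0 sqrtr_ge0.
have r0 : 0 <= (Num.sqrt (8 * pi * (t * c)))^-1 by rewrite invr_ge0 sqrtr_ge0.
apply/eqP; rewrite -(@eqrXn2 _ 2 _ _ isT l0 r0).
have p0 := pi_gt0 R.
rewrite exprMn sqr_sqrtr; last first.
  by rewrite divr_ge0 ?ltW// mulr_gt0.
rewrite !exprVn !sqr_sqrtr ?mulr_ge0 ?(ltW p0) ?(ltW t0) ?(ltW tc0) ?(ltW c0)//.
apply/eqP; move: (pi : R) p0 => p p0; field.
by rewrite !gt_eqF.
Qed.

Lemma hk_conj c s t v : conjc (hk c s t v) = hk c (- s) t v.
Proof.
rewrite !hkE conjcM cexp_conj conjc_real; congr (_ * cexp _ _).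
by rewrite mulNr mulNr.
Qed.

Lemma hk_real_mass t : 0 < t -> \int[leb]_v normc (hk 1 0 t v) = 1.
Proof.
move=> t0; under eq_Rintegral do rewrite normc_hk.
rewrite rintZ; last by apply: Lone_gauss; exact: ct.
rewrite rint_gauss; last exact: ct.
rewrite exprVn (_ : pi / (1 / (4 * t)) = 4 * pi * t); last by field; rewrite gt_eqF.
by rewrite mulVf// expf_neq0// gt_eqF// sqrtr_gt0 !mulr_gt0// pi_gt0.
Qed.

Lemma hk_autocorrelation_hk c s t y y' : 0 < c -> 0 < t -> c ^+ 2 + s ^+ 2 = 1 ->
  cint leb (fun x => hk c s t (x - y) * conjc (hk c s t (x - y'))) =
  (normc (hk 1 0 (2 * (t * c)) (y - y')))%:C.
Proof.
move=> c0 t0 cs1; rewrite hk_autocorrelation// normc_hk; congr (_%:C).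
have tc0 : 0 < t * c by rewrite mulr_gt0.
rewrite (_ : 4 * pi * (2 * (t * c)) = 8 * pi * (t * c)); last by ring.
by rewrite (_ : 1 / (4 * (2 * (t * c))) = (8 * (t * c))^-1)//; field; rewrite !gt_eqF.
Qed.

Lemma measurable_hk_sub c s t :
  measurable_fun setT (fun z : 'rV[R]_n * 'rV[R]_n => normc (hk c s t (z.1 - z.2))).
Proof. by apply: measurable_normc; exact: cmeas_hk_sub. Qed.

Lemma Lone_hk_mul2 c s t (F : 'rV[R]_n -> R) : 0 < c -> 0 < t ->
  (forall x, 0 <= F x) -> Lone leb F ->
  Lone (leb \x leb)%E (fun z => normc (hk c s t (z.1 - z.2)) * F z.2).
Proof.
move=> c0 t0 F0 iF; apply: Lone_prod2.
- apply: measurable_funM; first exact: measurable_hk_sub.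
  exact: (measurableT_comp (Lone_meas iF) measurable_snd).
- by move=> z; rewrite mulr_ge0 ?normc_ge0.
- move=> y /=; have := LoneZ (F y) (Lone_translate y (Lone_hk s c0 t0)).
  by congr Lone; apply/funext => x; rewrite mulrC.
- have := LoneZ (\int[leb]_v normc (hk c s t v)) iF; congr Lone; apply/funext => y /=.
  rewrite -(rint_translate y (Lone_hk s c0 t0)) mulrC -rintZ; last first.
    exact: (Lone_translate y (Lone_hk s c0 t0)).
  by apply: eq_Rintegral => x _; rewrite mulrC.
Qed.

Lemma Lone_hk_mul1 c s t (F : 'rV[R]_n -> R) : 0 < c -> 0 < t ->
  (forall x, 0 <= F x) -> Lone leb F ->
  Lone (leb \x leb)%E (fun z => normc (hk c s t (z.1 - z.2)) * F z.1).
Proof.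
move=> c0 t0 F0 iF; apply: Lone_prod1.
- apply: measurable_funM; first exact: measurable_hk_sub.
  exact: (measurableT_comp (Lone_meas iF) measurable_fst).
- by move=> z; rewrite mulr_ge0 ?normc_ge0.
- move=> y /=; have := LoneZ (F y) (Lone_hk_shift s y c0 t0).
  by congr Lone; apply/funext => x; rewrite mulrC.
- have := LoneZ (\int[leb]_v normc (hk c s t v)) iF; congr Lone; apply/funext => y /=.
  rewrite -(rint_translate y (Lone_hk s c0 t0)) mulrC -rintZ; last first.
    exact: (Lone_translate y (Lone_hk s c0 t0)).
  by apply: eq_Rintegral => x _; rewrite mulrC hk_sym.
Qed.

(** The product of |g| and |f| is at most |g|^2 + |f|^2, and each square is integrable against the
    kernel because translates of the kernel have the same finite mass. *)
Lemma hk_form_cintegrable c s t f g : 0 < c -> 0 < t -> Lp leb 2 f -> Lp leb 2 g ->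
  cintegrable (leb \x leb)%E (fun z => g z.1 * (hk c s t (z.1 - z.2) * f z.2)).
Proof.
move=> c0 t0 f2 g2.
have key (A G F : R) : 0 <= A -> 0 <= G -> 0 <= F -> G * (A * F) <= A * (G ^+ 2 + F ^+ 2).
  move=> A0 G0 F0; rewrite mulrCA ler_wpM2l//.
  have := sqr_ge0 (G - F); have := sqr_ge0 G; have := sqr_ge0 F.
  by rewrite sqrrB mulr2n; lra.
have i1 := Lone_hk_mul1 s c0 t0 (fun x => exprn_ge0 2 (normc_ge0 (g x))) (Lp2_Lone_sqr g2).
have i2 := Lone_hk_mul2 s c0 t0 (fun x => exprn_ge0 2 (normc_ge0 (f x))) (Lp2_Lone_sqr f2).
apply: (le_cintegrable _ _ (LoneD i1 i2)).
- apply: cmeasM; first exact: (cmeas_comp measurable_fst g2.1).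
  apply: cmeasM; first exact: cmeas_hk_sub.
  exact: (cmeas_comp measurable_snd f2.1).
- by move=> z; rewrite 2!Normc.normcM -mulrDr; apply: key; exact: normc_ge0.
Qed.

Definition hop : R -> R -> R -> ('rV[R]_n -> R[i]) -> 'rV[R]_n -> R[i] :=
  locked_with hop_key (fun c s t f x => cint leb (fun y => hk c s t (x - y) * f y)).

Lemma hopE c s t f x : hop c s t f x = cint leb (fun y => hk c s t (x - y) * f y).
Proof. by rewrite /hop unlock. Qed.

Lemma hop_cintegrable c s t f x : 0 < c -> 0 < t -> Lp leb 2 f ->
  cintegrable leb (fun y => hk c s t (x - y) * f y).
Proof. by move=> c0 t0 f2; apply: Lp2_mul => //; exact: Lp2_hk_shift. Qed.

Lemma Lp2_gauss : Lp leb 2 (fun x => (expR (- (1 : R) * sqn x))%:C).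
Proof.
apply: Lone_sqr_Lp2; first by apply: cmeas_real; exact: measurable_gauss.
have := @Lone_gauss R n _ (ltr0n R 2); congr Lone; apply/funext => x.
rewrite normc_real ger0_norm ?expR_ge0// expr2 -expRD; congr expR; ring.
Qed.

(** Fubini yields measurability only for an integrand integrable on the product; a Gaussian factor
    in x provides this and is divided out afterwards. *)
Lemma cmeas_hop c s t f : 0 < c -> 0 < t -> Lp leb 2 f -> cmeas (hop c s t f).
Proof.
move=> c0 t0 f2.
have := cmeas_cint1 (hk_form_cintegrable s c0 t0 f2 Lp2_gauss).
move=> /(cmeasM (cmeas_real (measurable_gauss (- 1)))); congr cmeas.
apply/funext => x /=; rewrite cintZ; last exact: hop_cintegrable.
by rewrite hopE mulrA -rmorphM/= -expRD opprK mulNr addrN expR0 mul1r.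
Qed.

Lemma Lone_hk_mul_slice c s t f x : 0 < c -> 0 < t -> Lp leb 2 f ->
  Lone leb (fun y => normc (hk c s t (x - y)) * normc (f y) ^+ 2).
Proof.
move=> c0 t0 f2; have if2 := Lp2_Lone_sqr f2.
apply: (le_Lone _ _ (LoneZ ((Num.sqrt (4 * pi * t))^-1 ^+ n) if2)).
  apply: measurable_funM; first exact: Lone_meas (Lone_hk_shift s x c0 t0).
  by apply: measurable_funX; apply: measurable_normc; exact: f2.1.
move=> y; rewrite ger0_norm ?mulr_ge0 ?exprn_ge0 ?normc_ge0//.
by rewrite ler_wpM2r ?exprn_ge0 ?normc_ge0// normc_hk_le.
Qed.

(** Schur's test: Cauchy-Schwarz with the modulus of the kernel split into two square roots. The
    resulting L_2 bound carries the mass c^(-n/2) of that modulus, so it serves for integrability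
    and not for the sharp constant. *)
Lemma normc_hop_sqr c s t f x : 0 < c -> 0 < t -> Lp leb 2 f ->
  normc (hop c s t f x) ^+ 2 <= \int[leb]_v normc (hk c s t v) *
    \int[leb]_y (normc (hk c s t (x - y)) * normc (f y) ^+ 2).
Proof.
move=> c0 t0 f2; set I1 := \int[leb]_v _; set I2 := \int[leb]_y _.
have half0 : 0 < (2 : R)^-1 by rewrite invr_gt0.
have half1 : (2 : R)^-1 + 2^-1 = 1 by field.
have mk : measurable_fun setT (fun y => normc (hk c s t (x - y))).
  exact: Lone_meas (Lone_hk_shift s x c0 t0).
have mf := measurable_normc f2.1.
have i2 := Lone_hk_mul_slice s x c0 t0 f2.
have := @rint_hoelder_eq _ _ _ leb (fun y => normc (hk c s t (x - y)) `^ 2^-1)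
  (fun y => normc (hk c s t (x - y)) `^ 2^-1 * normc (f y))
  (fun y => normc (hk c s t (x - y)))
  (fun y => normc (hk c s t (x - y)) * normc (f y) ^+ 2) _ _ half0 half0 half1.
have E1 y : normc (hk c s t (x - y)) `^ 2^-1 `^ 2^-1^-1 = normc (hk c s t (x - y)).
  by rewrite -powRrM mulfV// powRr1// normc_ge0.
have E2 y : normc (hk c s t (x - y)) `^ 2^-1 * (normc (hk c s t (x - y)) `^ 2^-1 * normc (f y)) =
    normc (hk c s t (x - y) * f y).
  rewrite Normc.normcM mulrA -powRD ?half1 ?powRr1 ?normc_ge0//.
  by apply/implyP => /eqP; lra.
have EI : \int[leb]_y (normc (hk c s t (x - y)) `^ 2^-1 *
    (normc (hk c s t (x - y)) `^ 2^-1 * normc (f y))) =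
    \int[leb]_y normc (hk c s t (x - y) * f y).
  by apply: eq_Rintegral => y _; exact: E2.
have EI1 : \int[leb]_y normc (hk c s t (x - y)) = I1.
  rewrite /I1 -(rint_translate x (Lone_hk s c0 t0)).
  by apply: eq_Rintegral => y _; rewrite hk_sym.
rewrite EI EI1.
move=> H; have {}H : \int[leb]_y normc (hk c s t (x - y) * f y) <= I1 `^ 2^-1 * I2 `^ 2^-1.
  apply: H => //.
  - exact: measurable_funpowR.
  - by apply: measurable_funM => //; exact: measurable_funpowR.
  - by move=> y; exact: powR_ge0.
  - by move=> y; rewrite mulr_ge0 ?powR_ge0 ?normc_ge0.
  - move=> y; rewrite powRM ?powR_ge0 ?normc_ge0// E1 invrK powR_mulrn//.
    exact: normc_ge0.
  - exact: Lone_hk_shift.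
have I10 : 0 <= I1 by apply: rint_ge0 => y; exact: normc_ge0.
have I20 : 0 <= I2 by apply: rint_ge0 => y; rewrite mulr_ge0 ?exprn_ge0 ?normc_ge0.
have {}H : normc (hop c s t f x) <= I1 `^ 2^-1 * I2 `^ 2^-1.
  by rewrite hopE; apply: le_trans H; apply: normc_cint; exact: hop_cintegrable.
have H2 : normc (hop c s t f x) ^+ 2 <= (I1 `^ 2^-1 * I2 `^ 2^-1) ^+ 2.
  by rewrite ler_pXn2r// nnegrE ?normc_ge0// mulr_ge0 ?powR_ge0.
apply: (le_trans H2).
have sq (I : R) : 0 <= I -> (I `^ 2^-1) ^+ 2 = I.
  by move=> i0; rewrite -powR_mulrn ?powR_ge0// -powRrM mulVf// powRr1.
by rewrite exprMn (sq _ I10) (sq _ I20).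
Qed.

Lemma hop_Lp2 c s t f : 0 < c -> 0 < t -> Lp leb 2 f -> Lp leb 2 (hop c s t f).
Proof.
move=> c0 t0 f2; apply: Lone_sqr_Lp2; first exact: cmeas_hop.
have i2 := Lone_hk_mul2 s c0 t0 (fun x => exprn_ge0 2 (normc_ge0 (f x))) (Lp2_Lone_sqr f2).
apply: (le_Lone _ _ (LoneZ (\int[leb]_v normc (hk c s t v)) (Lone_Fubini1 i2))).
  by apply: measurable_funX; apply: measurable_normc; exact: cmeas_hop.
by move=> x; rewrite ger0_norm ?exprn_ge0 ?normc_ge0//; exact: normc_hop_sqr.
Qed.

Lemma Lp_conj p f : Lp leb p f -> Lp leb p (fun x => conjc (f x)).
Proof.
by move=> [mf if_]; split; [exact: cmeas_conj|under eq_fun do rewrite normc_conj].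
Qed.

(** For T = [hop c s t], the kernel of T*T is the autocorrelation of [hk], that is the real heat
    kernel at time 2tc. It is positive of mass 1, so Schur's test bounds <T*T f, f> by the square
    norm of f without loss, whatever the angle. *)
Lemma hop_contract c s t f : 0 < c -> 0 < t -> c ^+ 2 + s ^+ 2 = 1 -> Lp leb 2 f ->
  lpow leb 2 (hop c s t f) <= lpow leb 2 f.
Proof.
move=> c0 t0 cs1 f2; have h2 := hop_Lp2 s c0 t0 f2; have hc2 := Lp_conj h2.
have fc2 := Lp_conj f2.
set t' := 2 * (t * c); have t'0 : 0 < t' by rewrite !mulr_gt0.
pose G v := normc (hk 1 0 t' v).
(* The conjugate of T*T f at [y], the kernel [G] being real. *)
have E1 y : cint leb (fun x => conjc (hop c s t f x) * hk c s t (x - y)) =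
    cint leb (fun y' => conjc (f y') * (G (y - y'))%:C).
  have L2 : Lp leb 2 (fun x => hk c s t (x - y)).
    by under eq_fun do rewrite hk_sym; exact: Lp2_hk_shift.
  have i0 := hk_form_cintegrable (- s) c0 t0 fc2 L2.
  transitivity (cint leb (fun x => cint leb (fun y' => hk c s t (x - y) *
      (hk c (- s) t (x - y') * conjc (f y'))))).
    congr cint; apply/funext => x; rewrite cintZ; last exact: hop_cintegrable.
    rewrite mulrC; congr (_ * _); rewrite hopE -cint_conj; last exact: hop_cintegrable.
    by congr cint; apply/funext => y'; rewrite conjcM hk_conj.
  rewrite (cint_Fubini i0) /=; congr cint; apply/funext => y'.
  have -> : (G (y - y'))%:C =
      cint leb (fun x => hk c s t (x - y) * conjc (hk c s t (x - y'))).
    by rewrite hk_autocorrelation_hk.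
  rewrite -cintZ; last exact: cintegrable_hk_pair.
  by congr cint; apply/funext => x; rewrite hk_conj; ring.
have E2 : (lpow leb 2 (hop c s t f))%:C = cint leb (fun y => f y *
    cint leb (fun y' => conjc (f y') * (G (y - y'))%:C)).
  rewrite lpow2E -cint_real.
  transitivity (cint leb (fun x => cint leb (fun y => conjc (hop c s t f x) *
      (hk c s t (x - y) * f y)))).
    congr cint; apply/funext => x; rewrite cintZ; last exact: hop_cintegrable.
    by rewrite -hopE -mulcJ mulrC.
  rewrite (cint_Fubini (hk_form_cintegrable s c0 t0 f2 hc2)) /=.
  congr cint; apply/funext => y; rewrite -E1 -cintZ.
    by congr cint; apply/funext => x; ring.
  apply: Lp2_mul => //.
  by under eq_fun do rewrite hk_sym; exact: Lp2_hk_shift.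
have iG := Lone_hk 0 (ltr01 : 0 < (1 : R)) t'0.
have iGy y : Lone leb (fun y' => G (y - y')) := Lone_hk_shift 0 y ltr01 t'0.
have if2 := Lp2_Lone_sqr f2.
have iGf := Lone_hk_mul2 0 (ltr01 : 0 < (1 : R)) t'0
  (fun x => exprn_ge0 2 (normc_ge0 (f x))) if2.
have iH : Lone leb (fun y => \int[leb]_y' (G (y - y') * normc (f y') ^+ 2)).
  exact: (Lone_Fubini1 iGf).
pose S y := cint leb (fun y' => conjc (f y') * (G (y - y'))%:C).
have mS : cmeas S.
  have := cmeas_cint1 (hk_form_cintegrable 0 ltr01 t'0 fc2 Lp2_gauss).
  move=> /(cmeasM (cmeas_real (measurable_gauss (- 1)))); congr cmeas.
  apply/funext => x /=; rewrite cintZ; last exact: hop_cintegrable.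
  rewrite mulrA -rmorphM/= -expRD opprK mulNr addrN expR0 mul1r.
  congr cint; apply/funext => y; rewrite mulrC; congr (_ * _).
  by rewrite /G normc_hk hkE !mul0r cexp_real -rmorphM.
have iS y : Lone leb (fun y' => G (y - y') * normc (f y') ^+ 2).
  exact: Lone_hk_mul_slice.
have mass y : \int[leb]_y' G (y - y') = 1.
  rewrite -(hk_real_mass t'0) -(rint_translate y (Lone_hk 0 ltr01 t'0)).
  by apply: eq_Rintegral => y' _; rewrite /G hk_sym.
(* The inequality ab <= (a^2 + b^2)/2 with weight g; each half then integrates to half of the square
   norm, as G has mass 1 in either variable. *)
have key (a b g : R) : 0 <= g -> a * b * g <= 2^-1 * a ^+ 2 * g + 2^-1 * (g * b ^+ 2).
  move=> g0; rewrite -subr_ge0 (_ : _ - _ = 2^-1 * (g * (a - b) ^+ 2)); last by field.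
  by rewrite mulr_ge0 ?invr_ge0// mulr_ge0// sqr_ge0.
have bound y : normc (f y) * normc (S y) <= 2^-1 * normc (f y) ^+ 2 +
    2^-1 * \int[leb]_y' (G (y - y') * normc (f y') ^+ 2).
  have iSy : cintegrable leb (fun y' => conjc (f y') * (G (y - y'))%:C).
    apply: Lp2_mul => //; have [m2 i2] := Lp2_hk_shift 0 y ltr01 t'0; split.
      by apply: cmeas_real; exact: Lone_meas (iGy y).
    by under eq_fun do rewrite normc_real ger0_norm ?normc_ge0//.
  have iGf1 : Lone leb (fun y' => normc (f y') * G (y - y')).
    have [_] := iSy; congr Lone; apply/funext => y'.
    by rewrite Normc.normcM normc_conj normc_real ger0_norm ?normc_ge0.
  apply: (@le_trans _ _ (normc (f y) * \int[leb]_y' (normc (f y') * G (y - y')))).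
    rewrite ler_wpM2l ?normc_ge0//; apply: (le_trans (normc_cint iSy)).
    apply: eq_ler; apply: eq_Rintegral => y' _.
    by rewrite Normc.normcM normc_conj normc_real ger0_norm ?normc_ge0.
  rewrite -rintZ//.
  have -> : 2^-1 * normc (f y) ^+ 2 + 2^-1 * \int[leb]_y' (G (y - y') * normc (f y') ^+ 2) =
      \int[leb]_y' (2^-1 * normc (f y) ^+ 2 * G (y - y') +
        2^-1 * (G (y - y') * normc (f y') ^+ 2)).
    rewrite rintD; [|exact: LoneZ|exact: LoneZ].
    by rewrite rintZ// mass mulr1 rintZ.
  apply: le_rint; [exact: LoneZ|by apply: LoneD; exact: LoneZ|move=> y'].
  have G0 : 0 <= G (y - y') by exact: normc_ge0.
  by rewrite mulrA; exact: key.
have iB : Lone leb (fun y => 2^-1 * normc (f y) ^+ 2 +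
    2^-1 * \int[leb]_y' (G (y - y') * normc (f y') ^+ 2)).
  by apply: LoneD; exact: LoneZ.
have i1 : cintegrable leb (fun y => f y * S y).
  apply: (le_cintegrable _ _ iB); first exact: cmeasM f2.1 mS.
  by move=> y; rewrite Normc.normcM; exact: bound.
rewrite -[leLHS]ger0_norm ?lpow_ge0// -normc_real E2.
apply: (le_trans (normc_cint i1)).
apply: (@le_trans _ _ (\int[leb]_y (2^-1 * normc (f y) ^+ 2 +
    2^-1 * \int[leb]_y' (G (y - y') * normc (f y') ^+ 2)))).
  apply: le_rint; [exact: i1.2|exact: iB|].
  by move=> y; rewrite Normc.normcM; exact: bound.
rewrite rintD; [|exact: LoneZ|exact: LoneZ].
rewrite (rintZ _ if2) (rintZ _ iH) (rint_Fubini1 iGf) -(rint_Fubini2 iGf) lpow2E.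
have -> : \int[leb]_y (\int[leb]_x (normc (hk 1 0 t' ((x, y).1 - (x, y).2)) *
    normc (f (x, y).2) ^+ 2)) = \int[leb]_y normc (f y) ^+ 2.
  apply: eq_Rintegral => y _ /=.
  transitivity (normc (f y) ^+ 2 * \int[leb]_x G (x - y)).
    rewrite -rintZ; last exact: Lone_translate iG.
    by apply: eq_Rintegral => x _; rewrite mulrC.
  by rewrite (rint_translate y iG) hk_real_mass// mulr1.
by apply: eq_ler; rewrite -mulrDl; have -> : (2 : R)^-1 + 2^-1 = 1; [by field|rewrite mul1r].
Qed.

Lemma hop_bilinear c s t f g : 0 < c -> 0 < t -> c ^+ 2 + s ^+ 2 = 1 ->
  Lp leb 2 f -> Lp leb 2 g ->
  normc (cint leb (fun x => g x * hop c s t f x)) <=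
    lpow leb 2 g `^ 2^-1 * lpow leb 2 f `^ 2^-1.
Proof.
move=> c0 t0 cs1 f2 g2; have h2 := hop_Lp2 s c0 t0 f2.
apply: (le_trans (normc_cint (Lp2_mul g2 h2))).
under eq_Rintegral do rewrite Normc.normcM.
apply: (le_trans (cauchy_schwarz g2 h2)); rewrite ler_wpM2l ?powR_ge0//.
by apply: ge0_ler_powR; rewrite ?nnegrE ?lpow_ge0 ?invr_ge0// hop_contract.
Qed.

End heat_kernel.

(** * Restriction to sets of finite measure *)

Section restricted_measure.
Context {R : realType} d (T : measurableType d) (mu : {measure set T -> \bar R}).
Variables (D : set T) (mD : measurable D) (Doo : (mu D < +oo)%E).
Local Notation nu := (mfrestr mD Doo).

Lemma rint_mfrestr0 (F : T -> R) : (forall x, ~ D x -> F x = 0) ->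
  \int[nu]_x F x = \int[mu]_x F x.
Proof.
move=> F0; have E : (fun x => (F x)%:E) = (EFin \o F) \_ D.
  apply/funext => x; rewrite patchE; case: ifPn => //; rewrite notin_setE => /F0 ->//.
rewrite /Rintegral E -!integral_mkcond; congr fine; apply: eq_measure_integral => A mA AD.
by rewrite /= /mfrestr /mrestr setIidl.
Qed.

Lemma rint_mfrestr (F : T -> R) : measurable_fun setT F ->
  \int[nu]_x F x = \int[mu]_x (F x * \1_D x).
Proof.
move=> mF; have mFD : measurable_fun setT (fun x => F x * \1_D x).
  by apply: measurable_funM.
rewrite -rint_mfrestr0; last by move=> x Dx; rewrite indicE memNset ?mulr0.
apply: rint_ae => //; exists (~` D); split.
- exact: measurableC.
- by rewrite /= /mfrestr /mrestr setICl measure0.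
- move=> x /= h Dx; apply: h; rewrite indicE mem_set// mulr1//.
Qed.

Lemma cint_mfrestr0 (f : T -> R[i]) : (forall x, ~ D x -> f x = 0) ->
  cint nu f = cint mu f.
Proof. by move=> f0; apply: complexP; rewrite /cint /= rint_mfrestr0// => x /f0 ->. Qed.

Lemma cint_mfrestr (f : T -> R[i]) : cmeas f ->
  cint nu f = cint mu (fun x => f x * (\1_D x)%:C).
Proof.
move=> [mf1 mf2]; apply: complexP; rewrite /cint /= rint_mfrestr//.
  by apply: eq_Rintegral => x _; case: (f x) => a b /=; rewrite mulr0 subr0.
by apply: eq_Rintegral => x _; case: (f x) => a b /=; rewrite mulr0 add0r.
Qed.

End restricted_measure.

Lemma le_cvg0 {R : realType} (a b : R) (e : nat -> R) :
  (forall k, a <= b + e k) -> e k @[k --> \oo] --> 0 -> a <= b.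
Proof.
move=> ab e0; rewrite -[b]addr0.
have cv : b + e k @[k --> \oo] --> b + 0 by apply: cvgD; [exact: cvg_cst|].
rewrite -(cvg_lim _ cv)//; apply: limr_ge; first by apply/cvg_ex; exists (b + 0).
by apply: nearW.
Qed.

Lemma cvg0_powR_half {R : realType} (e : nat -> R) : (forall k, 0 <= e k) ->
  e k @[k --> \oo] --> 0 -> e k `^ 2^-1 @[k --> \oo] --> 0.
Proof.
move=> e0 cv; under eq_fun do rewrite powR12_sqrt//.
have := cvg_comp _ _ cv (@sqrt_continuous R 0).
by rewrite sqrtr0.
Qed.

Section heat_estimates.
Context {R : realType} {n : nat}.
Local Notation leb := (lebesgue_rV R n).
Local Notation normc := Normc.normc.
Implicit Types (c s t : R) (x y v : 'rV[R]_n) (f g : 'rV[R]_n -> R[i]).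

Lemma hk_scale c s t v : 0 < t ->
  hk c s t (Num.sqrt t *: v) = ((Num.sqrt t)^-1 ^+ n)%:C * hk c s 1 v.
Proof.
move=> t0; have t1 := gt_eqF t0; rewrite !hkE sqnZ sqr_sqrtr ?ltW//.
have -> : Num.sqrt (4 * pi * t) = Num.sqrt t * Num.sqrt (4 * pi * 1).
  by rewrite -sqrtrM ?ltW// mulr1 mulrC.
have -> : - (c / (4 * t)) * (t * sqn v) = - (c / (4 * 1)) * sqn v by field; rewrite t1.
have -> : s / (4 * t) * (t * sqn v) = s / (4 * 1) * sqn v by field; rewrite t1.
by rewrite invfM exprMn rmorphM /= mulrA.
Qed.

Definition hmass c s := cint leb (hk c s 1).

(** Integrating the autocorrelation of the kernel in two ways gives the squared modulus of the mass
    and the mass 1 of a real heat kernel. Thus the phase left out of [hk] has modulus 1. *)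
Lemma normc_hmass c s : 0 < c -> c ^+ 2 + s ^+ 2 = 1 -> normc (hmass c s) = 1.
Proof.
move=> c0 cs1.
have i1 : cintegrable leb (hk c s 1) := cintegrable_hk s c0 ltr01.
have ii : cintegrable (leb \x leb)%E
    (fun z : 'rV[R]_n * 'rV[R]_n => hk c s 1 z.1 * conjc (hk c s 1 (z.1 - z.2))).
  have iL := Lone_hk_mul1 s c0 ltr01 (fun x => normc_ge0 (hk c s 1 x)) i1.2.
  apply: (le_cintegrable _ _ iL).
    apply: cmeasM; first exact: (cmeas_comp measurable_fst i1.1).
    by apply: cmeas_conj; exact: cmeas_hk_sub.
  by move=> z; rewrite Normc.normcM normc_conj mulrC.
have E1 : cint leb (fun y => cint leb (fun x => hk c s 1 x * conjc (hk c s 1 (x - y)))) = 1.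
  transitivity (cint leb (fun y => (normc (hk 1 0 (2 * (1 * c)) y))%:C)).
    congr cint; apply/funext => y; have := hk_autocorrelation_hk 0 y c0 ltr01 cs1.
    rewrite sub0r hkN => <-; congr cint; apply/funext => x.
    by rewrite subr0.
  by rewrite cint_real hk_real_mass// !mulr_gt0.
have E2 : cint leb (fun y => cint leb (fun x => hk c s 1 x * conjc (hk c s 1 (x - y)))) =
    hmass c s * conjc (hmass c s).
  rewrite -(cint_Fubini ii) /hmass mulrC -cintZ//; congr cint; apply/funext => x.
  have iS : cintegrable leb (fun y => hk c s 1 (x - y)).
    by split; [exact: cmeas_hk_shift|exact: Lone_hk_shift].
  rewrite [RHS]mulrC -cint_conj// -(cint_translate x (cintegrable_conj i1)) -cintZ.
    by congr cint; apply/funext => y /=; rewrite hk_sym.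
  exact: (cintegrable_translate x (cintegrable_conj i1)).
have : (normc (hmass c s) ^+ 2)%:C = (1 : R)%:C by rewrite -mulcJ -E2 E1.
move=> /complexI /eqP; rewrite -[1](expr1n _ 2) eqrXn2 ?normc_ge0// => /eqP.
by rewrite expr1n.
Qed.

Definition cut (D : set 'rV[R]_n) f x : R[i] := f x * (\1_D x)%:C.

Lemma cmeas_cut D f : measurable D -> cmeas f -> cmeas (cut D f).
Proof. by move=> mD mf; apply: cmeasM => //; apply: cmeas_real. Qed.

Lemma normc_cut D f x : normc (cut D f x) = normc (f x) * \1_D x.
Proof. by rewrite Normc.normcM normc_real ger0_norm. Qed.

Lemma normc_cut_le D f x : normc (cut D f x) <= normc (f x).
Proof. by rewrite normc_cut indicE; case: (x \in D); rewrite ?mulr1 ?mulr0 ?normc_ge0. Qed.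

Lemma cut_id (D : set 'rV[R]_n) f : (forall x, ~ D x -> f x = 0) -> cut D f = f.
Proof.
move=> f0; apply/funext => x; rewrite /cut indicE.
by have [|] := boolP (x \in D); rewrite ?mulr1// notin_setE => /f0 ->; rewrite mul0r.
Qed.

Lemma Lp_cut (D : set 'rV[R]_n) (p : R) f : measurable D -> 0 < p ->
  Lp leb p f -> Lp leb p (cut D f).
Proof.
move=> mD p0 [mf if_]; have mc := cmeas_cut mD mf; split => //.
apply: (le_Lone _ _ if_); first exact: measurable_funpowR (measurable_normc mc).
move=> x; rewrite ger0_norm ?powR_ge0//.
by apply: ge0_ler_powR; rewrite ?nnegrE ?normc_ge0 ?(ltW p0) ?normc_cut_le.
Qed.

Lemma Lone_indic (D : set 'rV[R]_n) : measurable D -> (leb D < +oo)%E ->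
  Lone leb (fun x => \1_D x).
Proof.
move=> mD Doo; apply/LoneP; split; first exact: measurable_indic.
under eq_integral do rewrite ger0_norm//.
by rewrite integral_indic// setIT.
Qed.

Lemma cbounded_cut_Lp (D : set 'rV[R]_n) (p : R) f : measurable D -> (leb D < +oo)%E ->
  0 < p -> cbounded_meas f -> Lp leb p (cut D f).
Proof.
move=> mD Doo p0 [mf [C fC]]; have mc := cmeas_cut mD mf; split => //.
apply: (le_Lone _ _ (LoneZ (`|C| `^ p) (Lone_indic mD Doo))).
  exact: measurable_funpowR (measurable_normc mc).
move=> x; rewrite ger0_norm ?powR_ge0// normc_cut indicE.
case: (x \in D); rewrite ?mulr1 ?mulr0 ?powR0 ?gt_eqF//.
apply: ge0_ler_powR; rewrite ?nnegrE ?normc_ge0 ?(ltW p0)//.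
exact: le_trans (fC x) (ler_norm _).
Qed.

Lemma lpow_cut_le (D : set 'rV[R]_n) (p : R) f : measurable D -> 0 < p ->
  Lp leb p f -> lpow leb p (cut D f) <= lpow leb p f.
Proof.
move=> mD p0 f2; rewrite !lpowE; apply: le_rint; [exact: (Lp_cut mD p0 f2).2|exact: f2.2|].
by move=> x; apply: ge0_ler_powR; rewrite ?nnegrE ?normc_ge0 ?(ltW p0) ?normc_cut_le.
Qed.

(** The interpolation theorem is applied to Lebesgue measure restricted to [D]. The compressed
    operator is [hop] of a cut function, and cutting its image again preserves the L_2 contraction;
    the kernel bound [M] is the prefactor of [hk]. *)
Lemma hop_interp_bounded c s t (q : R) (D : set 'rV[R]_n) f g :
  0 < c -> 0 < t -> c ^+ 2 + s ^+ 2 = 1 -> 2 < q ->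
  measurable D -> (leb D < +oo)%E ->
  cbounded_meas f -> (forall x, ~ D x -> f x = 0) ->
  cbounded_meas g -> (forall x, ~ D x -> g x = 0) ->
  normc (cint leb (fun x => g x * hop c s t f x)) <=
    ((Num.sqrt (4 * pi * t))^-1 ^+ n) `^ ((q - 2) / q) *
    lpow leb (q / (q - 1)) f `^ ((q - 1) / q) *
    lpow leb (q / (q - 1)) g `^ ((q - 1) / q).
Proof.
move=> c0 t0 cs1 q2 mD Doo bf f0 bg g0.
have [q0 q1 qq _ _] := conj_exponent q2.
pose nu := mfrestr mD Doo; pose k x y : R[i] := hk c s t (x - y).
pose M := (Num.sqrt (4 * pi * t))^-1 ^+ n.
have M0 : 0 < M.
  by rewrite exprn_gt0// invr_gt0 sqrtr_gt0 !mulr_gt0// pi_gt0.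
have mk : cmeas (fun z : 'rV[R]_n * 'rV[R]_n => k z.1 z.2) by exact: cmeas_hk_sub.
have kM x y : normc (k x y) <= M by exact: normc_hk_le.
have ksym x y : k x y = k y x by exact: hk_sym.
have E h x : cmeas h -> kop nu k h x = hop c s t (cut D h) x.
  move=> mh; rewrite kopE hopE cint_mfrestr; last by apply: cmeasM => //; exact: cmeas_hk_shift.
  by congr cint; apply/funext => y; rewrite /cut mulrA.
have lpw h (e : R) : 0 < e -> cmeas h -> lpow nu e h = lpow leb e (cut D h).
  move=> e0 mh; rewrite !lpowE rint_mfrestr; last exact: measurable_funpowR (measurable_normc mh).
  apply: eq_Rintegral => x _; rewrite normc_cut indicE.
  by case: (x \in D); rewrite ?mulr1 ?mulr0 ?powR0 ?gt_eqF.
have kL2 h : cbounded_meas h ->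
    \int[nu]_x (normc (kop nu k h x) `^ 2) <= \int[nu]_x (normc (h x) `^ 2).
  move=> bh; have h2 := cbounded_cut_Lp mD Doo (ltr0n R 2) bh.
  have mkh : cmeas (kop nu k h) by have [] := kop_bounded nu mk kM bh.
  have := lpw _ _ (ltr0n R 2) mkh; rewrite lpowE => ->.
  have := lpw _ _ (ltr0n R 2) bh.1; rewrite lpowE => ->.
  apply: le_trans (hop_contract c0 t0 cs1 h2).
  rewrite (_ : kop nu k h = hop c s t (cut D h)); last by apply/funext => x; exact/E/bh.1.
  by apply: lpow_cut_le => //; exact: hop_Lp2.
have := kop_bilinear_interp M0 mk kM ksym kL2 q2 bf bg.
rewrite (lpw _ _ qq bf.1) (lpw _ _ qq bg.1) !cut_id//.
rewrite (_ : kop nu k f = hop c s t f); last first.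
  by apply/funext => x; rewrite E ?cut_id//; exact: bf.1.
by rewrite cint_mfrestr0// => x /g0 ->; rewrite mul0r.
Qed.

Lemma hopD c s t f g x : 0 < c -> 0 < t -> Lp leb 2 f -> Lp leb 2 g ->
  hop c s t (fun y => f y + g y) x = hop c s t f x + hop c s t g x.
Proof.
move=> c0 t0 f2 g2; rewrite !hopE -cintD; [|exact: hop_cintegrable|exact: hop_cintegrable].
by congr cint; apply/funext => y; rewrite mulrDr.
Qed.

Lemma cutDC (D : set 'rV[R]_n) f x : cut D f x + cut (~` D) f x = f x.
Proof.
rewrite /cut -mulrDr -rmorphD/= !indicE in_setC.
by case: (x \in D); rewrite ?addr0 ?add0r mulr1.
Qed.

Lemma lpow_cutC_cvg0 (E : nat -> set 'rV[R]_n) f : (forall k, measurable (E k)) ->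
  (forall x, \forall k \near \oo, E k x) -> Lp leb 2 f ->
  lpow leb 2 (cut (~` E k) f) @[k --> \oo] --> 0.
Proof.
move=> mE cE f2; have if2 := Lp2_Lone_sqr f2.
have mC k : cmeas (cut (~` E k) f) by apply: cmeas_cut f2.1; exact: measurableC.
have mC2 k := measurable_funX 2 (measurable_normc (mC k)).
have b k x : `|normc (cut (~` E k) f x) ^+ 2| <= normc (f x) ^+ 2.
  rewrite ger0_norm ?exprn_ge0 ?normc_ge0//.
  by rewrite ler_pXn2r ?nnegrE ?normc_ge0 ?normc_cut_le.
have cv : {ae leb, forall x, normc (cut (~` E k) f x) ^+ 2 @[k --> \oo] --> (0 : R)}.
  apply/aeW => x; apply: cvg_near_cst.
  apply: filterS (cE x) => k Ekx; rewrite normc_cut indicE memNset; last by apply.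
  by rewrite mulr0 expr0n.
have [_] := @rint_dominated _ _ _ leb _ (fun=> 0) _ mC2 (measurable_cst (0 : R)) cv if2 b.
rewrite [X in _ --> X -> _](_ : _ = 0); last by rewrite /Rintegral integral0.
by under eq_fun do rewrite -lpow2E.
Qed.

Lemma measurable_sqn_ball k : measurable [set x : 'rV[R]_n | sqn x <= k%:R].
Proof.
rewrite -[X in measurable X]setTI; apply: (measurable_fun_le _ _ _) => //.
exact: measurable_sqn.
Qed.

Lemma lebesgue_sqn_ball k : (leb [set x : 'rV[R]_n | (sqn x <= k%:R)%R] < +oo)%E.
Proof.
have mB := measurable_sqn_ball k; rewrite -[X in leb X]setIT -integral_indic//.
have /LoneP[_] := LoneZ (expR k%:R) (Lone_gauss n (ltr01 : 0 < (1 : R))).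
apply: le_lt_trans; apply: ge0_le_integral => //.
- by apply/measurable_EFinP; exact: measurable_indic.
- apply/measurable_EFinP; apply: measurableT_comp => //.
  by apply: measurable_funM => //; exact: measurable_gauss.
- move=> x _; rewrite lee_fin; apply: le_trans (ler_norm _).
  rewrite indicE; case: (boolP (_ \in _)) => [|_]; last by rewrite mulr_ge0 ?expR_ge0.
  by rewrite inE /= => h; rewrite -expRD mulN1r -[leLHS]expR0 ler_expR subr_ge0.
Qed.

(** Truncation in space and in size makes [f] bounded; the remainder tends to 0 in L_2 and is
    handled by [hop_bilinear], whence the hypothesis that [f] is in L_2 as well as in L_p. *)
Lemma hop_interp c s t (q : R) (D : set 'rV[R]_n) f g :
  0 < c -> 0 < t -> c ^+ 2 + s ^+ 2 = 1 -> 2 < q ->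
  measurable D -> (leb D < +oo)%E ->
  Lp leb 2 f -> Lp leb (q / (q - 1)) f ->
  cbounded_meas g -> (forall x, ~ D x -> g x = 0) ->
  normc (cint leb (fun x => g x * hop c s t f x)) <=
    ((Num.sqrt (4 * pi * t))^-1 ^+ n) `^ ((q - 2) / q) *
    lpow leb (q / (q - 1)) f `^ ((q - 1) / q) *
    lpow leb (q / (q - 1)) g `^ ((q - 1) / q).
Proof.
move=> c0 t0 cs1 q2 mD Doo f2 fp bg g0.
have [q0 q1 qq _ _] := conj_exponent q2.
have g2 : Lp leb 2 g by rewrite -(cut_id g0); exact: cbounded_cut_Lp.
pose B k := [set x : 'rV[R]_n | sqn x <= k%:R].
pose E k := B k `&` [set x | normc (f x) <= k%:R].
have mB k : measurable (B k) := measurable_sqn_ball k.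
have mE k : measurable (E k).
  apply: measurableI => //; rewrite -[X in measurable X]setTI.
  by apply: (measurable_fun_le _ _ _) => //; exact: measurable_normc f2.1.
have cE x : \forall k \near \oo, E k x.
  exists (maxn (Num.truncn (sqn x)).+1 (Num.truncn (normc (f x))).+1) => // k /=.
  rewrite geq_max => /andP[k1 k2]; split => /=; apply: (le_trans (ltW (truncnS_gt _))).
    by rewrite ler_nat.
  by rewrite ler_nat.
have b0 : lpow leb 2 g `^ 2^-1 * lpow leb 2 (cut (~` E k) f) `^ 2^-1 @[k --> \oo] --> 0.
  rewrite -[X in _ --> X](mulr0 (lpow leb 2 g `^ 2^-1)); apply: cvgMr.
  by apply: cvg0_powR_half => [k|]; [exact: lpow_ge0|exact: lpow_cutC_cvg0].
apply: (le_cvg0 _ b0) => k.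
have fk2 := Lp_cut (mE k) (ltr0n R 2) f2.
have fc2 := Lp_cut (measurableC (mE k)) (ltr0n R 2) f2.
rewrite (_ : (fun x => _) = fun x => g x * hop c s t (cut (E k) f) x +
    g x * hop c s t (cut (~` E k) f) x); last first.
  by apply/funext => x; rewrite -mulrDr -hopD//; congr (_ * hop _ _ _ _ _); apply/funext => y; rewrite cutDC.
rewrite cintD; [|apply: Lp2_mul => //; exact: hop_Lp2|apply: Lp2_mul => //; exact: hop_Lp2].
apply: (le_trans (le_normcD _ _)); apply: lerD; last exact: hop_bilinear.
have Fb : cbounded_meas (cut (E k) f).
  split; first exact: fk2.1.
  exists k%:R => x; rewrite normc_cut indicE.
  case: (boolP (x \in E k)) => [|_]; last by rewrite mulr0.
  by rewrite mulr1 inE => -[].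
apply: (@le_trans _ _ (((Num.sqrt (4 * pi * t))^-1 ^+ n) `^ ((q - 2) / q) *
    lpow leb (q / (q - 1)) (cut (E k) f) `^ ((q - 1) / q) *
    lpow leb (q / (q - 1)) g `^ ((q - 1) / q))).
  (* One set of finite measure has to carry both [g] and the truncated [f]. *)
  apply: (@hop_interp_bounded _ _ _ _ (D `|` B k)) => //.
  - exact: measurableU.
  - apply: le_lt_trans (measureU2 _ mD (mB k)) _.
    by apply: lte_add_pinfty => //; exact: lebesgue_sqn_ball.
  - move=> x h; rewrite /cut indicE memNset ?mulr0//; move=> [Bx _].
    by apply: h; right.
  - by move=> x h; apply: g0 => Dx; apply: h; left.
rewrite ler_wpM2r ?powR_ge0// ler_wpM2l ?powR_ge0//.
apply: ge0_ler_powR; rewrite ?nnegrE ?lpow_ge0//; last exact: lpow_cut_le.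
by rewrite divr_ge0// ltW.
Qed.

End heat_estimates.

(** * Test functions *)

Section flat_functions.
Context {R : realType}.
Implicit Types (t s : R) (k : nat).

(* Derivatives of the flat function [exp (- 1 / t)] are combinations of the [rho k]. *)
Definition rho k t : R := if 0 < t then t^-1 ^+ k * expR (- t^-1) else 0.

(** The constant k^k comes from exp(s) = exp(s/k)^k >= (s/k)^k; for k = 0 it is 1. *)
Lemma exp_power_bound k : exists2 C : R, 0 <= C & forall s, 0 <= s -> s ^+ k * expR (- s) <= C.
Proof.
exists (k%:R ^+ k) => [|s s0]; first by rewrite exprn_ge0.
rewrite expRN ler_pdivrMr ?expR_gt0//; case: k => [|k].
  by rewrite !expr0 mul1r -[leLHS]expR0 ler_expR.
have k0 : 0 < k.+1%:R :> R by rewrite ltr0n.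
have -> : expR s = expR (s / k.+1%:R) ^+ k.+1.
  by rewrite -expRM_natl mulrC divfK// gt_eqF.
rewrite -exprMn ler_pXn2r ?nnegrE ?mulr_ge0 ?expR_ge0 ?(ltW k0)//.
rewrite -[leLHS](@divfK _ k.+1%:R) ?gt_eqF// mulrC ler_wpM2l ?(ltW k0)//.
by apply: le_trans (expR_ge1Dx _); rewrite lerDr.
Qed.

Lemma rho_ge0 k t : 0 <= rho k t.
Proof.
by rewrite /rho; case: ifP => // t0; rewrite mulr_ge0 ?expR_ge0 ?exprn_ge0// invr_ge0 ltW.
Qed.

Lemma rho_bound k : exists2 C : R, 0 <= C & forall t, `|rho k t| <= C.
Proof.
have [C C0 h] := exp_power_bound k; exists C => // t; rewrite ger0_norm ?rho_ge0//.
by rewrite /rho; case: ifP => // t0; apply: h; rewrite invr_ge0 ltW.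
Qed.

(** Two spare powers of 1/t are absorbed by the exponential; the quadratic bound forces derivative 0
    at the origin. *)
Lemma rho_flat k : exists2 C : R, 0 <= C & forall t, `|rho k t| <= C * t ^+ 2.
Proof.
have [C C0 h] := exp_power_bound k.+2; exists C => // t; rewrite ger0_norm ?rho_ge0//.
rewrite /rho; case: ifP => [t0|_]; last by rewrite mulr_ge0 ?sqr_ge0.
have ti : 0 <= t^-1 by rewrite invr_ge0 ltW.
rewrite -ler_pdivrMr ?exprn_gt0//; apply: le_trans (h _ ti).
by apply: eq_ler; rewrite -[t ^- 2]exprVn -[k.+2]addn2 exprD; ring.
Qed.

Lemma is_derive_flat (f : R -> R) (C : R) : 0 <= C -> (forall t, `|f t| <= C * t ^+ 2) ->
  is_derive (0 : R) 1 f 0.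
Proof.
move=> C0 fC.
have f0 : f 0 = 0 by have := fC 0; rewrite expr0n mulr0 normr_le0 => /eqP.
have cv : (fun h => h^-1 *: ((f \o shift 0) (h *: (1 : R)) - f 0)) @ (0 : R)^' --> (0 : R).
  apply/cvgr0Pnorm_le => e e0; near=> h; rewrite f0 subr0 /= addr0 /GRing.scale /= mulr1.
  have h0 : h != 0 by near: h; exact: nbhs_dnbhs_neq.
  rewrite normrM normfV ler_pdivrMl ?normr_gt0//; apply: (le_trans (fC h)).
  rewrite -[h ^+ 2]real_normK ?num_real// expr2 mulrCA ler_wpM2l//.
  have : `|h| <= e / (C + 1).
    near: h; apply: nbhs_dnbhs; apply: (@nbhs0_le R R^o).
    by rewrite divr_gt0// ltr_wpDl.
  rewrite ler_pdivlMr ?ltr_wpDl//; apply: le_trans.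
  by rewrite mulrDr mulr1 mulrC lerDl.
split; last exact: cvg_lim cv.
by apply/cvg_ex; exists 0.
Unshelve. all: by end_near. Qed.

Lemma is_derive_expn k t : is_derive t 1 (fun s : R => s ^+ k) (k%:R * t ^+ k.-1).
Proof.
elim: k => [|k IH]; first by rewrite mul0r; exact: is_derive_cst.
have := is_derive_mulf (is_derive_id t 1) IH.
under eq_fun do rewrite -exprS; move=> /is_derive_eq; apply.
by case: k {IH} => [|k]; rewrite /= ?expr0 ?exprS -?[k.+2%:R]natr1; ring.
Qed.

(** The derivative of [rho k] involves only [rho k.+1] and [rho k.+2], so the family is stable and
    higher derivatives need no further argument at the origin, where both sides vanish. *)
Lemma is_derive_rho k t : is_derive t 1 (rho k) (- k%:R * rho k.+1 t + rho k.+2 t).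
Proof.
have [t0|t0|->] := ltgtP t 0.
- have -> : - k%:R * rho k.+1 t + rho k.+2 t = 0.
    by rewrite /rho ltNge (ltW t0) mulr0 addr0.
  apply: (near_eq_is_derive _ (is_derive_cst (0 : R) t (1 : R))).
  near=> s; rewrite /rho ltNge ifF//; apply/negbTE; rewrite negbK ltW//.
  by near: s; exact: lt_nbhsl.
- have dV : is_derive t 1 (fun s : R => s^-1) (- t ^- 2).
    have := @is_deriveV R id t 1 1 (lt0r_neq0 t0) (is_derive_id t 1).
    by rewrite /GRing.scale /= mulr1.
  have dG : is_derive t 1 (fun s : R => s^-1 ^+ k * expR (- s^-1))
      (- k%:R * rho k.+1 t + rho k.+2 t).
    have d1 : is_derive t^-1 1 (fun s : R => s ^+ k) (k%:R * t^-1 ^+ k.-1).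
      exact: is_derive_expn.
    have d2 : is_derive t^-1 1 (fun s : R => expR (- s)) (- expR (- t^-1)).
      have := is_derive_compf (is_derive_expR (-1 * t^-1)) (is_derive_linear (-1) t^-1).
      by under eq_fun do rewrite mulN1r; rewrite mulrN1 mulN1r.
    have := is_derive_compf (is_derive_mulf d1 d2) dV.
    move=> /is_derive_eq; apply; rewrite /rho t0.
    have A : k%:R * t^-1 ^+ k.-1 * t ^- 2 = k%:R * t^-1 ^+ k.+1.
      case: k {d1} => [|k]; first by rewrite !mul0r.
      by rewrite /= -[t ^- 2]exprVn -mulrA -exprD addn2.
    have B : t^-1 ^+ k * t ^- 2 = t^-1 ^+ k.+2 by rewrite -[t ^- 2]exprVn -exprD addn2.
    set e := expR _; transitivity (- (k%:R * t^-1 ^+ k.-1 * t ^- 2) * e + t^-1 ^+ k * t ^- 2 * e).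
      by ring.
    by rewrite A B; ring.
  apply: (near_eq_is_derive _ dG); near=> s; rewrite /rho ifT//.
  by near: s; exact: lt_nbhsr.
- have -> : - k%:R * rho k.+1 0 + rho k.+2 0 = 0 by rewrite /rho ltxx mulr0 addr0.
  by have [C C0 h] := rho_flat k; exact: is_derive_flat C0 h.
Unshelve. all: by end_near. Qed.

End flat_functions.

Section line_derivative.
Context {R : realType} {n : nat}.
Implicit Types (f : 'rV[R]_n -> R) (x v : 'rV[R]_n).

Lemma is_derive_line f x v (d : R) :
  is_derive x v f d <-> is_derive (0 : R) 1 (fun h => f (h *: v + x)) d.
Proof.
have E : 'D_v f x = 'D_1 (fun h : R => f (h *: v + x)) 0.
  rewrite /derive; suff -> : (fun h : R => h^-1 *: ((f \o shift x) (h *: v) - f x)) =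
    (fun h : R => h^-1 *: (((fun h => f (h *: v + x)) \o shift 0) (h *: (1 : R)) -
      (fun h => f (h *: v + x)) 0)) by [].
  by apply/funext => h /=; rewrite addr0 scale0r add0r [_%:A]mulr1.
split => -[d1 d2].
  by split; [move/derivable1P : d1|rewrite -E].
by split; [apply/derivable1P|rewrite E].
Qed.

Lemma is_derive_line_comp (F : R -> R) f x v (a b : R) :
  is_derive (f x) 1 F a -> is_derive x v f b -> is_derive x v (fun y => F (f y)) (a * b).
Proof.
move=> dF /is_derive_line df; apply/is_derive_line.
have dF' : is_derive ((fun h : R => f (h *: v + x)) 0) 1 F a by rewrite scale0r add0r.
exact: (is_derive_compf dF' df).
Qed.

Lemma is_derive_lineM f g x v (a b : R) : is_derive x v f a -> is_derive x v g b ->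
  is_derive x v (fun y => f y * g y) (a * g x + f x * b).
Proof.
move=> df dg; have := is_deriveM df dg => /is_derive_eq; apply.
by rewrite /GRing.scale /= addrC [g x * _]mulrC.
Qed.

Lemma is_derive_lineD f g x v (a b : R) : is_derive x v f a -> is_derive x v g b ->
  is_derive x v (fun y => f y + g y) (a + b).
Proof. by move=> df dg; have := is_deriveD df dg. Qed.

Lemma is_derive_coord x v j : is_derive x v (fun y : 'rV[R]_n => y ord0 j) (v ord0 j).
Proof.
apply/is_derive_line.
have := is_derive_phase (v ord0 j) (x ord0 j) 0; congr is_derive.
by apply/funext => h; rewrite !mxE mulrC.
Qed.

Lemma is_derive_sqn_sub x y i :
  is_derive y (delta_mx ord0 i) (fun y : 'rV[R]_n => sqn (y - x))
    (2 * (y ord0 i - x ord0 i)).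
Proof.
apply/is_derive_line.
have E (h : R) : sqn (h *: delta_mx ord0 i + y - x) =
    h ^+ 2 + (2 * (y ord0 i - x ord0 i) * h + sqn (y - x)).
  rewrite /sqn (bigD1 i)//= [X in _ = _ + (_ + X)](bigD1 i)//= !mxE !eqxx mulr1.
  rewrite (eq_bigr (fun j => (y - x) ord0 j ^+ 2)) => [|j /negbTE ji].
    by rewrite !addrA; congr (_ + _); ring.
  by rewrite !mxE ji andbF mulr0 add0r.
under eq_fun do rewrite E.
have := is_derive_addf (is_derive_sqrf 0)
  (is_derive_phase (2 * (y ord0 i - x ord0 i)) (sqn (y - x)) 0).
by rewrite mulr0 add0r.
Qed.

End line_derivative.

Section smooth_functions.
Context {R : realType} {n : nat}.
Implicit Types (f g : 'rV[R]_n -> R) (x y : 'rV[R]_n).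

(* A class of smooth functions stable under partial derivatives, large enough
   to contain Gaussian wave packets and a bump function. *)
Inductive elementary : ('rV[R]_n -> R) -> Prop :=
| elementary_cst (a : R) : elementary (fun=> a)
| elementary_coord j : elementary (fun x => x ord0 j)
| elementaryD f g : elementary f -> elementary g -> elementary (fun x => f x + g x)
| elementaryM f g : elementary f -> elementary g -> elementary (fun x => f x * g x)
| elementary_exp f : elementary f -> elementary (fun x => expR (f x))
| elementary_cos f : elementary f -> elementary (fun x => cos (f x))
| elementary_sin f : elementary f -> elementary (fun x => sin (f x))
| elementary_rho k f : elementary f -> elementary (fun x => rho k (f x)).

Lemma elementary_derive f i : elementary f -> exists2 g, elementary g &
  forall x, is_derive x (delta_mx ord0 i) f (g x).
Proof.
elim=> {f} [a|j|f g ef [f' ef' df] eg [g' eg' dg]|f g ef [f' ef' df] eg [g' eg' dg]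
    |f ef [f' ef' df]|f ef [f' ef' df]|f ef [f' ef' df]|k f ef [f' ef' df]].
- by exists (fun=> 0) => [|x]; [exact: elementary_cst|exact: is_derive_cst].
- exists (fun=> (delta_mx ord0 i : 'rV[R]_n) ord0 j); first exact: elementary_cst.
  by move=> x; exact: is_derive_coord.
- exists (fun x => f' x + g' x); first exact: elementaryD.
  by move=> x; exact: is_derive_lineD.
- exists (fun x => f' x * g x + f x * g' x).
    by apply: elementaryD; exact: elementaryM.
  by move=> x; exact: is_derive_lineM.
- exists (fun x => expR (f x) * f' x).
    by apply: elementaryM => //; exact: elementary_exp.
  by move=> x; apply: is_derive_line_comp => //; exact: is_derive_expR.
- exists (fun x => -1 * sin (f x) * f' x).
    apply: elementaryM => //; apply: elementaryM; first exact: elementary_cst.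
    exact: elementary_sin.
  move=> x; apply: is_derive_line_comp => //; rewrite mulN1r; exact: is_derive_cos.
- exists (fun x => cos (f x) * f' x).
    by apply: elementaryM => //; exact: elementary_cos.
  by move=> x; apply: is_derive_line_comp => //; exact: is_derive_sin.
- exists (fun x => (- k%:R * rho k.+1 (f x) + rho k.+2 (f x)) * f' x).
    apply: elementaryM => //; apply: elementaryD; last exact: elementary_rho.
    apply: elementaryM; first exact: elementary_cst.
    exact: elementary_rho.
  by move=> x; apply: is_derive_line_comp => //; exact: is_derive_rho.
Qed.

Lemma elementary_continuous f : elementary f -> continuous f.
Proof.
elim=> {f} [a|j|f g ef cf eg cg|f g ef cf eg cg|f ef cf|f ef cf|f ef cf|k f ef cf] x.
- exact: cst_continuous.
- exact: coord_continuous.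
- exact: cvgD (cf x) (cg x).
- exact: cvgM (cf x) (cg x).
- exact: (cvg_comp _ _ (cf x) (@continuous_expR R (f x))).
- exact: (cvg_comp _ _ (cf x) (@continuous_cos R (f x))).
- exact: (cvg_comp _ _ (cf x) (@continuous_sin R (f x))).
- have cr := is_derive_continuous (is_derive_rho k).
  by apply: (@continuous_comp _ _ _ f (rho k)); [exact: cf|exact: cr].
Qed.

Lemma elementary_partial f i : elementary f -> elementary (partial i f).
Proof.
move=> /(elementary_derive i)[g eg dg]; congr elementary: eg.
by apply/funext => x; case: (dg x) => _ <-.
Qed.

Lemma elementary_partials f s : elementary f -> elementary (partials s f).
Proof. by move=> ef; elim: s => //= i s IH; exact: elementary_partial. Qed.

Lemma elementary_test_function f r : elementary f ->
  (forall x, r < enorm x -> f x = 0) -> test_function f.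
Proof.
move=> ef fr; split; last by exists r.
- by move=> s; exact: elementary_continuous (elementary_partials s ef).
- move=> s i x; have [g _ dg] := elementary_derive i (elementary_partials s ef).
  by case: (dg x).
Qed.

Lemma elementary_sqn_sub x : elementary (fun y => sqn (y - x)).
Proof.
rewrite /sqn; elim: (index_enum _) => [|i s IH].
  by under eq_fun do rewrite big_nil; exact: elementary_cst.
under eq_fun do rewrite big_cons; apply: elementaryD => //.
under eq_fun do rewrite !mxE expr2.
by apply: elementaryM; (apply: elementaryD; [exact: elementary_coord|exact: elementary_cst]).
Qed.

End smooth_functions.

Section weak_laplacian.
Context {R : realType} {n : nat}.
Local Notation leb := (lebesgue_rV R n).
Local Notation normc := Normc.normc.
Implicit Types (u h : 'rV[R]_n -> R[i]) (x y : 'rV[R]_n) (t a e : R).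

(** The cutoff exp(1 - 1/(1 - t)), extended by 0 for t >= 1. It is normalized to 1 at 0 but not
    constant near 0: it will be dilated, so that only its value there survives. *)
Definition bumpf t : R := expR 1 * rho 0 (1 - t).
Definition bump1 t : R := - expR 1 * rho 2 (1 - t).
Definition bump2 t : R := expR 1 * (- 2 * rho 3 (1 - t) + rho 4 (1 - t)).

Lemma is_derive_1sub t : is_derive t 1 (fun t : R => 1 - t) (-1).
Proof.
have := is_derive_phase (-1) 1 t; congr is_derive.
by apply/funext => s; rewrite mulN1r addrC.
Qed.

Lemma is_derive_rho_1sub k t : is_derive t 1 (fun t : R => rho k (1 - t))
  (k%:R * rho k.+1 (1 - t) - rho k.+2 (1 - t)).
Proof.
have := @is_derive_compf _ (rho k) (fun t : R => 1 - t) t _ _ (is_derive_rho k (1 - t))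
  (is_derive_1sub t).
by move=> /is_derive_eq; apply; ring.
Qed.

Lemma is_derive_bump t : is_derive t 1 bumpf (bump1 t).
Proof.
have := is_derive_scalef (expR 1) (is_derive_rho_1sub 0 t).
by move=> /is_derive_eq; apply; rewrite /bump1; ring.
Qed.

Lemma is_derive_bump1 t : is_derive t 1 bump1 (bump2 t).
Proof.
have := is_derive_scalef (- expR 1) (is_derive_rho_1sub 2 t).
by move=> /is_derive_eq; apply; rewrite /bump2; ring.
Qed.

Lemma is_derive_bump2 t : is_derive t 1 bump2
  (expR 1 * (- 2 * (3%:R * rho 4 (1 - t) - rho 5 (1 - t)) +
    (4%:R * rho 5 (1 - t) - rho 6 (1 - t)))).
Proof.
apply: is_derive_scalef; apply: is_derive_addf; last exact: is_derive_rho_1sub.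
by apply: is_derive_scalef; exact: is_derive_rho_1sub.
Qed.

Lemma bump0 : bumpf 0 = 1.
Proof. by rewrite /bumpf /rho subr0 ltr01 expr0 mul1r invr1 -expRD addrN expR0. Qed.

Lemma bump_eq0 t : 1 <= t -> bumpf t = 0.
Proof. by move=> t1; rewrite /bumpf /rho ltNge subr_le0 t1 mulr0. Qed.

Lemma bump_bound : exists2 C : R, 0 <= C &
  forall t, [/\ `|bumpf t| <= C, `|bump1 t| <= C & `|bump2 t| <= C].
Proof.
have [C0 C00 h0] := @rho_bound R 0; have [C2 C20 h2] := @rho_bound R 2.
have [C3 C30 h3] := @rho_bound R 3; have [C4 C40 h4] := @rho_bound R 4.
exists (expR 1 * (C0 + C2 + 2 * C3 + C4)); first by rewrite mulr_ge0 ?expR_ge0//; lra.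
move=> t; have e0 := expR_ge0 (1 : R).
split; rewrite normrM ?normrN (ger0_norm e0) ler_wpM2l//.
- by apply: le_trans (h0 _) _; lra.
- by apply: le_trans (h2 _) _; lra.
- apply: (le_trans (ler_normD _ _)); rewrite normrM normrN (ger0_norm (ler0n _ 2)).
  by have := h3 (1 - t); have := h4 (1 - t); lra.
Qed.

Lemma is_derive_cutoff (f f' : R -> R) e t : is_derive t 1 f (f' t) ->
  forall g g' : R -> R, (forall t, is_derive t 1 g (g' t)) ->
  is_derive t 1 (fun t => f t * g (e * t)) (f' t * g (e * t) + f t * (e * g' (e * t))).
Proof.
move=> df g g' dg.
have := is_derive_mulf df (is_derive_compf (dg (e * t)) (is_derive_linear e t)).
by move=> /is_derive_eq; apply; ring.
Qed.

Lemma is_derive_radial (F F' : R -> R) x i y : (forall t, is_derive t 1 F (F' t)) ->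
  is_derive y (delta_mx ord0 i) (fun y => F (sqn (y - x)))
    (F' (sqn (y - x)) * (2 * (y ord0 i - x ord0 i))).
Proof. by move=> dF; apply: is_derive_line_comp => //; exact: is_derive_sqn_sub. Qed.

Lemma partial2_radial (F F' F'' : R -> R) x i : (forall t, is_derive t 1 F (F' t)) ->
  (forall t, is_derive t 1 F' (F'' t)) ->
  partials [:: i; i] (fun y => F (sqn (y - x))) = fun y =>
    2 * F' (sqn (y - x)) + 4 * (y ord0 i - x ord0 i) ^+ 2 * F'' (sqn (y - x)).
Proof.
move=> dF dF'; rewrite /partials /=.
have -> : partial i (fun y => F (sqn (y - x))) =
    fun y => F' (sqn (y - x)) * (2 * (y ord0 i - x ord0 i)).
  by apply/funext => y; rewrite /partial; case: (is_derive_radial x i y dF).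
apply/funext => y; rewrite /partial.
have dc : is_derive y (delta_mx ord0 i) (fun y : 'rV[R]_n => 2 * (y ord0 i - x ord0 i)) 2.
  have := is_derive_lineM (is_derive_cst (2 : R) y (delta_mx ord0 i))
    (is_derive_lineD (is_derive_coord y (delta_mx ord0 i) i)
      (is_derive_cst (- x ord0 i) y (delta_mx ord0 i))).
  by move=> /is_derive_eq; apply; rewrite mxE !eqxx mul0r add0r addr0 mulr1.
have [_ ->] := is_derive_lineM (is_derive_radial x i y dF') dc.
ring.
Qed.

Lemma test_function_radial (F : R -> R) x (r : R) :
  elementary (fun y : 'rV[R]_n => F (sqn (y - x))) ->
  (forall t, r <= t -> F t = 0) -> test_function (fun y => F (sqn (y - x))).
Proof.
move=> eF Fr; have x0 := sqn_ge0 x; have r0 := normr_ge0 r.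
(* The radius comes from |y|^2 <= 2 |y - x|^2 + 2 |x|^2: outside it |y - x|^2 exceeds r. *)
apply: (@elementary_test_function _ _ _ (Num.sqrt (2 * (`|r| + 1) + 2 * sqn x))) => // y.
have p0 : 0 < 2 * (`|r| + 1) + 2 * sqn x by lra.
rewrite /enorm -/(sqn y) => h.
have {}h : 2 * (`|r| + 1) + 2 * sqn x < sqn y.
  by rewrite ltNge; apply/negP => le_; move: h; rewrite ltNge ler_wsqrtr.
apply: Fr; apply: (le_trans (ler_norm _)).
have : sqn y <= 2 * sqn (y - x) + 2 * sqn x.
  rewrite /sqn !mulr_sumr -big_split/=; apply: ler_sum => i _; rewrite !mxE.
  have := sqr_ge0 (y ord0 i - 2 * x ord0 i); nra.
lra.
Qed.

End weak_laplacian.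

Section Lp_conversion.
Context {R : realType} {n : nat}.
Local Notation leb := (lebesgue_rV R n).

Let power_norm (p : R) (f : 'rV[R]_n -> R[i]) : 0 < p ->
  (Lnorm leb p%:E (EFin \o cabs f) `^ p = \int[leb]_x `|Normc.normc (f x) `^ p|%:E)%E.
Proof.
move=> p0; rewrite poweR_Lnorm ?gt_eqF//; apply: eq_integral => x _.
by rewrite /= ger0_norm ?normc_ge0// ger0_norm ?powR_ge0.
Qed.

Lemma inLp_Lp (p : R) (f : 'rV[R]_n -> R[i]) : 0 < p -> inLp p f -> Lp leb p f.
Proof.
move=> p0 [mf ff]; split => //; apply/LoneP; split.
  exact: measurable_funpowR (measurable_normc mf).
by rewrite -power_norm// poweR_lty.
Qed.

Lemma Lp_inLp (p : R) (f : 'rV[R]_n -> R[i]) : 0 < p -> Lp leb p f -> inLp p f.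
Proof.
move=> p0 [mf /LoneP[_ ff]]; split => //; rewrite /finite_norm.
by apply: (@lty_poweRy _ _ p); rewrite ?gt_eqF// power_norm.
Qed.

Lemma inL2P (f : 'rV[R]_n -> R[i]) : inL2 f <-> Lp leb 2 f.
Proof. by split; [exact: inLp_Lp|exact: Lp_inLp]. Qed.

Lemma L2norm_lpow (f : 'rV[R]_n -> R[i]) : Lp leb 2 f -> L2norm f = lpow leb 2 f `^ 2^-1.
Proof.
move=> [mf ff]; rewrite /L2norm (Lnorm_rint _ ff) ?lpowE// => x; exact: normc_ge0.
Qed.

End Lp_conversion.

Section cint_sum.
Context {R : realType} d (T : measurableType d) (mu : {measure set T -> \bar R}).

Lemma cintegrable_cst0 : cintegrable mu (fun=> 0).
Proof.
split; first exact: cmeas_cst.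
under eq_fun do rewrite Normc.normc0; exact: integrable0.
Qed.

Lemma cint_sum I (s : seq I) (F : I -> T -> R[i]) : (forall i, cintegrable mu (F i)) ->
  cintegrable mu (fun x => \sum_(i <- s) F i x) /\
  cint mu (fun x => \sum_(i <- s) F i x) = \sum_(i <- s) cint mu (F i).
Proof.
move=> iF; elim: s => [|i s [IH1 IH2]].
  under eq_fun do rewrite big_nil; split; first exact: cintegrable_cst0.
  rewrite big_nil; have := cint_real mu (fun=> 0 : R).
  by rewrite /Rintegral integral0.
under eq_fun do rewrite big_cons; split; first exact: cintegrableD.
by rewrite cintD// IH2 big_cons.
Qed.

End cint_sum.

(** * The heat kernel as a generalized test function *)

Section weak_heat_equation.
Context {R : realType} {n : nat}.
Local Notation leb := (lebesgue_rV R n).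
Local Notation normc := Normc.normc.
Implicit Types (u h : 'rV[R]_n -> R[i]) (x y v : 'rV[R]_n) (t a e : R).

Lemma Lp2_gauss_at a x : 0 < a -> Lp leb 2 (fun y => (expR (- a * sqn (y - x)))%:C).
Proof.
move=> a0; have a20 : 0 < 2 * a by rewrite mulr_gt0.
have i2 := Lone_translate x (Lone_gauss n a20).
have i1 := Lone_translate x (Lone_gauss n a0).
apply: Lone_sqr_Lp2; first exact: cmeas_real (Lone_meas i1).
move: i2; congr Lone; apply/funext => y.
by rewrite normc_real ger0_norm ?expR_ge0// expr2 -expRD; congr expR; ring.
Qed.

Lemma gauss_moment a t : 0 < a -> 0 <= t ->
  (1 + t) * expR (- a * t) <= (1 + 2 / a) * expR (- (a / 2) * t).
Proof.
move=> a0 t0; have -> : expR (- a * t) = expR (- (a / 2) * t) * expR (- (a / 2) * t).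
  by rewrite -expRD; congr expR; field.
rewrite mulrA ler_wpM2r ?expR_ge0// mulNr expRN ler_pdivrMr ?expR_gt0//.
have h := expR_ge1Dx (a / 2 * t); have at0 : 0 <= a / 2 * t.
  by rewrite mulr_ge0// divr_ge0// ltW.
rewrite mulrDl mul1r lerD//; first by apply: le_trans h; rewrite lerDl.
rewrite -[leLHS](_ : 2 / a * (a / 2 * t) = _); last by field; rewrite gt_eqF.
rewrite ler_wpM2l//; first by rewrite divr_ge0// ltW.
by apply: le_trans h; rewrite lerDr.
Qed.

Lemma coord_sqr_le_sqn x i : x ord0 i ^+ 2 <= sqn x.
Proof. by rewrite /sqn (bigD1 i)//= lerDl sumr_ge0// => j _; exact: sqr_ge0. Qed.

(** The Laplacian of y -> F(|y|^2), as a function of t = |y|^2. *)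
Definition radial_laplacian (F' F'' : R -> R) t : R := 2 * n%:R * F' t + 4 * t * F'' t.

Section cutoff_case.
Variables (F F' F'' : R -> R) (x : 'rV[R]_n) (K a : R).
Hypotheses (a0 : 0 < a) (K0 : 0 <= K).
Hypothesis dF : forall t, is_derive t 1 F (F' t).
Hypothesis dF' : forall t, is_derive t 1 F' (F'' t).
Hypothesis mF'' : measurable_fun setT F''.
Hypothesis bF : forall t, 0 <= t -> [/\ `|F t| <= K * expR (- a * t),
  `|F' t| <= K * expR (- a * t) & `|F'' t| <= K * expR (- a * t)].

Let mcomp (G : R -> R) : measurable_fun setT G ->
  measurable_fun setT (fun y : 'rV[R]_n => G (sqn (y - x))).
Proof.
move=> mG; apply: (measurableT_comp mG).
apply: (measurableT_comp (@measurable_sqn R n)).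
by apply: measurable_fun_sub => //; exact: measurable_cst.
Qed.

Definition radial_dom (C : R) y : R := C * expR (- (a / 2) * sqn (y - x)).

Lemma radial_mul_cintegrable u (G : 'rV[R]_n -> R) (C : R) : Lp leb 2 u ->
  measurable_fun setT G -> (forall y, `|G y| <= radial_dom C y) ->
  cintegrable leb (fun y => u y * (G y)%:C).
Proof.
move=> u2 mG GC; have a2 : 0 < a / 2 by rewrite divr_gt0.
have [_ i1] := Lp2_mul u2 (Lp2_gauss_at x a2).
apply: (le_cintegrable _ _ (LoneZ C i1)); first exact: cmeasM u2.1 (cmeas_real mG).
move=> y; rewrite 2!Normc.normcM !normc_real (ger0_norm (expR_ge0 _)) mulrCA.
by rewrite ler_wpM2l ?normc_ge0// GC.
Qed.

(** The coefficient of the second derivative grows like 1 + t; [gauss_moment] pays for it with half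
    of the rate [a]. *)
Lemma radial_bound (N b c : R) t : 0 <= t -> `|c| <= 4 * (1 + t) -> `|b| <= N ->
  `|b * F' t + c * F'' t| <= (N + 4) * K * (1 + 2 / a) * expR (- (a / 2) * t).
Proof.
move=> t0 c1 b1; have [_ h1 h2] := bF t0; have N0 : 0 <= N := le_trans (normr_ge0 _) b1.
have e0 := expR_ge0 (- a * t).
have : `|b * F' t + c * F'' t| <= (N + 4) * K * ((1 + t) * expR (- a * t)).
  apply: (le_trans (ler_normD _ _)); rewrite !normrM.
  have H1 : `|b| * `|F' t| <= N * (K * expR (- a * t)) by apply: ler_pM.
  have H2 : `|c| * `|F'' t| <= 4 * (1 + t) * (K * expR (- a * t)) by apply: ler_pM.
  have H3 : 0 <= K * expR (- a * t) by rewrite mulr_ge0.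
  have H4 : 0 <= N * (K * expR (- a * t)) * t by rewrite !mulr_ge0.
  apply: (le_trans (lerD H1 H2)); rewrite -subr_ge0.
  by rewrite (_ : _ - _ = N * (K * expR (- a * t)) * t)//; ring.
move=> /le_trans; apply; rewrite -[leRHS]mulrA ler_wpM2l//.
  by rewrite mulr_ge0// addr_ge0.
exact: gauss_moment.
Qed.

Lemma weak_laplacian_cutoff u h0 (r : R) :
  elementary (fun y : 'rV[R]_n => F (sqn (y - x))) -> (forall t, r <= t -> F t = 0) ->
  oper_H0 u h0 ->
  cint leb (fun y => u y * (radial_laplacian F' F'' (sqn (y - x)))%:C) =
  - cint leb (fun y => h0 y * (F (sqn (y - x)))%:C).
Proof.
move=> eF Fr [[/inL2P u2 _] /inL2P h2 [v vP hv]].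
have tF := test_function_radial eF Fr.
have v2 i : Lp leb 2 (v i) by apply/inL2P; case: (vP i).
have mF : measurable_fun setT (fun y : 'rV[R]_n => F (sqn (y - x))).
  by apply: mcomp; exact: is_derive_measurable dF.
have FC y : `|F (sqn (y - x))| <= radial_dom K y.
  have [h _ _] := bF (sqn_ge0 (y - x)); apply: (le_trans h).
  rewrite /radial_dom ler_wpM2l// ler_expR !mulNr lerN2 ler_wpM2r ?sqn_ge0//.
  by rewrite ler_pdivrMr// ler_peMr ?(ltW a0)// ler1n.
have E i : cint leb (fun y => u y * (2 * F' (sqn (y - x)) +
    4 * (y ord0 i - x ord0 i) ^+ 2 * F'' (sqn (y - x)))%:C) =
    cint leb (fun y => v i y * (F (sqn (y - x)))%:C).
  have [_ /(_ _ tF)] := vP i; rewrite (partial2_radial x i dF dF').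
  by rewrite (_ : (-1) ^+ size [:: i; i] = 1) ?mul1r// /= sqrrN expr1n.
have iu i : cintegrable leb (fun y => u y * (2 * F' (sqn (y - x)) +
    4 * (y ord0 i - x ord0 i) ^+ 2 * F'' (sqn (y - x)))%:C).
  apply: (@radial_mul_cintegrable _ _ ((2 + 4) * K * (1 + 2 / a)) u2) => [|y].
    have mF' := is_derive_measurable dF'.
    apply: measurable_funD; apply: measurable_funM => //; [exact: mcomp|..|exact: mcomp].
    apply: measurable_funM => //; apply: measurable_funX; apply: measurable_funB => //.
    exact: measurable_coord.
  apply: (radial_bound (sqn_ge0 (y - x))); last by rewrite ger0_norm.
  have c0 : 0 <= 4 * (y ord0 i - x ord0 i) ^+ 2 by rewrite mulr_ge0// sqr_ge0.
  rewrite (ger0_norm c0) ler_wpM2l//.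
  have := coord_sqr_le_sqn (y - x) i; rewrite !mxE => /le_trans; apply.
  by rewrite lerDr.
have iv i : cintegrable leb (fun y => v i y * (F (sqn (y - x)))%:C).
  exact: (radial_mul_cintegrable (v2 i) mF FC).
transitivity (\sum_i cint leb (fun y => u y * (2 * F' (sqn (y - x)) +
    4 * (y ord0 i - x ord0 i) ^+ 2 * F'' (sqn (y - x)))%:C)).
  have [_ <-] := cint_sum (index_enum 'I_n) iu; congr cint; apply/funext => y.
  rewrite -mulr_sumr -rmorph_sum/=; congr (_ * _%:C).
  rewrite /radial_laplacian big_split/= sumr_const card_ord -mulr_suml -mulr_sumr.
  rewrite (_ : \sum_(i < n) _ = sqn (y - x)); last first.
    by apply: eq_bigr => i _; rewrite !mxE.
  by rewrite -[_ *+ n]mulr_natl; ring.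
under eq_bigr do rewrite E.
have [iS <-] := cint_sum (index_enum 'I_n) iv.
rewrite -cintN; last exact: (radial_mul_cintegrable h2 mF FC).
apply: cint_ae; [exact: iS.1| |].
  exact: cmeasN (cmeasM h2.1 (cmeas_real mF)).
apply: filterS hv => y hy _; rewrite hy// mulNr opprK.
by rewrite mulr_suml.
Qed.

End cutoff_case.

(** The function [f] is multiplied by the dilated cutoff of argument t/(k + 1). Derivatives falling
    on the cutoff carry factors 1/(k + 1) and vanish in the limit, and a common Gaussian bound
    allows dominated convergence. *)
Lemma weak_laplacian_radial u h0 (f f1 f2 : R -> R) x (a C : R) : 0 < a -> 0 <= C ->
  (forall t, is_derive t 1 f (f1 t)) -> (forall t, is_derive t 1 f1 (f2 t)) ->
  continuous f2 -> elementary (fun y : 'rV[R]_n => f (sqn (y - x))) ->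
  (forall t, 0 <= t -> [/\ `|f t| <= C * expR (- a * t),
    `|f1 t| <= C * expR (- a * t) & `|f2 t| <= C * expR (- a * t)]) ->
  oper_H0 u h0 ->
  cint leb (fun y => u y * (radial_laplacian f1 f2 (sqn (y - x)))%:C) =
  - cint leb (fun y => h0 y * (f (sqn (y - x)))%:C).
Proof.
move=> a0 C0 df df1 cf2 ef bf Huh; have [[/inL2P u2 _] /inL2P h2 _] := Huh.
have [B B0 bB] := @bump_bound R.
pose e k : R := k.+1%:R^-1.
have e0 k : 0 < e k by rewrite invr_gt0.
have e1 k : e k <= 1 by rewrite invf_le1// ler1n.
pose F k t := f t * bumpf (e k * t).
pose F1 k t := f1 t * bumpf (e k * t) + f t * (e k * bump1 (e k * t)).
pose F2 k t := (f2 t * bumpf (e k * t) + f1 t * (e k * bump1 (e k * t))) +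
  (e k * (f1 t * bump1 (e k * t) + f t * (e k * bump2 (e k * t)))).
have dF k t : is_derive t 1 (F k) (F1 k t).
  exact: is_derive_cutoff (df t) _ _ is_derive_bump.
have dF1 k t : is_derive t 1 (F1 k) (F2 k t).
  apply: is_derive_addf; first exact: is_derive_cutoff (df1 t) _ _ is_derive_bump.
  have := is_derive_scalef (e k) (is_derive_cutoff (e k) (df t) is_derive_bump1).
  by congr is_derive; apply/funext => s; rewrite mulrCA.
have cb : continuous (@bumpf R) := is_derive_continuous is_derive_bump.
have cb1 : continuous (@bump1 R) := is_derive_continuous is_derive_bump1.
have cb2 : continuous (@bump2 R) := is_derive_continuous is_derive_bump2.
(* The second derivative [F2] is a sum of four products, each at most C B exp(-a t). *)
pose K := 4 * (C * B).
have bF k t : 0 <= t -> [/\ `|F k t| <= K * expR (- a * t),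
    `|F1 k t| <= K * expR (- a * t) & `|F2 k t| <= K * expR (- a * t)].
  move=> t0; have [h0' h1 h2'] := bf t t0; have [g0 g1 g2] := bB (e k * t).
  have ek (z : R) : `|e k * z| <= `|z|.
    by rewrite normrM (ger0_norm (ltW (e0 k))) ler_piMl.
  have M (p z : R) : `|p| <= C * expR (- a * t) -> `|z| <= B ->
      `|p * z| <= C * B * expR (- a * t).
    by move=> hp hz; rewrite normrM mulrAC; exact: ler_pM.
  have A1 := M _ _ h0' g0; have A2 := M _ _ h1 g0; have A3 := M _ _ h2' g0.
  have A4 := M _ _ h0' (le_trans (ek _) g1); have A5 := M _ _ h1 (le_trans (ek _) g1).
  have A6 := M _ _ h1 g1; have A7 := M _ _ h0' (le_trans (ek _) g2).
  have P : 0 <= C * B * expR (- a * t) by rewrite !mulr_ge0 ?expR_ge0.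
  have -> : K * expR (- a * t) = 4 * (C * B * expR (- a * t)) by rewrite /K; ring.
  split.
  - by apply: (le_trans A1); lra.
  - by apply: (le_trans (ler_normD _ _)); lra.
  - apply: (le_trans (ler_normD _ _)).
    have B1 := ler_normD (f2 t * bumpf (e k * t)) (f1 t * (e k * bump1 (e k * t))).
    have B2 := le_trans (ek (f1 t * bump1 (e k * t) + f t * (e k * bump2 (e k * t))))
      (ler_normD _ _).
    lra.
have mF2 k : measurable_fun setT (F2 k).
  have me : measurable_fun setT (fun t : R => e k * t).
    exact: is_derive_measurable (is_derive_linear (e k)).
  have mb (G : R -> R) : continuous G -> measurable_fun setT (fun t => G (e k * t)).
    by move=> cG; exact: (measurableT_comp (continuous_measurable_fun cG) me).
  have mf := is_derive_measurable df; have mf1 := is_derive_measurable df1.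
  have mf2 := continuous_measurable_fun cf2.
  have := mb _ cb; have := mb _ cb1; have := mb _ cb2 => m2 m1 m0.
  apply: measurable_funD; first apply: measurable_funD.
  - exact: measurable_funM.
  - by apply: measurable_funM => //; exact: measurable_funM.
  - apply: measurable_funM => //; apply: measurable_funD; first exact: measurable_funM.
    by apply: measurable_funM => //; exact: measurable_funM.
have eF k : elementary (fun y : 'rV[R]_n => F k (sqn (y - x))).
  apply: elementaryM => //; apply: elementaryM; first exact: elementary_cst.
  apply: elementary_rho; under eq_fun do rewrite -mulNr.
  apply: elementaryD; first exact: elementary_cst.
  by apply: elementaryM; [exact: elementary_cst|exact: elementary_sqn_sub].
have F0 k t : k.+1%:R <= t -> F k t = 0.
  by move=> kt; rewrite /F bump_eq0 ?mulr0// mulrC ler_pdivlMr// mul1r.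
have K0 : 0 <= K by rewrite !mulr_ge0.
have W k := weak_laplacian_cutoff a0 K0 (dF k) (dF1 k) (mF2 k) (bF k) (eF k) (F0 k) Huh.
have e_cvg : e k @[k --> \oo] --> (0 : R) by exact: cvg_harmonic.
have cG (G : R -> R) t : continuous G -> G (e k * t) @[k --> \oo] --> G 0.
  move=> cG; have cv : e k * t @[k --> \oo] --> (0 : R).
    by rewrite -[X in _ --> X](mul0r t); apply: cvgMl.
  exact: (cvg_comp _ _ cv (cG 0)).
have cb_mul (z : R) t : z * bumpf (e k * t) @[k --> \oo] --> z.
  have h : z * bumpf (e k * t) @[k --> \oo] --> z * 1.
    by apply: cvgMr; rewrite -bump0; exact: cG.
  by rewrite mulr1 in h.
have cF t : F k t @[k --> \oo] --> f t.
  exact: cb_mul.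
have cF1 t : F1 k t @[k --> \oo] --> f1 t.
  rewrite -[X in _ --> X]addr0; apply: cvgD.
    exact: cb_mul.
  rewrite -[X in _ --> X](mulr0 (f t)); apply: cvgMr.
  by rewrite -[X in _ --> X](mul0r (bump1 0)); apply: cvgM => //; exact: cG.
have cF2 t : F2 k t @[k --> \oo] --> f2 t.
  rewrite -[X in _ --> X]addr0; apply: cvgD.
    rewrite -[X in _ --> X]addr0; apply: cvgD.
      exact: cb_mul.
    rewrite -[X in _ --> X](mulr0 (f1 t)); apply: cvgMr.
    by rewrite -[X in _ --> X](mul0r (bump1 0)); apply: cvgM => //; exact: cG.
  rewrite -[X in _ --> X](mul0r (f1 t * bump1 0 + f t * (0 * bump2 0))); apply: cvgM => //.
  apply: cvgD; apply: cvgMr; first exact: cG.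
  by apply: cvgM => //; exact: cG.
pose S y : R := sqn (y - x).
have a2 : 0 < a / 2 by rewrite divr_gt0.
have mS : measurable_fun setT S.
  apply: (measurableT_comp (@measurable_sqn R n)).
  by apply: measurable_fun_sub => //; exact: measurable_cst.
have mc (G : R -> R) : measurable_fun setT G -> cmeas (fun y => (G (S y))%:C).
  by move=> mG; apply: cmeas_real; exact: (measurableT_comp mG mS).
have mlap (G G' : R -> R) : measurable_fun setT G -> measurable_fun setT G' ->
    measurable_fun setT (radial_laplacian G G').
  move=> mG mG'.
  have m4 : measurable_fun setT (fun t : R => 4 * t).
    exact: is_derive_measurable (is_derive_linear 4).
  apply: measurable_funD; last exact: (measurable_funM m4 mG').
  exact: measurable_funM.
pose N : R := 2 * n%:R; have N0 : 0 <= N by rewrite mulr_ge0.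
pose P := (N + 4) * K * (1 + 2 / a).
have P1 : K <= P.
  rewrite /P mulrAC ler_peMl// mulr_ege1//; first by lra.
  by rewrite lerDl divr_ge0// ltW.
have [_ iu] := Lp2_mul u2 (Lp2_gauss_at x a2).
have [_ ih] := Lp2_mul h2 (Lp2_gauss_at x a2).
have cvu : normc (cint leb (fun y => u y * (radial_laplacian (F1 k) (F2 k) (S y))%:C) -
    cint leb (fun y => u y * (radial_laplacian f1 f2 (S y))%:C)) @[k --> \oo] --> 0.
  apply: (cint_dominated _ _ _ (LoneZ P iu)).
  - move=> k; apply: (cmeasM u2.1); apply: mc; apply: mlap => //.
    exact: is_derive_measurable (dF1 k).
  - apply: (cmeasM u2.1); apply: mc; apply: mlap; first exact: is_derive_measurable df1.
    exact: continuous_measurable_fun.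
  - apply/aeW => y; under eq_fun do rewrite -mulrBr -rmorphB Normc.normcM normc_real.
    have h : normc (u y) * `|radial_laplacian (F1 k) (F2 k) (S y) -
        radial_laplacian f1 f2 (S y)| @[k --> \oo] --> normc (u y) * 0.
      apply: cvgMr; apply/norm_cvg0P; apply/subr_cvg0.
      by apply: cvgD; apply: cvgMr; [exact: cF1|exact: cF2].
    by rewrite mulr0 in h.
  - move=> k y; rewrite 2!Normc.normcM !normc_real (ger0_norm (expR_ge0 _)) mulrCA.
    rewrite ler_wpM2l ?normc_ge0//; apply: (radial_bound a0 K0 (bF k) (sqn_ge0 _)).
      by rewrite ger0_norm ?mulr_ge0 ?sqn_ge0// ler_wpM2l// lerDr.
    by rewrite ger0_norm.
have cvh : normc (cint leb (fun y => h0 y * (F k (S y))%:C) -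
    cint leb (fun y => h0 y * (f (S y))%:C)) @[k --> \oo] --> 0.
  apply: (cint_dominated _ _ _ (LoneZ P ih)).
  - move=> k; apply: (cmeasM h2.1); apply: mc; exact: is_derive_measurable (dF k).
  - apply: (cmeasM h2.1); apply: mc; exact: is_derive_measurable df.
  - apply/aeW => y; under eq_fun do rewrite -mulrBr -rmorphB Normc.normcM normc_real.
    have h : normc (h0 y) * `|F k (S y) - f (S y)| @[k --> \oo] --> normc (h0 y) * 0.
      by apply: cvgMr; apply/norm_cvg0P; apply/subr_cvg0; exact: cF.
    by rewrite mulr0 in h.
  - move=> k y; rewrite 2!Normc.normcM !normc_real (ger0_norm (expR_ge0 _)) mulrCA.
    rewrite ler_wpM2l ?normc_ge0//; have [bk _ _] := bF k _ (sqn_ge0 (y - x)).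
    apply: (le_trans bk); apply: ler_pM; rewrite ?expR_ge0//.
    by rewrite ler_expR !mulNr lerN2 ler_wpM2r ?sqn_ge0// ler_pdivrMr// ler_peMr ?(ltW a0)// ler1n.
apply/eqP; rewrite -subr_eq0 opprK -normc_eq0 eq_le normc_ge0 andbT.
pose L k := cint leb (fun y => u y * (radial_laplacian (F1 k) (F2 k) (S y))%:C).
pose Q k := cint leb (fun y => h0 y * (F k (S y))%:C).
set L0 := cint leb (fun y => u y * _); set Q0 := cint leb (fun y => h0 y * _).
have cv : normc (L k - L0) + normc (Q k - Q0) @[k --> \oo] --> (0 : R) + 0 by exact: cvgD cvu cvh.
rewrite addr0 in cv; apply: (le_cvg0 _ cv) => k; rewrite add0r.
rewrite (_ : L0 + Q0 = (L0 - L k) + (Q0 - Q k)); last first.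
  have E : L k = - Q k := W k.
  by rewrite E opprK addrACA addrN addr0.
by apply: (le_trans (le_normcD _ _)); rewrite (normc_sub L0) (normc_sub Q0).
Qed.

Definition imag_unit : R[i] := 0 +i* 1.

(** Test functions are real. The imaginary part is written as the real part of -i G, so that a
    statement about real parts of w G, for any complex w, covers both components. *)
Lemma cint_split u (G : 'rV[R]_n -> R[i]) : cmeas u -> cmeas G ->
  cintegrable leb (fun y => u y * G y) ->
  cint leb (fun y => u y * G y) = cint leb (fun y => u y * (complex.Re (G y))%:C) +
    imag_unit * cint leb (fun y => u y * (complex.Re (- imag_unit * G y))%:C).
Proof.
move=> mu mG iuG.
have E y : G y = (complex.Re (G y))%:C + imag_unit * (complex.Re (- imag_unit * G y))%:C.
  by case: (G y) => a b; apply: complexP => /=; ring.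
have mIm : cmeas (fun y => (complex.Re (- imag_unit * G y))%:C).
  apply: cmeas_real; have [_] := mG; congr measurable_fun; apply/funext => y.
  by case: (G y) => a b /=; ring.
have i1 : cintegrable leb (fun y => u y * (complex.Re (G y))%:C).
  apply: (le_cintegrable _ _ iuG.2); first exact: cmeasM mu (cmeas_real mG.1).
  by move=> y; rewrite 2!Normc.normcM normc_real ler_wpM2l ?normc_ge0 ?normc_Re.
have i2 : cintegrable leb (fun y => u y * (complex.Re (- imag_unit * G y))%:C).
  apply: (le_cintegrable _ _ iuG.2); first exact: cmeasM mu mIm.
  move=> y; rewrite 2!Normc.normcM normc_real ler_wpM2l ?normc_ge0//.
  rewrite (_ : complex.Re _ = complex.Im (G y)) ?normc_Im//.
  by case: (G y) => a b /=; ring.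
rewrite -cintZ// -cintD//; last exact: cintegrableZ.
by congr cint; apply/funext => y; rewrite [in LHS]E; ring.
Qed.

Lemma is_derive_wave (w : R[i]) (a b t : R) :
  is_derive t 1 (fun t => complex.Re (w * cexp (- a * t) (b * t)))
    (complex.Re (w * ((- a) +i* b) * cexp (- a * t) (b * t))).
Proof.
have E (w' : R[i]) (t' : R) : complex.Re (w' * cexp (- a * t') (b * t')) =
    expR (- a * t') * (complex.Re w' * cos (b * t') + - complex.Im w' * sin (b * t')).
  by case: w' => p q /=; ring.
under eq_fun do rewrite E; rewrite E.
have de := is_derive_compf (is_derive_expR (- a * t)) (is_derive_linear (- a) t).
have dc := is_derive_scalef (complex.Re w) (is_derive_cosf (is_derive_linear b t)).
have ds := is_derive_scalef (- complex.Im w) (is_derive_sinf (is_derive_linear b t)).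
have := is_derive_mulf de (is_derive_addf dc ds).
by move=> /is_derive_eq; apply; case: w {E dc ds} => p q /=; ring.
Qed.

Lemma elementary_wave (w : R[i]) (a b : R) x :
  elementary (fun y : 'rV[R]_n => complex.Re (w * cexp (- a * sqn (y - x)) (b * sqn (y - x)))).
Proof.
have E y : complex.Re (w * cexp (- a * sqn (y - x)) (b * sqn (y - x))) =
    complex.Re w * (expR (- a * sqn (y - x)) * cos (b * sqn (y - x))) +
    (- complex.Im w) * (expR (- a * sqn (y - x)) * sin (b * sqn (y - x))).
  by case: w => p q /=; ring.
under eq_fun do rewrite E.
have es k : elementary (fun y : 'rV[R]_n => k * sqn (y - x)).
  by apply: elementaryM; [exact: elementary_cst|exact: elementary_sqn_sub].
apply: elementaryD; apply: elementaryM; try exact: elementary_cst.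
  by apply: elementaryM; [exact: elementary_exp|exact: elementary_cos].
by apply: elementaryM; [exact: elementary_exp|exact: elementary_sin].
Qed.

Lemma Re_combination (A B : R) (w z1 z2 z : R[i]) :
  complex.Re (w * ((A%:C * z1 + B%:C * z2) * z)) =
  A * complex.Re (w * z1 * z) + B * complex.Re (w * z2 * z).
Proof.
by case: w => p q; case: z1 => a b; case: z2 => c d; case: z => e f /=; ring.
Qed.

(** Differentiation multiplies the amplitude of the wave by z = -a + i b, so the derivatives needed
    are the waves [f k] with amplitude w z^k, all with the same Gaussian decay. *)
Lemma weak_laplacian_wave u h0 (w : R[i]) (a b : R) x : 0 < a -> oper_H0 u h0 ->
  cint leb (fun y => u y * (complex.Re (w * (((2 * n%:R)%:C * ((- a) +i* b) +
    (4 * sqn (y - x))%:C * ((- a) +i* b) ^+ 2) *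
    cexp (- a * sqn (y - x)) (b * sqn (y - x)))))%:C) =
  - cint leb (fun y => h0 y *
      (complex.Re (w * cexp (- a * sqn (y - x)) (b * sqn (y - x))))%:C).
Proof.
move=> a0 Huh; set z := (- a) +i* b.
pose f k t := complex.Re (w * z ^+ k * cexp (- a * t) (b * t)).
have df k t : is_derive t 1 (f k) (f k.+1 t).
  by have := is_derive_wave (w * z ^+ k) a b t; rewrite /f exprSr mulrA.
pose C := normc w * (1 + normc z + normc z ^+ 2).
have bf k t : normc w * normc z ^+ k <= C -> `|f k t| <= C * expR (- a * t).
  move=> h; apply: (le_trans (normc_Re _)); rewrite 2!Normc.normcM normcX normc_cexp.
  by rewrite ler_wpM2r ?expR_ge0.
have [w0 z0] := (normc_ge0 w, normc_ge0 z); have z20 : 0 <= normc z ^+ 2 by rewrite exprn_ge0.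
have ef : elementary (fun y : 'rV[R]_n => f 0%N (sqn (y - x))).
  by rewrite /f; under eq_fun do rewrite expr0 mulr1; exact: elementary_wave.
have C0 : 0 <= C by rewrite mulr_ge0// !addr_ge0.
have := weak_laplacian_radial a0 C0 (df 0%N) (df 1%N) (is_derive_continuous (df 2%N)) ef _ Huh.
have -> : (fun y => h0 y * (f 0%N (sqn (y - x)))%:C) = fun y => h0 y *
      (complex.Re (w * cexp (- a * sqn (y - x)) (b * sqn (y - x))))%:C.
  by apply/funext => y; rewrite /f expr0 mulr1.
move=> <-; last first.
  move=> t t0; split; apply: bf; rewrite ?expr0 ?expr1 ler_wpM2l//; lra.
congr cint; apply/funext => y; congr (_ * _%:C); rewrite /radial_laplacian /f.
by rewrite expr1 Re_combination.
Qed.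

(** The Laplacian of [hk]: for a wave exp(z |v|^2) it multiplies by 2 n z + 4 |v|^2 z^2, here with z
    = (-c + i s)/(4t). *)
Definition hk_laplacian c s t v : R[i] :=
  ((2 * n%:R)%:C * ((- (c / (4 * t))) +i* (s / (4 * t))) +
    (4 * sqn v)%:C * ((- (c / (4 * t))) +i* (s / (4 * t))) ^+ 2) * hk c s t v.

Lemma hk_laplacian_bound c s t v : 0 < c -> 0 < t ->
  normc (hk_laplacian c s t v) <= (Num.sqrt (4 * pi * t))^-1 ^+ n *
   ((2 * n%:R) * normc ((- (c / (4 * t))) +i* (s / (4 * t))) +
      4 * normc ((- (c / (4 * t))) +i* (s / (4 * t))) ^+ 2) *
   (1 + 2 / (c / (4 * t))) * expR (- (c / (4 * t) / 2) * sqn v).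
Proof.
move=> c0 t0; set z := (_ +i* _); set a := c / (4 * t); set M := _ ^+ n.
have a0 : 0 < a by rewrite divr_gt0// mulr_gt0.
have M0 : 0 <= M by rewrite exprn_ge0// invr_ge0 sqrtr_ge0.
have z0 := normc_ge0 z; have z20 : 0 <= normc z ^+ 2 by rewrite exprn_ge0.
have v0 := sqn_ge0 v; have e0 := expR_ge0 (- a * sqn v).
rewrite /hk_laplacian Normc.normcM normc_hk -/M -/a.
have h : normc ((2 * n%:R)%:C * z + (4 * sqn v)%:C * z ^+ 2) <=
    (2 * n%:R * normc z + 4 * normc z ^+ 2) * (1 + sqn v).
  apply: (le_trans (le_normcD _ _)); rewrite 2!Normc.normcM normcX !normc_real.
  rewrite !ger0_norm ?mulr_ge0// -subr_ge0.
  rewrite (_ : _ - _ = 2 * n%:R * normc z * sqn v + 4 * normc z ^+ 2); last by ring.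
  by rewrite addr_ge0 ?mulr_ge0.
apply: (@le_trans _ _ (M * (2 * n%:R * normc z + 4 * normc z ^+ 2) *
    ((1 + sqn v) * expR (- a * sqn v)))).
  rewrite (_ : M * _ * _ = (2 * n%:R * normc z + 4 * normc z ^+ 2) * (1 + sqn v) *
    (M * expR (- a * sqn v))); last by ring.
  by rewrite ler_wpM2r// mulr_ge0.
rewrite -[leRHS]mulrA ler_wpM2l//; last exact: gauss_moment.
by rewrite mulr_ge0// addr_ge0// mulr_ge0// mulr_ge0.
Qed.

Lemma cmeas_hk_laplacian c s t : cmeas (hk_laplacian c s t).
Proof.
apply: cmeasM; last exact: cmeas_hk.
apply: cmeasD; first exact: cmeas_cst.
apply: cmeasM; last exact: cmeas_cst.
by apply: cmeas_real; apply: measurable_funM => //; exact: measurable_sqn.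
Qed.

Lemma hk_laplacian_cintegrable u c s t x : 0 < c -> 0 < t -> Lp leb 2 u ->
  cintegrable leb (fun y => u y * hk_laplacian c s t (y - x)).
Proof.
move=> c0 t0 u2; have a2 : 0 < c / (4 * t) / 2 by rewrite !divr_gt0// mulr_gt0.
have [_ i1] := Lp2_mul u2 (Lp2_gauss_at x a2).
set a := c / (4 * t) in a2 i1.
pose C := (Num.sqrt (4 * pi * t))^-1 ^+ n *
   ((2 * n%:R) * normc ((- (c / (4 * t))) +i* (s / (4 * t))) +
      4 * normc ((- (c / (4 * t))) +i* (s / (4 * t))) ^+ 2) * (1 + 2 / (c / (4 * t))).
apply: (le_cintegrable _ _ (LoneZ C i1)).
  apply: cmeasM u2.1 _.
  apply: (@cmeas_comp _ _ _ _ _ (fun y : 'rV[R]_n => y - x)); last exact: cmeas_hk_laplacian.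
  by apply: measurable_fun_sub => //; exact: measurable_cst.
move=> y; rewrite Normc.normcM (Normc.normcM _ (expR _)%:C) normc_real (ger0_norm (expR_ge0 _)) mulrCA.
by rewrite ler_wpM2l ?normc_ge0//; exact: hk_laplacian_bound.
Qed.

(** Real and imaginary parts of the heat kernel are waves with amplitude its prefactor, times 1 and
    -i respectively. *)
Lemma weak_heat u h0 c s t x : 0 < c -> 0 < t -> oper_H0 u h0 ->
  cint leb (fun y => u y * hk_laplacian c s t (y - x)) =
  - cint leb (fun y => h0 y * hk c s t (y - x)).
Proof.
move=> c0 t0 Huh; have [[/inL2P u2 _] /inL2P h2 _] := Huh.
have a0 : 0 < c / (4 * t) by rewrite divr_gt0// mulr_gt0.
have ms : measurable_fun setT (fun y : 'rV[R]_n => y - x).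
  by apply: measurable_fun_sub => //; exact: measurable_cst.
rewrite cint_split; [|exact: u2.1|exact: (cmeas_comp ms (@cmeas_hk_laplacian c s t))|
  exact: hk_laplacian_cintegrable].
rewrite [in RHS]cint_split; [|exact: h2.1|exact: (cmeas_comp ms (@cmeas_hk R n c s t))|].
  set M := ((Num.sqrt (4 * pi * t))^-1 ^+ n)%:C.
  have W w : cint leb (fun y => u y * (complex.Re (w * hk_laplacian c s t (y - x)))%:C) =
      - cint leb (fun y => h0 y * (complex.Re (w * hk c s t (y - x)))%:C).
    have E y : w * hk c s t (y - x) = w * M *
        cexp (- (c / (4 * t)) * sqn (y - x)) (s / (4 * t) * sqn (y - x)).
      by rewrite hkE mulrA.
    have := weak_laplacian_wave (w * M) (s / (4 * t)) x a0 Huh.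
    under [X in _ = - cint _ X -> _]funext do rewrite -E.
    move=> <-; congr cint; apply/funext => y; congr (_ * (complex.Re _)%:C).
    by rewrite /hk_laplacian hkE -/M; ring.
  have W1 : cint leb (fun y => u y * (complex.Re (hk_laplacian c s t (y - x)))%:C) =
      - cint leb (fun y => h0 y * (complex.Re (hk c s t (y - x)))%:C).
    have := W 1; under [X in cint _ X = _ -> _]funext do rewrite mul1r.
    by under [X in _ = - cint _ X -> _]funext do rewrite mul1r.
  by rewrite W1 (W (- imag_unit)) opprD mulrN.
by apply: Lp2_mul => //; under eq_fun do rewrite hk_sym; exact: Lp2_hk_shift.
Qed.

End weak_heat_equation.

Lemma cvg0_approx {R : realType} (u : nat -> R) (a : nat -> nat -> R) (b : nat -> R) :
  (forall j k, `|u k| <= a j k + b j) ->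
  (forall j, a j k @[k --> \oo] --> 0) -> b j @[j --> \oo] --> 0 ->
  u k @[k --> \oo] --> 0.
Proof.
move=> uab a0 b0; apply/cvgr0Pnorm_le => e e0; have e2 : 0 < e / 2 by rewrite divr_gt0.
have /cvgr0Pnorm_le/(_ _ e2)[j _ bj] := b0.
have /cvgr0Pnorm_le/(_ _ e2)[m _ am] := a0 j.
exists m => // k /= mk; apply: (le_trans (uab j k)).
have := bj j (leqnn j); have := am k mk => /=.
by move=> /ler_normlW h1 /ler_normlW h2; rewrite [e]splitr lerD.
Qed.

Lemma cvg0_combination {R : realType} (p q : R) (a b : nat -> R) :
  a j @[j --> \oo] --> 0 -> b j @[j --> \oo] --> 0 ->
  2 * (p * a j) + 2 * (b j * q) @[j --> \oo] --> 0.
Proof.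
move=> a0 b0.
have cv : 2 * (p * a j) + 2 * (b j * q) @[j --> \oo] --> 2 * (p * 0) + 2 * (0 * q).
  by apply: cvgD; apply: cvgMr; [apply: cvgMr|apply: cvgMl].
by rewrite mulr0 mul0r mulr0 addr0 in cv.
Qed.

(** * Continuity at time zero *)

Section translation_continuity.
Context {R : realType} {n : nat}.
Local Notation leb := (lebesgue_rV R n).
Local Notation normc := Normc.normc.
Local Notation wt := (fun x : 'rV[R]_n => expR (- (1 : R) * sqn x)).
Implicit Types (F G : 'rV[R]_n -> R) (f g h u : 'rV[R]_n -> R[i]).
Variables (d : nat -> 'rV[R]_n) (D : R).
Hypothesis d_bound : forall k, sqn (d k) <= D.
Hypothesis d_cvg : forall i, d k ord0 i @[k --> \oo] --> 0.

Definition shift_error F k := \int[leb]_x (`|F (x + d k) - F x| * wt x).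

Definition shift_continuous F := bounded_meas F /\ shift_error F k @[k --> \oo] --> 0.

Let iwt : Lone leb wt := Lone_gauss n ltr01.

Lemma measurable_shift F k : measurable_fun setT F ->
  measurable_fun setT (fun x : 'rV[R]_n => F (x + d k)).
Proof.
move=> mF; apply: (measurableT_comp mF).
under eq_fun do rewrite -[d k]opprK; apply: measurable_fun_sub => //; exact: measurable_cst.
Qed.

Lemma Lone_bounded_gauss (a : R) F : 0 < a -> bounded_meas F ->
  Lone leb (fun x => F x * expR (- a * sqn x)).
Proof.
move=> a0 [mF [C FC]]; apply: (le_Lone _ _ (LoneZ C (Lone_gauss n a0))).
  by apply: measurable_funM => //; exact: measurable_gauss.
by move=> x; rewrite normrM (ger0_norm (expR_ge0 _)) ler_wpM2r ?expR_ge0.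
Qed.

Lemma Lone_bounded_wt F : bounded_meas F -> Lone leb (fun x => F x * wt x).
Proof. exact: Lone_bounded_gauss ltr01. Qed.

Lemma bounded_shift F k : bounded_meas F ->
  bounded_meas (fun x : 'rV[R]_n => `|F (x + d k) - F x|).
Proof.
move=> [mF [C FC]]; split.
  apply: measurableT_comp => //; apply: measurable_funB => //; exact: measurable_shift.
exists (C + C) => x; rewrite normr_id; apply: (le_trans (ler_normB _ _)).
by rewrite lerD.
Qed.

Lemma shift_error_ge0 F k : 0 <= shift_error F k.
Proof. by apply: rint_ge0 => x; rewrite mulr_ge0 ?expR_ge0. Qed.

Lemma le_shift_error F (e : nat -> R) : bounded_meas F ->
  (forall k, shift_error F k <= e k) -> e k @[k --> \oo] --> 0 -> shift_continuous F.
Proof.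
move=> bF Fe e0; split => //; apply: cvg0_squeeze e0; apply: nearW => k.
by rewrite ger0_norm ?shift_error_ge0.
Qed.

Lemma shift_continuous_cst (a : R) : shift_continuous (fun=> a).
Proof.
apply: (@le_shift_error _ (fun=> 0)); last exact: cvg_cst.
  by split => //; exists `|a|.
move=> k; rewrite /shift_error; under eq_Rintegral do rewrite subrr normr0 mul0r.
by rewrite /Rintegral integral0.
Qed.

Lemma shift_continuousD F G : shift_continuous F -> shift_continuous G ->
  shift_continuous (fun x => F x + G x).
Proof.
move=> [bF cF] [bG cG].
have bFG : bounded_meas (fun x => F x + G x).
  have [[mF [C FC]] [mG [C' GC]]] := (bF, bG).
  split; first exact: measurable_funD.
  by exists (C + C') => x; apply: (le_trans (ler_normD _ _)); exact: lerD.
have cv : shift_error F k + shift_error G k @[k --> \oo] --> (0 : R) + 0 by exact: cvgD.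
rewrite addr0 in cv; apply: le_shift_error cv => // k.
rewrite /shift_error -rintD; [|exact: Lone_bounded_wt (bounded_shift k bF)|
  exact: Lone_bounded_wt (bounded_shift k bG)].
apply: le_rint; first exact: Lone_bounded_wt (bounded_shift k bFG).
  by apply: LoneD; apply: Lone_bounded_wt; exact: bounded_shift.
move=> x; rewrite -mulrDl ler_wpM2r ?expR_ge0//.
by rewrite opprD addrACA ler_normD.
Qed.

Lemma shift_continuousM F G : shift_continuous F -> shift_continuous G ->
  shift_continuous (fun x => F x * G x).
Proof.
move=> [bF cF] [bG cG]; have bFG := bounded_measM bF bG.
have [[mF [C FC]] [mG [C' GC]]] := (bF, bG).
have cv : C' * shift_error F k + C * shift_error G k @[k --> \oo] --> C' * 0 + C * 0.
  by apply: cvgD; exact: cvgMr.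
rewrite !mulr0 addr0 in cv; apply: le_shift_error cv => // k.
have iF := Lone_bounded_wt (bounded_shift k bF).
have iG := Lone_bounded_wt (bounded_shift k bG).
rewrite /shift_error -!rintZ// -rintD; [|exact: LoneZ|exact: LoneZ].
apply: le_rint; first exact: Lone_bounded_wt (bounded_shift k bFG).
  by apply: LoneD; exact: LoneZ.
move=> x; rewrite !mulrA -mulrDl ler_wpM2r ?expR_ge0//.
rewrite (_ : _ - _ = (F (x + d k) - F x) * G (x + d k) + F x * (G (x + d k) - G x)); last by ring.
apply: (le_trans (ler_normD _ _)); rewrite !normrM [X in X + _]mulrC.
by rewrite lerD// ler_wpM2r.
Qed.

(** From |x - d|^2 + |d|^2 >= |x|^2 / 2: moving the weight costs a constant and half of the rate. *)
Lemma shift_wt x k : wt (x - d k) <= expR D * expR (- (2^-1 : R) * sqn x).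
Proof.
rewrite -expRD ler_expR; apply: (@le_trans _ _ (sqn (d k) - 2^-1 * sqn x)); last first.
  by rewrite mulNr lerD2r.
have E : sqn (x - d k) + sqn (d k) =
    2^-1 * sqn x + \sum_i 2^-1 * (x ord0 i - 2 * d k ord0 i) ^+ 2.
  rewrite /sqn mulr_sumr -!big_split/=; apply: eq_bigr => i _.
  by rewrite !mxE; field.
have : 0 <= \sum_i 2^-1 * (x ord0 i - 2 * d k ord0 i) ^+ 2.
  by apply: sumr_ge0 => i _; rewrite mulr_ge0// sqr_ge0.
by rewrite mulN1r lerNl opprB lerBlDr E lerDl.
Qed.

(** The distance of [F] and [G] enters at x + d k and at x; the first is translated back, which
    moves the weight and explains the weaker Gaussian on the right. *)
Lemma shift_error_approx F G k : bounded_meas F -> bounded_meas G ->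
  shift_error F k <= shift_error G k +
    (expR D + 1) * \int[leb]_x (`|F x - G x| * expR (- (2^-1 : R) * sqn x)).
Proof.
move=> bF bG; have h0 : 0 < (2^-1 : R) by [].
pose P x := `|F x - G x|; have P0 x : 0 <= P x by exact: normr_ge0.
have bP : bounded_meas P.
  have [[mF [C FC]] [mG [C' GC]]] := (bF, bG); split.
    by apply: measurableT_comp => //; exact: measurable_funB.
  exists (C + C') => x; rewrite normr_id; apply: (le_trans (ler_normB _ _)).
  by rewrite lerD.
have iP := Lone_bounded_gauss h0 bP.
have bPs : bounded_meas (fun x : 'rV[R]_n => P (x + d k)).
  by have [mP [C PC]] := bP; split; [exact: measurable_shift|exists C].
have iPs := Lone_bounded_wt bPs.
have E1 : \int[leb]_x (P (x + d k) * wt x) <=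
    expR D * \int[leb]_x (P x * expR (- (2^-1 : R) * sqn x)).
  rewrite -(rint_translate (d k) iPs) -rintZ//; apply: le_rint.
  - exact: (Lone_translate (d k) iPs).
  - exact: LoneZ.
  - move=> x; have -> : x - d k + d k = x by rewrite subrK.
    by apply: (le_trans (ler_wpM2l (P0 x) (shift_wt x k))); apply: eq_ler; ring.
have E2 : \int[leb]_x (P x * wt x) <= \int[leb]_x (P x * expR (- (2^-1 : R) * sqn x)).
  apply: le_rint => //; first exact: Lone_bounded_wt.
  move=> x; rewrite ler_wpM2l// ler_expR !mulNr lerN2 ler_wpM2r ?sqn_ge0//.
  by rewrite invf_le1// ler1n.
have iG := Lone_bounded_wt (bounded_shift k bG).
have iF := Lone_bounded_wt (bounded_shift k bF).
have iPw := Lone_bounded_wt bP.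
apply: (@le_trans _ _ (shift_error G k + (\int[leb]_x (P (x + d k) * wt x) +
    \int[leb]_x (P x * wt x)))).
  rewrite /shift_error -rintD// -rintD//; last exact: LoneD.
  apply: le_rint => //; first by apply: LoneD => //; exact: LoneD.
  move=> x; rewrite -!mulrDl ler_wpM2r ?expR_ge0//.
  rewrite (_ : _ - _ = (G (x + d k) - G x) + ((F (x + d k) - G (x + d k)) - (F x - G x))).
    by apply: (le_trans (ler_normD _ _)); rewrite lerD2l ler_normB.
  by ring.
by rewrite lerD2l mulrDl mul1r lerD.
Qed.

(** Closure under bounded pointwise limits: by dominated convergence such limits are approximated in
    the weighted L_1 norm, uniformly in the shift by [shift_error_approx]. *)
Lemma shift_continuous_lim (F_ : nat -> 'rV[R]_n -> R) F (C : R) :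
  (forall j, shift_continuous (F_ j)) -> (forall j x, `|F_ j x| <= C) ->
  (forall x, F_ j x @[j --> \oo] --> F x) -> shift_continuous F.
Proof.
move=> cF_ F_C cvF.
have FC x : `|F x| <= C.
  have cv : `|F_ j x| @[j --> \oo] --> `|F x| by apply: cvg_norm.
  rewrite -(cvg_lim _ cv)//.
  by apply: limr_le; [apply/cvg_ex; exists (Num.norm (F x))|apply: nearW].
have mF : measurable_fun setT F.
  by apply: (measurable_fun_cvg (fun j => (cF_ j).1.1)) => x _; exact: cvF.
have bF : bounded_meas F by split => //; exists C.
have h0 : 0 < (2^-1 : R) by [].
split => //; apply: (@cvg0_approx _ _ (fun j k => shift_error (F_ j) k)
  (fun j => (expR D + 1) * \int[leb]_x (`|F x - F_ j x| * expR (- (2^-1 : R) * sqn x)))).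
- move=> j k; rewrite ger0_norm ?shift_error_ge0//.
  by apply: shift_error_approx => //; case: (cF_ j).
- by move=> j; case: (cF_ j).
rewrite -[X in _ --> X](mulr0 (expR D + 1)); apply: cvgMr.
have m j : measurable_fun setT (fun x => `|F x - F_ j x| * expR (- (2^-1 : R) * sqn x)).
  apply: measurable_funM; last exact: measurable_gauss.
  by apply: measurableT_comp => //; apply: measurable_funB => //; case: (cF_ j) => -[].
have cv : {ae leb, forall x, `|F x - F_ j x| * expR (- (2^-1 : R) * sqn x) @[j --> \oo] --> (0 : R)}.
  apply/aeW => x; rewrite -[X in _ --> X](mul0r (expR (- (2^-1 : R) * sqn x))).
  apply: cvgMl; apply/norm_cvg0P; rewrite -[X in _ --> X](subrr (F x)).
  by apply: cvgB => //; exact: cvg_cst.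
have bd j x : `| `|F x - F_ j x| * expR (- (2^-1 : R) * sqn x)| <=
    (C + C) * expR (- (2^-1 : R) * sqn x).
  rewrite normrM normr_id (ger0_norm (expR_ge0 _)) ler_wpM2r ?expR_ge0//.
  by apply: (le_trans (ler_normB _ _)); rewrite lerD.
have [_] := @rint_dominated _ _ _ leb _ (fun=> 0) _ m (measurable_cst (0 : R)) cv
  (LoneZ (C + C) (Lone_gauss n h0)) bd.
by rewrite [X in _ --> X -> _](_ : _ = 0)// /Rintegral integral0.
Qed.

Lemma lebesgue_hyperplane (i : 'I_n) (a : R) : leb [set x : 'rV[R]_n | x ord0 i = a] = 0%E.
Proof.
have mA j : measurable (if j == i then [set a] else setT).
  by case: ifP => // _; exact: measurable_set1.
have := lebesgue_rV_box mA; rewrite (bigD1 i)//= eqxx lebesgue_measure_set1 mul0e => <-.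
congr (leb _); apply/seteqP; split => x /=.
  by move=> xi j; case: ifP => // /eqP ->.
by move=> /(_ i); rewrite eqxx.
Qed.

(** Off the bounding hyperplane, a null set, small shifts do not change membership; the weight
    itself dominates. *)
Lemma shift_continuous_halfspace (i : 'I_n) (a : R) :
  shift_continuous (\1_[set x : 'rV[R]_n | a < x ord0 i]).
Proof.
have mA : measurable [set x : 'rV[R]_n | a < x ord0 i].
  rewrite -[X in measurable X]setTI.
  have -> : [set x : 'rV[R]_n | a < x ord0 i] = (fun x => x ord0 i) @^-1` `]a, +oo[%classic.
    by apply/seteqP; split => x /=; rewrite in_itv/= andbT.
  exact: measurable_coord.
set A := [set x | _] in mA *.
have bA : bounded_meas (\1_A : 'rV[R]_n -> R).
  by split; [exact: measurable_indic|exists 1 => x; rewrite ger0_norm// indicE; case: (_ \in _)].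
split => //.
have mk k : measurable_fun setT (fun x : 'rV[R]_n => `|\1_A (x + d k) - \1_A x| * wt x).
  exact: Lone_meas (Lone_bounded_wt (bounded_shift k bA)).
have cv : {ae leb, forall x, `|\1_A (x + d k) - \1_A x| * wt x @[k --> \oo] --> (0 : R)}.
  exists [set x : 'rV[R]_n | x ord0 i = a]; split; [|exact: lebesgue_hyperplane|].
    rewrite -[X in measurable X]setTI.
    exact: (measurable_coord i measurableT (measurable_set1 a)).
  move=> x /= h; apply: contrapT => /eqP xa; apply: h.
  have cx : (x + d k) ord0 i @[k --> \oo] --> x ord0 i.
    rewrite -[X in _ --> X]addr0; under eq_fun do rewrite mxE.
    by apply: cvgD => //; exact: cvg_cst.
  apply: cvg_near_cst; have [xa'|xa'] := ltP a (x ord0 i).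
    near=> k; rewrite !indicE !mem_set// ?subrr ?normr0 ?mul0r// /A /=.
    near: k; exact: (cvgr_gt _ cx).
  have {}xa : x ord0 i < a by rewrite lt_neqAle xa.
  near=> k; rewrite !indicE !memNset// ?subrr ?normr0 ?mul0r// /A /=; apply/negP; rewrite -leNgt ?(ltW xa)//.
  by apply: ltW; near: k; exact: (cvgr_lt _ cx).
have bd k x : `| `|\1_A (x + d k) - \1_A x| * wt x| <= wt x.
  rewrite normrM normr_id (ger0_norm (expR_ge0 _)) ler_piMl ?expR_ge0// !indicE.
  by case: (_ \in _); case: (_ \in _); rewrite ?subrr ?subr0 ?sub0r ?normrN ?normr1 ?normr0.
have [_] := @rint_dominated _ _ _ leb _ (fun=> 0) _ mk (measurable_cst (0 : R)) cv iwt bd.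
by rewrite [X in _ --> X -> _](_ : _ = 0)// /Rintegral integral0.
Unshelve. all: by end_near. Qed.

Lemma bigprod_indicC (A : nat -> set 'rV[R]_n) m : (forall k, shift_continuous (\1_(A k))) ->
  shift_continuous (fun x => \prod_(k < m) (1 + -1 * \1_(A k) x)).
Proof.
move=> cA; elim: m => [|m IH].
  by under eq_fun do rewrite big_ord0; exact: shift_continuous_cst.
under eq_fun do rewrite big_ord_recr/=; apply: shift_continuousM => //.
apply: shift_continuousD; first exact: shift_continuous_cst.
by apply: shift_continuousM => //; exact: shift_continuous_cst.
Qed.

(* Continuity of translations without density of continuous functions: it holds
   for half-spaces, which generate the Borel sets. *)
Lemma shift_continuous_sigma_algebra :
  sigma_algebra setT [set A : set 'rV[R]_n | shift_continuous (\1_A)].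
Proof.
split => /=.
- by rewrite indic0; exact: shift_continuous_cst.
- move=> A cA.
  have -> : \1_(setT `\` A) = (fun x => 1 + -1 * \1_A x) :> ('rV[R]_n -> R).
    apply/funext => x; rewrite !indicE in_setD in_setT /=.
    by case: (x \in A); rewrite ?mulr1 ?mulr0 ?addr0 ?addrN.
  apply: shift_continuousD; first exact: shift_continuous_cst.
  by apply: shift_continuousM => //; exact: shift_continuous_cst.
(* The indicator of the union is the limit of 1 - P m, where P m is the product of the indicators of
   the first m complements and is eventually constant at every point. *)
- move=> A cA; pose P m x := \prod_(k < m) (1 + -1 * \1_(A k) x) : R.
  have P01 m x : 0 <= P m x <= 1.
    apply/andP; split.
      apply: prodr_ge0 => k _; rewrite indicE.
      by case: (_ \in _); rewrite ?mulr1 ?mulr0 ?addr0 ?addrN.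
    apply: prodr_ile1 => k _; rewrite indicE.
    by case: (_ \in _); rewrite ?mulr1 ?mulr0 ?addr0 ?addrN ?lexx ?ler01.
  apply: (@shift_continuous_lim (fun m x => 1 + -1 * P m x) _ 1).
  + move=> m; apply: shift_continuousD; first exact: shift_continuous_cst.
    apply: shift_continuousM; first exact: shift_continuous_cst.
    exact: bigprod_indicC.
  + move=> m x; have /andP[p0 p1] := P01 m x.
    by rewrite mulN1r ger0_norm ?subr_ge0// gerBl.
  + move=> x; apply: cvg_near_cst; rewrite indicE.
    have [|nx] := boolP (x \in \bigcup_k A k).
      rewrite inE => -[m _ Amx]; exists m.+1 => // k /= mk.
      rewrite /P (bigD1 (Ordinal mk))//= indicE mem_set//= mulr1 addrN mul0r mulr0 addr0//.
    apply: nearW => m; rewrite /P big1 ?mulr1 ?addrN// => k _.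
    rewrite indicE memNset ?mulr0 ?addr0// => Akx.
    by move: nx; rewrite notin_setE; apply; exists k.
Qed.

Lemma shift_continuous_indic (A : set 'rV[R]_n) : measurable A -> shift_continuous (\1_A).
Proof.
move: A; apply: smallest_sub; first exact: shift_continuous_sigma_algebra.
rewrite -bigcup_seq; apply: bigcup_sub => i _ B [C mC <-] /=; rewrite setTI.
have E : (measurable : set (set R)) = <<s @RGenOInfty.G R >> := RGenOInfty.measurableE R.
have {mC} : <<s @RGenOInfty.G R >> C by rewrite -E.
move: C; apply: smallest_sub => [|B' [a ->]]; last first.
  have -> : (fun x : 'rV[R]_n => x ord0 i) @^-1` `]a, +oo[%classic = [set x | a < x ord0 i].
    by apply/seteqP; split => x /=; rewrite in_itv/= andbT.
  exact: shift_continuous_halfspace.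
have [h0 hC hU] := shift_continuous_sigma_algebra; split => /=.
- by rewrite preimage_set0.
- by move=> A cA; rewrite setTD preimage_setC -setTD; exact: hC.
- by move=> A cA; rewrite preimage_bigcup; exact: hU.
Qed.

Lemma shift_continuous_sum I (s : seq I) (F_ : I -> 'rV[R]_n -> R) :
  (forall i, shift_continuous (F_ i)) -> shift_continuous (fun x => \sum_(i <- s) F_ i x).
Proof.
move=> cF_; elim: s => [|i s IH].
  by under eq_fun do rewrite big_nil; exact: shift_continuous_cst.
by under eq_fun do rewrite big_cons; exact: shift_continuousD.
Qed.

Import HBNNSimple.

Lemma shift_continuous_ge0 F (C : R) : measurable_fun setT F -> (forall x, 0 <= F x <= C) ->
  shift_continuous F.
Proof.
move=> mF FC.
have mE : measurable_fun setT (EFin \o F) by exact/measurable_EFinP.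
have [|g [ndg cvg_g]] := approximation measurableT mE.
  by move=> x _; rewrite lee_fin; case/andP: (FC x).
have cv x : (g j : _ -> R) x @[j --> \oo] --> F x.
  exact: fine_cvg (cvg_g x I).
have gF j x : (g j : _ -> R) x <= F x.
  rewrite -(cvg_lim _ (cv x))//; apply: nondecreasing_cvgn_le.
    by move=> a b ab; have /lefP := ndg a b ab; apply.
  by apply/cvg_ex; exists (F x).
apply: (@shift_continuous_lim (fun j x => (g j : _ -> R) x) _ C) => //.
- move=> j; rewrite (_ : (fun x => _) = fun x =>
      \sum_(y <- finmap.enum_fset (fset_set (range (g j)))) y * \1_(g j @^-1` [set y]) x).
    apply: shift_continuous_sum => y; apply: shift_continuousM; first exact: shift_continuous_cst.
    by apply: shift_continuous_indic.
  by apply/funext => x; rewrite fimfunE fsbig_finite.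
- move=> j x; rewrite ger0_norm//; apply: (le_trans (gF j x)).
  by case/andP: (FC x).
Qed.

Lemma shift_continuous_bounded F : bounded_meas F -> shift_continuous F.
Proof.
move=> [mF [C FC]].
rewrite (_ : F = fun x => (F x + C) + - C); last by apply/funext => x; rewrite addrK.
apply: shift_continuousD; last exact: shift_continuous_cst.
apply: (@shift_continuous_ge0 _ (C + C)).
  by apply: measurable_funD.
move=> x; have := FC x; rewrite ler_norml => /andP[h1 h2].
by rewrite -lerBlDr sub0r h1 lerD2r h2.
Qed.

Lemma Lp2_shift u k : Lp leb 2 u -> Lp leb 2 (fun x => u (x + d k)).
Proof.
move=> u2; apply: Lone_sqr_Lp2; last first.
  have := Lone_translate (- d k) (Lp2_Lone_sqr u2); congr Lone.
  by apply/funext => x; rewrite opprK.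
by have [m1 m2] := u2.1; split; [exact: (measurable_shift k m1)|exact: (measurable_shift k m2)].
Qed.

Lemma lpow2_shift u k : Lp leb 2 u -> lpow leb 2 (fun x => u (x + d k)) = lpow leb 2 u.
Proof.
move=> u2; rewrite !lpow2E -(rint_translate (- d k) (Lp2_Lone_sqr u2)).
by apply: eq_Rintegral => x _; rewrite opprK.
Qed.

Lemma form_bound h u : Lp leb 2 h -> Lp leb 2 u ->
  normc (cint leb (fun x => h x * u x)) <= lpow leb 2 h `^ 2^-1 * lpow leb 2 u `^ 2^-1.
Proof.
move=> h2 u2; apply: (le_trans (normc_cint (Lp2_mul h2 u2))).
under eq_Rintegral do rewrite Normc.normcM; exact: cauchy_schwarz.
Qed.

Lemma shift_form_bound h u k : Lp leb 2 h -> Lp leb 2 u ->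
  normc (cint leb (fun x => h x * (u (x + d k) - u x))) <=
    2 * (lpow leb 2 h `^ 2^-1 * lpow leb 2 u `^ 2^-1).
Proof.
move=> h2 u2; have us2 := Lp2_shift k u2.
under [X in cint _ X]funext do rewrite mulrBr.
rewrite cintB; [|exact: Lp2_mul|exact: Lp2_mul].
apply: (le_trans (le_normcD _ _)).
rewrite normcN (_ : 2 * _ = lpow leb 2 h `^ 2^-1 * lpow leb 2 u `^ 2^-1 +
  lpow leb 2 h `^ 2^-1 * lpow leb 2 u `^ 2^-1); last by rewrite mulr_natl mulr2n.
by apply: lerD; [rewrite -(lpow2_shift k u2)|]; exact: form_bound.
Qed.

Lemma shift_form_truncated h u (N : R) k : 0 <= N -> cmeas h -> cbounded_meas u ->
  (forall x, normc (h x) <= N * wt x) ->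
  normc (cint leb (fun x => h x * (u (x + d k) - u x))) <=
    N * (shift_error (fun x => complex.Re (u x)) k + shift_error (fun x => complex.Im (u x)) k).
Proof.
move=> N0 mh [[m1 m2] [C uC]] hN.
have b1 : bounded_meas (fun x => complex.Re (u x)).
  by split => //; exists C => x; exact: le_trans (normc_Re _) (uC x).
have b2 : bounded_meas (fun x => complex.Im (u x)).
  by split => //; exists C => x; exact: le_trans (normc_Im _) (uC x).
have i1 := Lone_bounded_wt (bounded_shift k b1).
have i2 := Lone_bounded_wt (bounded_shift k b2).
have iS := LoneZ N (LoneD i1 i2).
have bd x : normc (h x * (u (x + d k) - u x)) <=
    N * (`|complex.Re (u (x + d k)) - complex.Re (u x)| * wt x +
         `|complex.Im (u (x + d k)) - complex.Im (u x)| * wt x).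
  rewrite Normc.normcM -mulrDl [X in _ <= _ * X]mulrC mulrA.
  apply: ler_pM; rewrite ?normc_ge0//.
  by apply: (le_trans (normc_le_ReIm _)); case: (u (x + d k)) => a b; case: (u x).
have iL : cintegrable leb (fun x => h x * (u (x + d k) - u x)).
  apply: (le_cintegrable _ bd iS); apply: cmeasM mh _; apply: cmeasB; last by split.
  by split; [exact: (measurable_shift k m1)|exact: (measurable_shift k m2)].
apply: (le_trans (normc_cint iL)); rewrite /shift_error -rintD// -rintZ; last exact: LoneD.
by apply: le_rint; [exact: iL.2|exact: iS|exact: bd].
Qed.

(** Only pairings with a fixed [h] are shown to converge, which is all that the initial value needs.
    Both functions are truncated; the remainders are small in L_2 uniformly in the shift, by
    translation invariance of the norm. *)
Lemma shift_form_cvg h u : Lp leb 2 h -> Lp leb 2 u ->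
  normc (cint leb (fun x => h x * u (x + d k)) - cint leb (fun x => h x * u x)) @[k --> \oo] --> 0.
Proof.
move=> h2 u2.
have E k : cint leb (fun x => h x * u (x + d k)) - cint leb (fun x => h x * u x) =
    cint leb (fun x => h x * (u (x + d k) - u x)).
  rewrite -cintB; [|exact: Lp2_mul h2 (Lp2_shift k u2)|exact: Lp2_mul].
  by congr cint; apply/funext => x; rewrite mulrBr.
under eq_fun do rewrite E.
(* On this set [h] is at most j times the Gaussian weight, so the weighted L_1 error of the bounded
   part of [u] controls the pairing. *)
pose Eh (j : nat) := [set x | normc (h x) * expR (1 * sqn x) <= j%:R].
pose Eu (j : nat) := [set x | normc (u x) <= j%:R].
have mEh j : measurable (Eh j).
  rewrite -[X in measurable X]setTI; apply: (measurable_fun_le _ _ _) => //.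
  apply: measurable_funM; first exact: measurable_normc h2.1.
  by have := @measurable_gauss R n (-1); rewrite opprK.
have mEu j : measurable (Eu j).
  rewrite -[X in measurable X]setTI; apply: (measurable_fun_le _ _ _) => //.
  exact: measurable_normc u2.1.
have cEh x : \forall j \near \oo, Eh j x.
  exists (Num.truncn (normc (h x) * expR (1 * sqn x))).+1 => // j /= jx.
  by apply: (le_trans (ltW (truncnS_gt _))); rewrite ler_nat.
have cEu x : \forall j \near \oo, Eu j x.
  exists (Num.truncn (normc (u x))).+1 => // j /= jx.
  by apply: (le_trans (ltW (truncnS_gt _))); rewrite ler_nat.
pose nrm (f : 'rV[R]_n -> R[i]) := lpow leb 2 f `^ 2^-1.
apply: (@cvg0_approx _ _
  (fun j k => j%:R * (shift_error (fun x => complex.Re (cut (Eu j) u x)) k +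
                      shift_error (fun x => complex.Im (cut (Eu j) u x)) k))
  (fun j => 2 * (nrm h * nrm (cut (~` Eu j) u)) + 2 * (nrm (cut (~` Eh j) h) * nrm u))).
- move=> j k; rewrite ger0_norm ?normc_ge0//.
  have hj2 := Lp_cut (mEh j) (ltr0n R 2) h2.
  have gj2 := Lp_cut (measurableC (mEh j)) (ltr0n R 2) h2.
  have uj2 := Lp_cut (mEu j) (ltr0n R 2) u2.
  have vj2 := Lp_cut (measurableC (mEu j)) (ltr0n R 2) u2.
  have iform f g : Lp leb 2 f -> Lp leb 2 g ->
      cintegrable leb (fun x => f x * (g (x + d k) - g x)).
    move=> f2 g2; under eq_fun do rewrite mulrBr.
    apply: cintegrableB; apply: Lp2_mul => //; exact: Lp2_shift.
  have -> : cint leb (fun x => h x * (u (x + d k) - u x)) =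
    cint leb (fun x => cut (Eh j) h x * (cut (Eu j) u (x + d k) - cut (Eu j) u x)) +
    (cint leb (fun x => cut (Eh j) h x * (cut (~` Eu j) u (x + d k) - cut (~` Eu j) u x)) +
     cint leb (fun x => cut (~` Eh j) h x * (u (x + d k) - u x))).
    rewrite -cintD; [|exact: iform|exact: iform].
    rewrite -cintD; [|exact: iform|by apply: cintegrableD; exact: iform].
    congr cint; apply/funext => x.
    by rewrite -[in LHS](cutDC (Eh j) h x) -(cutDC (Eu j) u x) -(cutDC (Eu j) u (x + d k)); ring.
  apply: (le_trans (le_normcD _ _)); apply: lerD.
    apply: shift_form_truncated => //; first exact: hj2.1.
      split; first exact: uj2.1.
      exists j%:R => x; rewrite normc_cut indicE.
      by case: (boolP (x \in Eu j)) => [|_]; [rewrite inE mulr1|rewrite mulr0].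
    move=> x; rewrite normc_cut indicE.
    case: (boolP (x \in Eh j)) => [|_]; last by rewrite mulr0 mulr_ge0 ?expR_ge0.
    rewrite inE mulr1 /Eh /= => hx.
    by rewrite mulNr expRN ler_pdivlMr// expR_gt0.
  apply: (le_trans (le_normcD _ _)); apply: lerD.
    apply: (le_trans (shift_form_bound k hj2 vj2)); rewrite ler_wpM2l// ler_wpM2r ?powR_ge0//.
    apply: ge0_ler_powR; rewrite ?nnegrE ?lpow_ge0 ?invr_ge0//.
    exact: lpow_cut_le.
  exact: shift_form_bound.
- move=> j.
  have bu : cbounded_meas (cut (Eu j) u).
    split; first by apply: cmeas_cut u2.1; exact: mEu.
    exists j%:R => x; rewrite normc_cut indicE.
    by case: (boolP (x \in Eu j)) => [|_]; [rewrite inE mulr1|rewrite mulr0].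
  have [[m1 m2] [C uC]] := bu.
  have b1 : bounded_meas (fun x => complex.Re (cut (Eu j) u x)).
    by split => //; exists C => x; exact: le_trans (normc_Re _) (uC x).
  have b2 : bounded_meas (fun x => complex.Im (cut (Eu j) u x)).
    by split => //; exists C => x; exact: le_trans (normc_Im _) (uC x).
  have cv := cvgD (shift_continuous_bounded b1).2 (shift_continuous_bounded b2).2.
  rewrite -[X in _ --> X](mulr0 (j%:R : R)); apply: cvgMr.
  by rewrite -[X in _ --> X](addr0 (0 : R)); exact: cv.
have cu : nrm (cut (~` Eu j) u) @[j --> \oo] --> 0.
  by apply: cvg0_powR_half => [j|]; [exact: lpow_ge0|exact: lpow_cutC_cvg0].
have ch : nrm (cut (~` Eh j) h) @[j --> \oo] --> 0.
  by apply: cvg0_powR_half => [j|]; [exact: lpow_ge0|exact: lpow_cutC_cvg0].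
exact: (@cvg0_combination R (nrm h) (nrm u) (fun j => nrm (cut (~` Eu j) u))
  (fun j => nrm (cut (~` Eh j) h)) cu ch).
Qed.

End translation_continuity.

(** * The heat evolution at time zero *)

Section initial_value.
Context {R : realType} {n : nat}.
Local Notation leb := (lebesgue_rV R n).
Local Notation normc := Normc.normc.
Implicit Types (c s t : R) (x y v : 'rV[R]_n) (h u : 'rV[R]_n -> R[i]).

(** The substitution y = x + sqrt(t) v freezes the kernel at time 1 and moves the time dependence
    into a translation of [u]. *)
Lemma hop_rescale c s t u x : 0 < c -> 0 < t -> Lp leb 2 u ->
  hop c s t u x = cint leb (fun v => hk c s 1 v * u (x + Num.sqrt t *: v)).
Proof.
move=> c0 t0 u2; have st : 0 < Num.sqrt t by rewrite sqrtr_gt0.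
have iu := hop_cintegrable s x c0 t0 u2.
have stn : (Num.sqrt t ^+ n)%:C * ((Num.sqrt t)^-1 ^+ n)%:C = 1 :> R[i].
  by rewrite -rmorphM/= -exprMn mulfV ?expr1n// gt_eqF.
have := cint_affine x st iu => E.
have -> : (fun v => hk c s 1 v * u (x + Num.sqrt t *: v)) =
    fun v => (Num.sqrt t ^+ n)%:C * (hk c s t (x - (x + Num.sqrt t *: v)) *
      u (x + Num.sqrt t *: v)).
  apply/funext => v; rewrite opprD addrA addrN add0r hkN hk_scale// !mulrA stn mul1r//.
rewrite cintZ; last exact: (cintegrable_affine x st iu).
by rewrite E mulrA stn mul1r hopE.
Qed.

Lemma cmeas_translate_pair t u : cmeas u ->
  cmeas (fun z : 'rV[R]_n * 'rV[R]_n => u (z.1 + t *: z.2)).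
Proof.
move=> mu; apply: (@cmeas_comp _ _ _ _ _ (fun z : 'rV[R]_n * 'rV[R]_n => z.1 + t *: z.2)) => //.
apply: measurable_fun_coordP => i; under eq_fun do rewrite !mxE.
apply: measurable_funD.
  exact: (measurableT_comp (measurable_coord i) measurable_fst).
apply: measurable_funM => //.
exact: (measurableT_comp (measurable_coord i) measurable_snd).
Qed.

Lemma Lp2_affine t u x : 0 < t -> Lp leb 2 u -> Lp leb 2 (fun v => u (x + t *: v)).
Proof.
move=> t0 u2; apply: Lone_sqr_Lp2; first exact: (cmeas_comp (measurable_affine x t) u2.1).
exact: (Lone_affine x t0 (Lp2_Lone_sqr u2)).
Qed.

Lemma translate_pair_cintegrable c s t h u : 0 < c -> 0 < t -> Lp leb 2 h -> Lp leb 2 u ->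
  cintegrable (leb \x leb)%E (fun z : 'rV[R]_n * 'rV[R]_n =>
    hk c s 1 z.2 * (h z.1 * u (z.1 + t *: z.2))).
Proof.
move=> c0 t0 h2 u2; have ih := Lp2_Lone_sqr h2; have iu := Lp2_Lone_sqr u2.
have ik : Lone leb (fun v : 'rV[R]_n => normc (hk c s 1 v)) by exact: Lone_hk.
have i1 := Lone_tensor ih ik.
have ius v : Lone leb (fun x => normc (u (x + t *: v)) ^+ 2).
  have := Lone_translate (- (t *: v)) iu; congr Lone.
  by apply/funext => x; rewrite opprK.
have mu := cmeas_translate_pair t u2.1.
have mk : cmeas (fun z : 'rV[R]_n * 'rV[R]_n => hk c s 1 z.2).
  exact: (cmeas_comp measurable_snd (@cmeas_hk R n c s 1)).
have i2 : Lone (leb \x leb)%E (fun z : 'rV[R]_n * 'rV[R]_n =>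
    normc (u (z.1 + t *: z.2)) ^+ 2 * normc (hk c s 1 z.2)).
  apply: Lone_prod2.
  - apply: measurable_funM; last exact: measurable_normc mk.
    by apply: measurable_funX; exact: measurable_normc mu.
  - by move=> z; rewrite mulr_ge0 ?exprn_ge0 ?normc_ge0.
  - move=> v /=; have := LoneZ (normc (hk c s 1 v)) (ius v).
    by congr Lone; apply/funext => x; rewrite mulrC.
  - have := LoneZ (\int[leb]_x (normc (u x) ^+ 2)) ik; congr Lone; apply/funext => v /=.
    rewrite mulrC -(rint_translate (- (t *: v)) iu) -rintZ.
      by apply: eq_Rintegral => x _; rewrite opprK mulrC.
    by have := ius v; congr Lone; apply/funext => x; rewrite opprK.
apply: (le_cintegrable _ _ (LoneD i1 i2)).
  apply: cmeasM mk _; apply: cmeasM mu; exact: (cmeas_comp measurable_fst h2.1).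
move=> z; rewrite 2!Normc.normcM -mulrDl mulrC ler_wpM2r ?normc_ge0//.
have := sqr_ge0 (normc (h z.1) - normc (u (z.1 + t *: z.2))).
have := sqr_ge0 (normc (h z.1)); have := sqr_ge0 (normc (u (z.1 + t *: z.2))).
by rewrite sqrrB mulr2n; lra.
Qed.

Lemma hop_form_rescale c s t h u : 0 < c -> 0 < t -> Lp leb 2 h -> Lp leb 2 u ->
  cint leb (fun x => h x * hop c s t u x) =
  cint leb (fun v => hk c s 1 v * cint leb (fun x => h x * u (x + Num.sqrt t *: v))).
Proof.
move=> c0 t0 h2 u2; have st : 0 < Num.sqrt t by rewrite sqrtr_gt0.
have ihu v : cintegrable leb (fun x => h x * u (x + Num.sqrt t *: v)).
  exact: Lp2_mul h2 (Lp2_shift (fun=> Num.sqrt t *: v) 0 u2).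
transitivity (cint leb (fun x => cint leb (fun v => hk c s 1 v * (h x * u (x + Num.sqrt t *: v))))).
  congr cint; apply/funext => x; rewrite (hop_rescale s x c0 t0 u2) -cintZ.
    by congr cint; apply/funext => v; ring.
  apply: Lp2_mul; last exact: Lp2_affine.
  have := @Lp2_hk_shift R n c s 1 0 c0 ltr01; congr (Lp leb 2 _).
  by apply/funext => v; rewrite sub0r hkN.
rewrite (cint_Fubini (translate_pair_cintegrable s c0 st h2 u2)).
by congr cint; apply/funext => v /=; rewrite (cintZ (hk c s 1 v) (ihu v)).
Qed.

(** Along t = (k + 1)^(-2) the translations are by v/(k + 1). For fixed v the pairing converges by
    [shift_form_cvg], and dominated convergence against the kernel leaves its total mass [hmass] as
    a factor. *)
Lemma initial_value c s h u : 0 < c -> Lp leb 2 h -> Lp leb 2 u ->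
  normc (cint leb (fun x => h x * hop c s (k.+1%:R^-1 ^+ 2) u x) -
    hmass (n:=n) c s * cint leb (fun x => h x * u x)) @[k --> \oo] --> 0.
Proof.
move=> c0 h2 u2; pose e k : R := k.+1%:R^-1.
have e0 k : 0 < e k by rewrite invr_gt0.
have e20 k : 0 < e k ^+ 2 by rewrite exprn_gt0.
pose I := cint leb (fun x => h x * u x).
pose g k v := cint leb (fun x => h x * u (x + e k *: v)).
have us k v : Lp leb 2 (fun x => u (x + e k *: v)) := Lp2_shift (fun=> e k *: v) 0 u2.
have E k : cint leb (fun x => h x * hop c s (k.+1%:R^-1 ^+ 2) u x) =
    cint leb (fun v => hk c s 1 v * g k v).
  have sq : Num.sqrt (e k ^+ 2) = e k by rewrite sqrtr_sqr ger0_norm// ltW.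
  by rewrite (hop_form_rescale s c0 (e20 k) h2 u2) sq.
have ik : cintegrable leb (hk c s 1 : 'rV[R]_n -> R[i]) by exact: cintegrable_hk.
have EI : hmass (n:=n) c s * I = cint leb (fun v => hk c s 1 v * I).
  rewrite mulrC -cintZ//; congr cint; apply/funext => v; exact: mulrC.
rewrite EI; under eq_fun do rewrite E.
pose C := lpow leb 2 h `^ 2^-1 * lpow leb 2 u `^ 2^-1.
apply: (cint_dominated _ _ _ (LoneZ C ik.2)).
- move=> k; have := cmeas_cint2 (translate_pair_cintegrable s c0 (e0 k) h2 u2).
  congr cmeas; apply/funext => v /=; rewrite cintZ//.
  exact: Lp2_mul h2 (us k v).
- by apply: cmeasM ik.1 _; exact: cmeas_cst.
- apply/aeW => v; under eq_fun do rewrite -mulrBr Normc.normcM.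
  have h0 : normc (hk c s 1 v) * normc (g k v - I) @[k --> \oo] --> normc (hk c s 1 v) * 0.
    apply: cvgMr; apply: (@shift_form_cvg _ _ (fun k => e k *: v) (sqn v)) => //.
    + move=> k; rewrite sqnZ ler_piMl ?sqn_ge0// expr_le1//; last exact: ltW.
      by rewrite invf_le1// ler1n.
    + move=> i; under eq_fun do rewrite mxE.
      have cv : e k * v ord0 i @[k --> \oo] --> 0 * v ord0 i.
        by apply: cvgMl; exact: cvg_harmonic.
      by rewrite mul0r in cv.
  by rewrite mulr0 in h0.
- move=> k v; rewrite Normc.normcM mulrC ler_wpM2r ?normc_ge0//.
  rewrite /C -(lpow2_shift (fun=> e k *: v) 0 u2).
  exact: form_bound h2 (us k v).
Qed.

End initial_value.

(** * Bounds for the resolvent *)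

Section complex_derivative.
Context {R : realType}.
Implicit Types (f g : R -> R[i]) (t : R) (w : R[i]).

(** The derivative of a complex function of a real variable, taken componentwise. *)
Definition cis_derive t f (z : R[i]) :=
  is_derive t 1 (fun t => complex.Re (f t)) (complex.Re z) /\
  is_derive t 1 (fun t => complex.Im (f t)) (complex.Im z).

Lemma cis_deriveM t f g (z w : R[i]) : cis_derive t f z -> cis_derive t g w ->
  cis_derive t (fun t => f t * g t) (z * g t + f t * w).
Proof.
move=> [f1 f2] [g1 g2]; split.
  have -> : (fun t => complex.Re (f t * g t)) = fun t =>
      complex.Re (f t) * complex.Re (g t) + -1 * (complex.Im (f t) * complex.Im (g t)).
    by apply/funext => x; case: (f x) => ? ?; case: (g x) => ? ? /=; ring.
  have := is_derive_addf (is_derive_mulf f1 g1) (is_derive_scalef (-1) (is_derive_mulf f2 g2)).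
  move=> /is_derive_eq; apply.
  by case: z {f1 f2} => ? ?; case: w {g1 g2} => ? ?; case: (f t) => ? ?; case: (g t) => ? ? /=; ring.
have -> : (fun t => complex.Im (f t * g t)) = fun t =>
    complex.Re (f t) * complex.Im (g t) + complex.Im (f t) * complex.Re (g t).
  by apply/funext => x; case: (f x) => ? ?; case: (g x) => ? ? /=; ring.
have := is_derive_addf (is_derive_mulf f1 g2) (is_derive_mulf f2 g1).
move=> /is_derive_eq; apply.
by case: z {f1 f2} => ? ?; case: w {g1 g2} => ? ?; case: (f t) => ? ?; case: (g t) => ? ? /=; ring.
Qed.

Lemma cis_derive_cst t (z : R[i]) : cis_derive t (fun=> z) 0.
Proof. by split; exact: is_derive_cst. Qed.

Lemma cis_deriveZ t f (z w : R[i]) : cis_derive t f z -> cis_derive t (fun t => w * f t) (w * z).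
Proof.
by move=> df; have := cis_deriveM (cis_derive_cst t w) df; rewrite mul0r add0r.
Qed.

Lemma cis_derive_cexp (A B : R -> R) t (a b : R) : is_derive t 1 A a -> is_derive t 1 B b ->
  cis_derive t (fun t => cexp (A t) (B t)) ((a +i* b) * cexp (A t) (B t)).
Proof.
move=> dA dB; have dE := is_derive_compf (is_derive_expR (A t)) dA; split.
  have := is_derive_mulf dE (is_derive_cosf dB).
  by move=> /is_derive_eq; apply => /=; ring.
have := is_derive_mulf dE (is_derive_sinf dB).
by move=> /is_derive_eq; apply => /=; ring.
Qed.

Lemma cis_derive_cint d (T : measurableType d) (mu : {measure set T -> \bar R})
    (f f' : R -> T -> R[i]) (G : T -> R) (a b t0 : R) : a < t0 < b ->
  (forall t, a < t < b -> cintegrable mu (f t)) ->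
  (forall t, a < t < b -> forall z : T, cis_derive t (f^~ z) (f' t z)) ->
  (forall t, a < t < b -> forall z : T, Normc.normc (f' t z) <= G z) -> Lone mu G ->
  cis_derive t0 (fun t => cint mu (f t)) (cint mu (f' t0)).
Proof.
move=> abt if_ df f'G iG.
have It : (`]a, b[%classic : set R) t0 by rewrite /= in_itv.
have Iab (t : R) : (`]a, b[%classic : set R) t -> a < t < b by rewrite /= in_itv.
have G0 (z : T) : 0 <= G z := le_trans (normc_ge0 _) (f'G t0 abt z).
(* One argument for both components: [p] is the real or the imaginary part. *)
have main (p : R[i] -> R) : (forall z, `|p z| <= Normc.normc z) ->
    (forall t, a < t < b -> Lone mu (fun z => p (f t z))) ->
    (forall t, a < t < b -> forall z : T, is_derive t 1 (fun t => p (f t z)) (p (f' t z))) ->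
    is_derive t0 1 (fun t => \int[mu]_z p (f t z)) (\int[mu]_z p (f' t0 z)).
  move=> pn ip dp; pose F t z := p (f t z).
  have H1 s x : (`]a, b[%classic : set R) s -> setT x -> derivable (F^~ x) s 1.
    by move=> /Iab ss _; case: (dp s ss x).
  have H2 s x : (`]a, b[%classic : set R) s -> setT x -> `|partial1of2 F s x| <= G x.
    move=> /Iab ss _; rewrite partial1of2E; case: (dp s ss x) => _ ->.
    by apply: (le_trans (pn _)); exact: f'G.
  have i1 s : (`]a, b[%classic : set R) s -> mu.-integrable setT (EFin \o F s).
    by move=> /Iab; exact: ip.
  split; first exact: (derivable_under_integral measurableT It i1 H1 G0 iG H2).
  rewrite -derive1E (differentiation_under_integral measurableT It i1 H1 G0 iG H2).
  by apply: eq_Rintegral => z _; rewrite partial1of2E; case: (dp t0 abt z).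
split.
  apply: main; first exact: normc_Re.
    by move=> t abt'; exact: cintegrable_Re (if_ t abt').
  by move=> t abt' z; case: (df t abt' z).
apply: main; first exact: normc_Im.
  by move=> t abt'; exact: cintegrable_Im (if_ t abt').
by move=> t abt' z; case: (df t abt' z).
Qed.

End complex_derivative.

(** * The heat equation in time *)

Section heat_evolution.
Context {R : realType} {n : nat}.
Local Notation leb := (lebesgue_rV R n).
Local Notation normc := Normc.normc.
Implicit Types (c s t : R) (x y v : 'rV[R]_n) (h u : 'rV[R]_n -> R[i]).

Lemma sqrt_inv_exp (a : R) : 0 < a -> (Num.sqrt a)^-1 ^+ n = expR (- (n%:R / 2) * ln a).
Proof.
move=> a0; rewrite -powR12_sqrt ?(ltW a0)// powR_expln// -expRN -expRM_natl.
by congr expR; field.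
Qed.

Lemma hk_exp c s t v : 0 < t -> hk c s t v =
  cexp (- (n%:R / 2) * ln (4 * pi * t) + - (c * sqn v / 4) * t^-1) (s * sqn v / 4 * t^-1).
Proof.
move=> t0; have p0 : 0 < 4 * pi * t by rewrite !mulr_gt0// pi_gt0.
rewrite hkE sqrt_inv_exp// -cexp_real -cexpD add0r.
by congr cexp; [congr (_ + _)|]; field; rewrite gt_eqF.
Qed.

(** The right-hand side of the rotated heat equation; [cis_derive_hk] identifies it with the time
    derivative of the kernel. *)
Definition hk_dt c s t v : R[i] := (c +i* s) * hk_laplacian c s t v.

Lemma is_derive_inv t : 0 < t -> is_derive t 1 (fun t : R => t^-1) (- t ^- 2).
Proof.
move=> t0; have := @is_deriveV R id t 1 1 (lt0r_neq0 t0) (is_derive_id t 1).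
by rewrite /GRing.scale /= mulr1.
Qed.

Lemma is_derive_log t : 0 < t -> is_derive t 1 (fun t : R => ln (4 * pi * t)) t^-1.
Proof.
move=> t0; have p0 : 0 < 4 * pi * t by rewrite !mulr_gt0// pi_gt0.
have := is_derive_compf (is_derive1_ln p0) (is_derive_linear (4 * pi) t).
move=> /is_derive_eq; apply; rewrite invfM mulrAC mulVf ?mul1r//.
by rewrite mulf_neq0// gt_eqF// pi_gt0.
Qed.

Lemma cis_derive_hk c s t v : 0 < t -> c ^+ 2 + s ^+ 2 = 1 ->
  cis_derive t (fun t => hk c s t v) (hk_dt c s t v).
Proof.
move=> t0 cs1.
have dA := is_derive_addf (is_derive_scalef (- (n%:R / 2)) (is_derive_log t0))
  (is_derive_scalef (- (c * sqn v / 4)) (is_derive_inv t0)).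
have dB := is_derive_scalef (s * sqn v / 4) (is_derive_inv t0).
have [d1 d2] := cis_derive_cexp dA dB.
have E : ((- (n%:R / 2) * t^-1 + - (c * sqn v / 4) * - t ^- 2) +i* (s * sqn v / 4 * - t ^- 2)) *
    hk c s t v = hk_dt c s t v.
  rewrite /hk_dt /hk_laplacian mulrA; congr (_ * _).
  apply: complexP => /=.
    (* Multiplying the left side by c^2 + s^2 = 1 makes the identity homogeneous in c and s, hence
       purely algebraic. *)
    by rewrite -[LHS]mulr1 -[X in _ * X = _]cs1; field; rewrite gt_eqF.
  by rewrite -[LHS]mulr1 -[X in _ * X = _]cs1; field; rewrite gt_eqF.
rewrite -E; rewrite -hk_exp// in d1 d2.
have near_t : \forall r \near t, 0 < r by exact: lt_nbhsr.
split.
  by apply: (near_eq_is_derive _ d1); near=> r; rewrite hk_exp//; near: r.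
by apply: (near_eq_is_derive _ d2); near=> r; rewrite hk_exp//; near: r.
Unshelve. all: by end_near. Qed.

Lemma gauss_mono c t t' v : 0 < c -> 0 < t -> t <= t' ->
  expR (- (c / (4 * t)) * sqn v) <= expR (- (c / (4 * t')) * sqn v).
Proof.
move=> c0 t0 tt'; rewrite ler_expR !mulNr lerN2 ler_wpM2r ?sqn_ge0//.
rewrite ler_wpM2l ?(ltW c0)// lef_pV2 ?posrE ?mulr_gt0//; last exact: lt_le_trans tt'.
by rewrite ler_wpM2l.
Qed.

Lemma hk_prefactor_mono t t' : 0 < t -> t <= t' ->
  (Num.sqrt (4 * pi * t'))^-1 ^+ n <= (Num.sqrt (4 * pi * t))^-1 ^+ n.
Proof.
move=> t0 tt'; have p0 : 0 < 4 * pi :> R by rewrite mulr_gt0// pi_gt0.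
have q0 : 0 < Num.sqrt (4 * pi * t) by rewrite sqrtr_gt0 mulr_gt0.
have qq : Num.sqrt (4 * pi * t) <= Num.sqrt (4 * pi * t').
  by rewrite ler_wsqrtr// ler_wpM2l// ltW.
apply: lerXn2r; rewrite ?nnegrE ?invr_ge0 ?sqrtr_ge0// lef_pV2// posrE.
exact: lt_le_trans qq.
Qed.

Lemma normc_hk_phase c s t : 0 < t -> c ^+ 2 + s ^+ 2 = 1 ->
  normc ((- (c / (4 * t))) +i* (s / (4 * t))) = (4 * t)^-1.
Proof.
move=> t0 cs1; apply/eqP; rewrite -(@eqrXn2 _ 2)// ?normc_ge0//; last first.
  by rewrite invr_ge0 mulr_ge0// ltW.
by rewrite normc_sq /= sqrrN !expr_div_n -mulrDl cs1 mul1r exprVn.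
Qed.

(* Domination by the kernel at a later time, uniformly near t0. *)
Lemma hk_dt_dominated c s t0 : 0 < c -> 0 < t0 -> c ^+ 2 + s ^+ 2 = 1 ->
  exists C : R, 0 <= C /\ forall t, t0 / 2 < t < 2 * t0 -> forall v,
    normc (hk_dt c s t v) <= C * normc (hk c s (4 * t0) v).
Proof.
move=> c0 t00 cs1; have th0 : 0 < t0 / 2 by rewrite divr_gt0.
pose M t := (Num.sqrt (4 * pi * t))^-1 ^+ n.
have M0 t : 0 < t -> 0 < M t.
  by move=> tt; rewrite exprn_gt0// invr_gt0 sqrtr_gt0 !mulr_gt0// pi_gt0.
pose A : R := 2 * n%:R * (2 * t0)^-1 + 4 * (2 * t0)^-1 ^+ 2.
have M40 := M0 (4 * t0) (mulr_gt0 (ltr0n R 4) t00).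
have A0 : 0 <= A by rewrite addr_ge0 ?mulr_ge0 ?exprn_ge0 ?invr_ge0 ?mulr_ge0 ?(ltW t00).
have B0 : 0 <= 1 + 16 * t0 / c by rewrite addr_ge0// divr_ge0 ?mulr_ge0 ?(ltW t00) ?(ltW c0).
(* Each factor is bounded at an end of ]t0/2, 2 t0[. The Gaussian of [hk_laplacian_bound] has rate
   c/(8t) > c/(16 t0), the rate at time 4 t0; this dictates the comparison time. *)
exists (M (t0 / 2) * A * (1 + 16 * t0 / c) / M (4 * t0)); split.
  by rewrite divr_ge0 ?(ltW M40)// !mulr_ge0// ltW// M0.
move=> t /andP[t1 t2] v; have tt : 0 < t := lt_trans th0 t1.
have e1 : normc (c +i* s) = 1.
  apply/eqP; rewrite -(@eqrXn2 _ 2)// ?normc_ge0//.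
  by rewrite normc_sq /= cs1 expr1n.
rewrite /hk_dt Normc.normcM e1 mul1r normc_hk -/(M _).
apply: (le_trans (hk_laplacian_bound s v c0 tt)); rewrite normc_hk_phase//.
have dv K E : K / M (4 * t0) * (M (4 * t0) * E) = K * E.
  by rewrite mulrA divfK// gt_eqF.
rewrite dv.
have ti : (4 * t)^-1 <= (2 * t0)^-1.
  rewrite lef_pV2 ?posrE ?mulr_gt0//; move: t1; rewrite ltr_pdivrMr// => t1; lra.
have ti0 : 0 <= (4 * t)^-1 by rewrite invr_ge0 mulr_ge0// ltW.
have H1 : M t <= M (t0 / 2) by apply: hk_prefactor_mono => //; exact: ltW.
have H2 : 2 * n%:R * (4 * t)^-1 + 4 * (4 * t)^-1 ^+ 2 <= A.
  by apply: lerD; rewrite ler_wpM2l ?mulr_ge0//; apply: lerXn2r; rewrite ?nnegrE// (le_trans ti0).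
have H3 : 1 + 2 / (c / (4 * t)) <= 1 + 16 * t0 / c.
  rewrite lerD2l (_ : 2 / (c / (4 * t)) = 8 * t / c); last by field; rewrite !gt_eqF.
  by rewrite ler_pM2r ?invr_gt0//; lra.
have H4 : expR (- (c / (4 * t) / 2) * sqn v) <= expR (- (c / (4 * (4 * t0))) * sqn v).
  rewrite (_ : c / (4 * t) / 2 = c / (4 * (2 * t))); last by field; rewrite gt_eqF.
  apply: gauss_mono => //; first by rewrite mulr_gt0.
  by lra.
have Mt := ltW (M0 t tt).
have a0 : 0 <= 2 * n%:R * (4 * t)^-1 + 4 * (4 * t)^-1 ^+ 2.
  by rewrite addr_ge0 ?mulr_ge0 ?exprn_ge0.
have b0 : 0 <= 1 + 2 / (c / (4 * t)).
  by rewrite addr_ge0// divr_ge0// divr_ge0 ?mulr_ge0 ?ltW.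
apply: (ler_pM _ (expR_ge0 _) _ H4); first by rewrite !mulr_ge0.
apply: (ler_pM _ b0 _ H3); first by rewrite mulr_ge0.
exact: (ler_pM Mt a0 H1 H2).
Qed.

Definition heat_form c s t h u := cint leb (fun x => h x * hop c s t u x).

Lemma heat_form_prod c s t h u : 0 < c -> 0 < t -> Lp leb 2 h -> Lp leb 2 u ->
  heat_form c s t h u =
  cint (leb \x leb)%E (fun z => h z.1 * (hk c s t (z.1 - z.2) * u z.2)).
Proof.
move=> c0 t0 h2 u2; rewrite -(cint_Fubini1 (hk_form_cintegrable s c0 t0 u2 h2)).
congr cint; apply/funext => x /=; rewrite hopE -cintZ//; exact: hop_cintegrable.
Qed.

Lemma hk_laplacianN c s t v : hk_laplacian c s t (- v) = hk_laplacian c s t v.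
Proof. by rewrite /hk_laplacian sqnN hkN. Qed.

(** The time derivative falls on the kernel inside the double integral; the heat equation turns it
    into a Laplacian, which [weak_heat] moves onto [u]. No regularity of the evolved function is
    used. *)
Lemma heat_form_derive c s t0 h u h0 : 0 < c -> 0 < t0 -> c ^+ 2 + s ^+ 2 = 1 ->
  Lp leb 2 h -> oper_H0 u h0 ->
  cis_derive t0 (fun t => heat_form c s t h u) (- (c +i* s) * heat_form c s t0 h h0).
Proof.
move=> c0 t00 cs1 h2 Huh; have [[/inL2P u2 _] /inL2P h02 _] := Huh.
have th0 : 0 < t0 / 2 by rewrite divr_gt0.
have tin : t0 / 2 < t0 < 2 * t0 by apply/andP; split; [rewrite ltr_pdivrMr//|]; lra.
have pos t : t0 / 2 < t < 2 * t0 -> 0 < t by move=> /andP[t1 _]; exact: lt_trans t1.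
pose F t (z : 'rV[R]_n * 'rV[R]_n) := h z.1 * (hk c s t (z.1 - z.2) * u z.2).
pose F' t (z : 'rV[R]_n * 'rV[R]_n) := h z.1 * (hk_dt c s t (z.1 - z.2) * u z.2).
have [C [C0 hC]] := hk_dt_dominated c0 t00 cs1.
have i4 := hk_form_cintegrable s c0 (mulr_gt0 (ltr0n R 4) t00) u2 h2.
have bF' t : t0 / 2 < t < 2 * t0 -> forall z, normc (F' t z) <=
    C * normc (h z.1 * (hk c s (4 * t0) (z.1 - z.2) * u z.2)).
  move=> tt z; rewrite /F' 2![normc (h _ * _)]Normc.normcM mulrCA ler_wpM2l ?normc_ge0//.
  by rewrite 2![normc (_ * u _)]Normc.normcM mulrA ler_wpM2r ?normc_ge0// hC.
have dF t : t0 / 2 < t < 2 * t0 -> forall z, cis_derive t (F^~ z) (F' t z).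
  move=> tt z; have := cis_derive_hk (z.1 - z.2) (pos t tt) cs1.
  move=> /(cis_deriveZ (h z.1 * u z.2)); rewrite /F /F'.
  rewrite (_ : h z.1 * (hk_dt c s t (z.1 - z.2) * u z.2) =
    h z.1 * u z.2 * hk_dt c s t (z.1 - z.2)); last by ring.
  congr cis_derive; apply/funext => r; ring.
have iF t : t0 / 2 < t < 2 * t0 -> cintegrable (leb \x leb)%E (F t).
  by move=> tt; exact: hk_form_cintegrable (pos t tt) u2 h2.
have := cis_derive_cint tin iF dF bF' (LoneZ C i4.2).
have -> : cint (leb \x leb)%E (F' t0) = - (c +i* s) * heat_form c s t0 h h0.
  have mF' : cmeas (F' t0).
    apply: cmeasM; first exact: (cmeas_comp measurable_fst h2.1).
    apply: cmeasM; last exact: (cmeas_comp measurable_snd u2.1).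
    apply: cmeasM; first exact: cmeas_cst.
    apply: (@cmeas_comp _ _ _ _ _ (fun z : 'rV[R]_n * 'rV[R]_n => z.1 - z.2)).
      exact: (measurable_fun_sub measurable_fst measurable_snd).
    exact: cmeas_hk_laplacian.
  have iF' : cintegrable (leb \x leb)%E (F' t0).
    exact: (le_cintegrable mF' (bF' t0 tin) (LoneZ C i4.2)).
  rewrite -(cint_Fubini1 iF') /heat_form -cintZ; last first.
    by apply: Lp2_mul => //; exact: hop_Lp2.
  congr cint; apply/funext => x /=.
  have W : cint leb (fun y => u y * hk_laplacian c s t0 (x - y)) = - hop c s t0 h0 x.
    rewrite hopE; have := weak_heat s x c0 t00 Huh.
    under [X in cint _ X = _ -> _]funext do rewrite -hk_laplacianN opprB.
    by move=> ->; congr (- cint _ _); apply/funext => y; rewrite hk_sym mulrC.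
  have iL : cintegrable leb (fun y => u y * hk_laplacian c s t0 (x - y)).
    have := hk_laplacian_cintegrable s x c0 t00 u2.
    by under eq_fun do rewrite -hk_laplacianN opprB.
  transitivity (h x * (c +i* s) * cint leb (fun y => u y * hk_laplacian c s t0 (x - y))).
    rewrite -cintZ//; congr cint; apply/funext => y; rewrite /F' /hk_dt /=; ring.
  by rewrite W; ring.
move=> [d1 d2]; have near_t : \forall r \near t0, 0 < r by exact: lt_nbhsr.
split.
  by apply: (near_eq_is_derive _ d1); near=> r; rewrite heat_form_prod//; near: r.
by apply: (near_eq_is_derive _ d2); near=> r; rewrite heat_form_prod//; near: r.
Unshelve. all: by end_near. Qed.

End heat_evolution.

(** * The Gamma integral for exponents in ]0, 1] *)

Section gamma_integral.
Context {R : realType}.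
Local Notation mu := (@lebesgue_measure R).
Implicit Types (nu a b t : R).

Definition gamma_fun nu t : R := t `^ (nu - 1) * expR (- t).

Lemma gamma_fun_ge0 nu t : 0 <= gamma_fun nu t.
Proof. by rewrite mulr_ge0 ?powR_ge0 ?expR_ge0. Qed.

Lemma measurable_gamma_fun nu : measurable_fun setT (gamma_fun nu).
Proof.
apply: measurable_funM; first exact: measurable_powR.
by apply: (measurableT_comp (@measurable_expR R)); exact: measurable_funN.
Qed.

Definition gamma_major nu t : R := nu * t `^ (nu - 1) * expR (- t `^ nu).

(* [gamma_major] is the derivative of [- exp (- t^nu)], hence integrable. *)
Lemma gamma_fun_le nu t : 0 < nu <= 1 -> 0 < t ->
  gamma_fun nu t <= expR 1 / nu * gamma_major nu t.
Proof.
move=> /andP[n0 n1] t0; rewrite /gamma_fun /gamma_major.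
have -> : expR 1 / nu * (nu * t `^ (nu - 1) * expR (- t `^ nu)) =
    t `^ (nu - 1) * expR (1 - t `^ nu) by rewrite expRD; field; rewrite gt_eqF.
rewrite ler_wpM2l ?powR_ge0// ler_expR lerBrDr addrC -lerBrDr opprK.
(* The remaining claim is t^nu <= 1 + t: for t <= 1 the left side is at most 1, and for t > 1 it is
   at most t because nu <= 1. *)
have [t1|t1] := leP t 1.
  apply: (@le_trans _ _ 1); last by rewrite lerDl ltW.
  rewrite -(powRr0 t) ger_powR ?(ltW n0)//.
  by apply/andP; split.
apply: (@le_trans _ _ t); last by rewrite lerDr.
by rewrite -[leRHS]powRr1 ?(ltW t0)// ler_powR// ltW.
Qed.

Lemma measurable_gamma_major nu : measurable_fun setT (gamma_major nu).
Proof.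
apply: measurable_funM.
  by apply: measurable_funM => //; exact: measurable_powR.
apply: (measurableT_comp (@measurable_expR R)); apply: measurable_funN.
exact: measurable_powR.
Qed.

Lemma is_derive_expN_powR nu t : 0 < t ->
  is_derive t 1 (fun t => expR (- t `^ nu)) (- gamma_major nu t).
Proof.
move=> t0.
have dN : is_derive t 1 (fun t : R => - t `^ nu) (- (nu * t `^ (nu - 1))).
  have := is_derive_scalef (-1) (is_derive1_powR nu t0).
  by under eq_fun do rewrite mulN1r; rewrite mulN1r.
have := @is_derive_compf _ expR (fun t : R => - t `^ nu) t _ _ (is_derive_expR (- t `^ nu)) dN.
by move=> /is_derive_eq; apply; rewrite /gamma_major; ring.
Qed.

Lemma is_derive_gamma_major nu t : 0 < t ->
  is_derive t 1 (fun t => - expR (- t `^ nu)) (gamma_major nu t).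
Proof.
move=> t0; have := is_derive_scalef (-1) (is_derive_expN_powR nu t0).
under eq_fun do rewrite mulN1r.
by rewrite mulN1r opprK.
Qed.

Lemma is_derive_cont (f : R -> R) t (d : R) : is_derive t 1 f d -> {for t, continuous f}.
Proof. by move=> [df _]; apply: differentiable_continuous; apply/derivable1_diffP. Qed.

Lemma gamma_major_continuous nu t : 0 < t -> {for t, continuous (gamma_major nu)}.
Proof.
move=> t0; have d1 := is_derive_scalef nu (is_derive1_powR (nu - 1) t0).
have d2 := is_derive_expN_powR nu t0.
apply: cvgM; first exact: (is_derive_cont d1).
exact: (is_derive_cont d2).
Qed.

Lemma gamma_fun_continuous nu t : 0 < t -> {for t, continuous (gamma_fun nu)}.
Proof.
move=> t0; have c1 := is_derive_cont (is_derive1_powR (nu - 1) t0).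
apply: cvgM; first exact: c1.
apply: (@continuous_comp _ _ _ (fun t : R => - t) expR); last exact: continuous_expR.
exact: continuousN.
Qed.

Lemma integral_gamma_major nu a b : 0 < a -> a < b ->
  (\int[mu]_(t in `[a, b]) (gamma_major nu t)%:E <= 1)%E.
Proof.
move=> a0 ab.
rewrite (@continuous_FTC2 _ (gamma_major nu) (fun t => - expR (- t `^ nu)))//.
- rewrite -EFinB lee_fin opprK.
  apply: (@le_trans _ _ (expR (- a `^ nu))); first by rewrite gerDr oppr_le0 expR_ge0.
  by rewrite -[leRHS]expR0 ler_expR oppr_le0 powR_ge0.
- apply: continuous_in_subspaceT => t; rewrite inE/= in_itv/= => /andP[at_ _].
  by apply: gamma_major_continuous; exact: lt_le_trans at_.
- split.
  + move=> t; rewrite in_itv/= => /andP[at_ _].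
    by case: (is_derive_gamma_major nu (lt_trans a0 at_)).
  + apply: cvg_at_right_filter; apply: is_derive_cont (is_derive_gamma_major nu a0).
  + apply: cvg_at_left_filter; apply: is_derive_cont (is_derive_gamma_major nu (lt_trans a0 ab)).
- move=> t; rewrite in_itv/= => /andP[at_ _]; rewrite derive1E.
  by case: (is_derive_gamma_major nu (lt_trans a0 at_)).
Qed.

Lemma gamma_fun_integrable nu : 0 < nu <= 1 ->
  mu.-integrable `]0, +oo[ (EFin \o gamma_fun nu).
Proof.
move=> nu01; have /andP[n0 n1] := nu01.
(* With [k.+2] even the first interval, [1/2, 2], is nondegenerate. *)
pose A (k : nat) : set R := `[k.+2%:R^-1, k.+2%:R]%classic.
have A0 k t : A k t -> 0 < t.
  by rewrite /A /= in_itv/= => /andP[+ _]; apply: lt_le_trans; rewrite invr_gt0.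
have UA : \bigcup_k A k = `]0, +oo[%classic.
  apply/seteqP; split => [t [k _ Akt]|t]; first by rewrite /= in_itv/= andbT (A0 k).
  rewrite /= in_itv/= andbT => t0; pose k := maxn (Num.truncn t) (Num.truncn t^-1).
  exists k => //; rewrite /A /= in_itv/=; apply/andP; split.
    rewrite invf_ple ?posrE ?invr_gt0// (le_trans (ltW (truncnS_gt _)))// ler_nat.
    by rewrite ltnS leqW// leq_maxr.
  rewrite (le_trans (ltW (truncnS_gt _)))// ler_nat.
  by rewrite ltnS leqW// leq_maxl.
have ndA : nondecreasing_seq A.
  apply/nondecreasing_seqP => k; rewrite subsetEset => t; rewrite /A /= !in_itv/= => /andP[h1 h2].
  apply/andP; split; last by apply: le_trans h2 _; rewrite ler_nat.
  by apply: le_trans h1; rewrite lef_pV2 ?posrE// ler_nat.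
have mg : measurable_fun setT (EFin \o gamma_fun nu).
  by apply/measurable_EFinP; exact: measurable_gamma_fun.
apply/integrableP; split; first exact: measurable_funTS.
rewrite -UA.
have mabs : measurable_fun setT (fun t : measurableTypeR R => `|(EFin \o gamma_fun nu) t|)%E.
  exact: measurableT_comp mg.
have cv := @ge0_nondecreasing_set_cvg_integral _ (measurableTypeR R) R A (fun t => `|(EFin \o gamma_fun nu) t|)%E mu
  ndA (fun k => measurable_itv _) (fun k => measurable_funTS mabs)
  (fun k x _ => abse_ge0 _).
rewrite -(cvg_lim _ cv)//; apply: (@le_lt_trans _ _ (expR 1 / nu)%:E); last exact: ltry.
apply: lime_le; first by apply/cvg_ex; eexists; exact: cv.
apply: nearW => k.
have e0 : 0 <= expR 1 / nu by rewrite divr_ge0 ?expR_ge0// ltW.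
apply: (@le_trans _ _ (\int[mu]_(t in A k) ((expR 1 / nu)%:E * (gamma_major nu t)%:E))%E).
  apply: ge0_le_integral => //; first exact: measurable_itv.
  - by apply: measurable_funTS; exact: measurableT_comp mg.
  - apply: measurable_funTS; apply: measurable_funeM; apply/measurable_EFinP.
    exact: measurable_gamma_major.
  - move=> t At; rewrite /= ger0_norm ?gamma_fun_ge0// -EFinM lee_fin.
    by apply: gamma_fun_le => //; exact: A0 At.
rewrite ge0_integralZl_EFin//; first last.
- by apply: measurable_funTS; apply/measurable_EFinP; exact: measurable_gamma_major.
- by move=> t At; rewrite lee_fin mulr_ge0 ?expR_ge0// mulr_ge0 ?powR_ge0// ltW.
- exact: measurable_itv.
rewrite -[leRHS]mule1; apply: lee_wpmul2l; first by rewrite lee_fin.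
apply: integral_gamma_major; first by rewrite invr_gt0.
by rewrite (@lt_trans _ _ 1)// ?invf_lt1// ltr1n.
Qed.

Lemma le_gamma_integral nu b : 0 < nu <= 1 ->
  \int[mu]_(t in `]0, b]) gamma_fun nu t <= Gamma nu.
Proof.
move=> nu01; have ig := gamma_fun_integrable nu01.
have sub : `]0, b]%classic `<=` (`]0, +oo[%classic : set R).
  by move=> t /=; rewrite !in_itv/= andbT => /andP[].
rewrite /Gamma /Rintegral fine_le//.
- apply: integrable_fin_num; first exact: measurable_itv.
  by apply: integrableS ig => //; exact: measurable_itv.
- by apply: integrable_fin_num ig; exact: measurable_itv.
- apply: ge0_subset_integral => //; try exact: measurable_itv.
    by apply: measurable_funTS; apply/measurable_EFinP; exact: measurable_gamma_fun.
  by move=> t _; rewrite lee_fin; exact: gamma_fun_ge0.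
Qed.

(** With F the incomplete Gamma integral, Y + C F is nondecreasing on [a, b] since |Y'| <= C F', and
    F b is at most the complete integral. No integral of [Y'] has to be formed. *)
Lemma gamma_gronwall (Y Y' : R -> R) (C nu a b : R) : 0 < nu <= 1 -> 0 <= C ->
  (forall t, 0 < t -> is_derive t 1 Y (Y' t)) ->
  (forall t, 0 < t -> `|Y' t| <= C * gamma_fun nu t) ->
  0 < a -> a < b -> Y a <= Y b + C * Gamma nu.
Proof.
move=> nu01 C0 dY bY' a0 ab; have ig := gamma_fun_integrable nu01.
pose F y := \int[mu]_(t in [set` Interval (BRight (0 : R)) (BRight y)]) gamma_fun nu t.
have dF t : 0 < t -> is_derive t 1 F (gamma_fun nu t).
  move=> t0.
  have i1 : mu.-integrable [set` Interval (BRight (0 : R)) (BRight (t + 1))] (EFin \o gamma_fun nu).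
    apply: integrableS ig; [exact: measurable_itv|exact: measurable_itv|].
    by move=> x /=; rewrite !in_itv/= andbT => /andP[].
  have t1 : t < t + 1 by rewrite ltrDl.
  have [|d1 d2] := continuous_FTC1 t1 i1 _ (gamma_fun_continuous (nu:=nu) t0).
    by rewrite lte_fin.
  by split; [exact: d1|rewrite -derive1E; exact: d2].
have dD t : 0 < t -> is_derive t 1 (fun t => Y t + C * F t) (Y' t + C * gamma_fun nu t).
  by move=> t0; apply: is_derive_addf; [exact: dY|apply: is_derive_scalef; exact: dF].
have pos t : t \in `]a, b[ -> 0 < t.
  by rewrite in_itv/= => /andP[at_ _]; exact: lt_trans at_.
have mono : Y a + C * F a <= Y b + C * F b.
  apply: (@ger0_derive1_le_cc _ (fun t => Y t + C * F t) a b).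
  - by move=> t /pos t0; case: (dD t t0).
  - move=> t /pos t0; rewrite derive1E; case: (dD t t0) => _ ->.
    by have := bY' t t0; rewrite ler_norml => /andP[+ _]; rewrite -subr_ge0 opprK.
  - apply: continuous_in_subspaceT => t; rewrite inE/= in_itv/= => /andP[at_ _].
    exact: is_derive_cont (dD t (lt_le_trans a0 at_)).
  - by rewrite in_itv/= lexx ltW.
  - by rewrite in_itv/= lexx ltW.
  - exact: ltW.
have F0 t : 0 <= F t by apply: Rintegral_ge0 => x _; exact: gamma_fun_ge0.
apply: (@le_trans _ _ (Y a + C * F a)); first by rewrite lerDl mulr_ge0.
by apply: (le_trans mono); rewrite lerD2l ler_wpM2l// le_gamma_integral.
Qed.

End gamma_integral.

Section resolvent_form.
Context {R : realType} {n : nat}.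
Local Notation leb := (lebesgue_rV R n).
Local Notation normc := Normc.normc.
Implicit Types (c s t : R) (f g h u : 'rV[R]_n -> R[i]).

Lemma LpB f g : Lp leb 2 f -> Lp leb 2 g -> Lp leb 2 (fun x => f x - g x).
Proof.
move=> f2 g2; apply: Lone_sqr_Lp2; first exact: cmeasB f2.1 g2.1.
apply: (le_Lone _ _ (LoneD (LoneZ 2 (Lp2_Lone_sqr f2)) (LoneZ 2 (Lp2_Lone_sqr g2)))).
  by apply: measurable_funX; apply: measurable_normc; exact: cmeasB f2.1 g2.1.
move=> x; rewrite ger0_norm ?exprn_ge0 ?normc_ge0//.
have h := le_normcD (f x) (- g x); rewrite normcN in h.
have [f0 g0] := (normc_ge0 (f x), normc_ge0 (g x)).
apply: (@le_trans _ _ ((normc (f x) + normc (g x)) ^+ 2)).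
  by apply: lerXn2r => //; rewrite nnegrE ?normc_ge0 ?addr_ge0.
have := sqr_ge0 (normc (f x) - normc (g x)).
by rewrite sqrrB sqrrD !mulr2n; lra.
Qed.

Lemma LpZ (z : R[i]) f : Lp leb 2 f -> Lp leb 2 (fun x => z * f x).
Proof.
move=> f2; apply: Lone_sqr_Lp2; first by apply: cmeasM f2.1; exact: cmeas_cst.
have := LoneZ (normc z ^+ 2) (Lp2_Lone_sqr f2); congr Lone; apply/funext => x.
by rewrite Normc.normcM exprMn.
Qed.

Lemma heat_formB c s t h f g (z : R[i]) : 0 < c -> 0 < t ->
  Lp leb 2 h -> Lp leb 2 f -> Lp leb 2 g ->
  heat_form c s t h (fun x => f x - z * g x) =
  heat_form c s t h f - z * heat_form c s t h g.
Proof.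
move=> c0 t0 h2 f2 g2; have zg2 := LpZ z g2; have fg2 := LpB f2 zg2.
rewrite !heat_form_prod//.
have i1 := hk_form_cintegrable s c0 t0 f2 h2; have i2 := hk_form_cintegrable s c0 t0 g2 h2.
rewrite -cintZ// -cintB//; last exact: cintegrableZ.
by congr cint; apply/funext => x; ring.
Qed.

(* With e = c + i s, the function t |-> exp(e lambda t) <exp(e t Delta) u, h>
   has derivative -e exp(e lambda t) <exp(e t Delta) w, h>. *)
Lemma evolution_derive c s t h u h0 (al be : R) (lam : R[i]) : 0 < c -> 0 < t ->
  c ^+ 2 + s ^+ 2 = 1 -> Lp leb 2 h -> oper_H0 u h0 -> (c +i* s) * lam = al +i* be ->
  cis_derive t (fun t => cexp (al * t) (be * t) * heat_form c s t h u)
    (- (c +i* s) * (cexp (al * t) (be * t) *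
       heat_form c s t h (fun x => h0 x - lam * u x))).
Proof.
move=> c0 t0 cs1 h2 Huh ab; have [[/inL2P u2 _] /inL2P h02 _] := Huh.
have dE := cis_derive_cexp (is_derive_linear al t) (is_derive_linear be t).
have := cis_deriveM dE (heat_form_derive c0 t0 cs1 h2 Huh).
congr cis_derive; rewrite heat_formB// -ab.
by move: (cexp _ _) (heat_form _ _ _ _ u) (heat_form _ _ _ _ h0) => E P Q; ring.
Qed.

Lemma cis_derive_Re (f : R -> R[i]) t (z w : R[i]) : cis_derive t f z ->
  is_derive t 1 (fun t => complex.Re (w * f t)) (complex.Re (w * z)).
Proof. by move=> /(cis_deriveZ w)[]. Qed.

Lemma cis_derive_rescale (f : R -> R[i]) t (z : R[i]) (k : R) : cis_derive (k * t) f z ->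
  cis_derive t (fun t => f (k * t)) (k%:C * z).
Proof.
move=> [d1 d2]; have dl := is_derive_linear k t; split.
  have := @is_derive_compf _ (fun t => complex.Re (f t)) (fun t => k * t) t _ _ d1 dl.
  by move=> /is_derive_eq; apply; case: z {d1 d2} => ? ? /=; ring.
have := @is_derive_compf _ (fun t => complex.Im (f t)) (fun t => k * t) t _ _ d2 dl.
by move=> /is_derive_eq; apply; case: z {d1 d2} => ? ? /=; ring.
Qed.

Lemma exists_phase (z : R[i]) : exists2 w : R[i], normc w = 1 & complex.Re (w * z) = normc z.
Proof.
have [->|z0] := eqVneq z 0.
  by exists 1; rewrite ?mulr0 ?Normc.normc0 ?Normc.normc1.
have n0 : normc z != 0 by rewrite normc_eq0.
exists (conjc z * (normc z)^-1%:C).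
  rewrite Normc.normcM normc_conj normc_real ger0_norm ?invr_ge0 ?normc_ge0//.
  by rewrite mulfV.
rewrite mulrAC [conjc z * z]mulrC mulcJ -rmorphM/= expr2 -mulrA mulfV// mulr1//.
Qed.

Lemma prefactor_power t (r : R) : 0 < t -> 0 < r ->
  ((Num.sqrt (4 * pi * t))^-1 ^+ n) `^ r^-1 = (4 * pi * t) `^ (- (n%:R / (2 * r))).
Proof.
move=> t0 r0; have p0 : 0 < 4 * pi * t by rewrite !mulr_gt0// pi_gt0.
rewrite sqrt_inv_exp// powR_expln ?expR_gt0// expRK powR_expln//.
by congr expR; field; rewrite gt_eqF.
Qed.

(** The change of variable t -> t / kap turns the bound t^(-a) exp(-kap t) into the integrand of
    Gamma at nu = 1 - a. *)
Lemma gamma_rescale (a nu kap t P W : R) : 0 < kap -> 0 < t -> 0 < P -> nu = 1 - a ->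
  kap^-1 * (expR (- kap * (kap^-1 * t)) * ((P * (kap^-1 * t)) `^ (- a) * W)) =
  P `^ (- a) * kap `^ (- nu) * W * gamma_fun nu t.
Proof.
move=> k0 t0 P0 nuE; have ki0 : 0 < kap^-1 by rewrite invr_gt0.
have kt0 : 0 < kap^-1 * t by rewrite mulr_gt0.
rewrite /gamma_fun !powR_expln ?mulr_gt0// !lnM ?posrE// lnV ?posrE//.
have -> : - kap * (kap^-1 * t) = - t by rewrite mulNr mulVKf// gt_eqF.
have -> : kap^-1 = expR (- ln kap) by rewrite expRN lnK.
transitivity (W * expR (- ln kap + - t + (- a * (ln P + (- ln kap + ln t))))).
  by rewrite !expRD; ring.
have -> : - ln kap + - t + - a * (ln P + (- ln kap + ln t)) =
    - a * ln P + - nu * ln kap + ((nu - 1) * ln t + - t) by rewrite nuE; ring.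
by rewrite !expRD; ring.
Qed.

Lemma expR_seq_cvg0 (kap : R) : 0 < kap -> expR (- kap * k.+2%:R) @[k --> \oo] --> 0.
Proof.
move=> k0; apply: (@cvg0_squeeze _ _ (fun k => kap^-1 * k.+1%:R^-1)).
  apply: nearW => k; rewrite ger0_norm ?expR_ge0// mulNr expRN -invfM.
  rewrite lef_pV2 ?posrE ?expR_gt0 ?mulr_gt0//.
  apply: (@le_trans _ _ (kap * k.+2%:R)); first by rewrite ler_pM2l// ler_nat.
  by apply: le_trans (expR_ge1Dx _); rewrite lerDr.
have cv : kap^-1 * k.+1%:R^-1 @[k --> \oo] --> kap^-1 * 0.
  by apply: cvgMr; exact: cvg_harmonic.
by rewrite mulr0 in cv.
Qed.

Lemma cexp_seq_cvg (al be : R) (t_ : nat -> R) : t_ k @[k --> \oo] --> 0 ->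
  normc (cexp (al * t_ k) (be * t_ k) - 1) @[k --> \oo] --> 0.
Proof.
move=> t0.
have [dR dI] := cis_derive_cexp (is_derive_linear al 0) (is_derive_linear be 0).
have cR := cvg_comp _ _ t0 (is_derive_cont dR).
have cI := cvg_comp _ _ t0 (is_derive_cont dI).
have E0 : cexp (al * 0) (be * 0) = 1 :> R[i] by rewrite !mulr0 cexp0.
rewrite E0 in cR cI.
apply: (@cvg0_squeeze _ _ (fun k => `|complex.Re (cexp (al * t_ k) (be * t_ k)) - 1| +
    `|complex.Im (cexp (al * t_ k) (be * t_ k)) - 0|)).
  apply: nearW => k; rewrite ger0_norm ?normc_ge0//; apply: (le_trans (normc_le_ReIm _)).
  by case: (cexp _ _) => p q /=.
have cv : `|complex.Re (cexp (al * t_ k) (be * t_ k)) - 1| +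
    `|complex.Im (cexp (al * t_ k) (be * t_ k)) - 0| @[k --> \oo] --> (0 : R) + 0.
  by apply: cvgD; apply/norm_cvg0P; apply/subr_cvg0; [exact: cR|exact: cI].
by rewrite addr0 in cv.
Qed.

(** The quantity X of [evolution_derive] is compared at a small and a large time: it starts from
    [z], whose modulus is that of the pairing, and decays like exp(-kap t), while [hop_interp]
    bounds its derivative by a Gamma integrand. *)
Lemma resolvent_form_bound (D : set 'rV[R]_n) c s h u h0 (r gam kap : R) (lam : R[i]) :
  0 < c -> c ^+ 2 + s ^+ 2 = 1 -> 0 < gam -> r = gam + n%:R / 2 -> 1 < r -> 0 < kap ->
  - complex.Re ((c +i* s) * lam) = kap ->
  measurable D -> (leb D < +oo)%E -> cbounded_meas h -> (forall x, ~ D x -> h x = 0) ->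
  oper_H0 u h0 -> Lp leb (2 * r / (r + 1)) (fun x => h0 x - lam * u x) ->
  normc (cint leb (fun x => h x * u x)) <=
    (4 * pi) `^ (- (n%:R / (2 * r))) * kap `^ (- (gam / r)) * Gamma (gam / r) *
    (lpow leb (2 * r / (r + 1)) (fun x => h0 x - lam * u x) `^ ((r + 1) / (2 * r)) *
     lpow leb (2 * r / (r + 1)) h `^ ((r + 1) / (2 * r))).
Proof.
move=> c0 cs1 g0 rE r1 k0 kE mD Doo bh hD Huh wp.
have [[/inL2P u2 _] /inL2P h02 _] := Huh.
have h2 : Lp leb 2 h by rewrite -(cut_id hD); exact: cbounded_cut_Lp.
pose w x := h0 x - lam * u x.
have w2 : Lp leb 2 w by apply: LpB => //; exact: LpZ.
(* The exponent conjugate to 2r / (r + 1); the prefactor of the kernel then enters with power (q -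
   2)/q = 1/r. *)
pose q := 2 * r / (r - 1).
have r0 : 0 < r by lra.
have r10 : 0 < r - 1 by lra.
have q2 : 2 < q by rewrite /q ltr_pdivlMr//; lra.
have pE : q / (q - 1) = 2 * r / (r + 1).
  have r1' : 0 < r + 1 by lra.
  have -> : q - 1 = (r + 1) / (r - 1) by rewrite /q; field; rewrite gt_eqF.
  by rewrite /q; field; rewrite !gt_eqF.
have pE' : (q - 1) / q = (r + 1) / (2 * r).
  by rewrite /q; field; rewrite !gt_eqF.
have qr : (q - 2) / q = r^-1.
  by rewrite /q; field; rewrite !gt_eqF.
pose W := lpow leb (2 * r / (r + 1)) w `^ ((r + 1) / (2 * r)) *
  lpow leb (2 * r / (r + 1)) h `^ ((r + 1) / (2 * r)).
rewrite -/W.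
have W0 : 0 <= W by rewrite mulr_ge0 ?powR_ge0.
pose a : R := n%:R / (2 * r).
have a0 : 0 <= a by rewrite divr_ge0// mulr_ge0// ltW.
have nuE : gam / r = 1 - a.
  rewrite /a (_ : gam = r - n%:R / 2); last by rewrite rE addrK.
  by field; rewrite gt_eqF.
have nu01 : 0 < gam / r <= 1.
  apply/andP; split; first exact: divr_gt0.
  by rewrite nuE gerBl.
set al := complex.Re ((c +i* s) * lam) in kE.
pose be := complex.Im ((c +i* s) * lam).
have albe : (c +i* s) * lam = al +i* be by apply: complexP.
have alE : al = - kap by rewrite -kE opprK.
pose X t := cexp (al * t) (be * t) * heat_form c s t h u.
pose X' t := - (c +i* s) * (cexp (al * t) (be * t) * heat_form c s t h w).
have dX t : 0 < t -> cis_derive t X (X' t).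
  by move=> t0; exact: evolution_derive.
pose z := hmass (n:=n) c s * cint leb (fun x => h x * u x).
(* Rotating by [om] reduces the complex function X to the real function [Y] that the comparison
   requires. *)
have [om om1 omz] := exists_phase z.
have zE : normc z = normc (cint leb (fun x => h x * u x)).
  by rewrite Normc.normcM normc_hmass// mul1r.
pose C1 := (4 * pi) `^ (- a) * kap `^ (- (gam / r)) * W.
have C10 : 0 <= C1 by rewrite mulr_ge0// mulr_ge0 ?powR_ge0.
pose Y t := complex.Re (om * X (kap^-1 * t)).
pose Y' t := complex.Re (om * (kap^-1%:C * X' (kap^-1 * t))).
have ki0 : 0 < kap^-1 by rewrite invr_gt0.
have dY t : 0 < t -> is_derive t 1 Y (Y' t).
  by move=> t0; apply: cis_derive_Re; apply: cis_derive_rescale; apply: dX; rewrite mulr_gt0.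
have e1 : normc (c +i* s) = 1.
  apply/eqP; rewrite -(@eqrXn2 _ 2)// ?normc_ge0//.
  by rewrite normc_sq /= cs1 expr1n.
have X'bound t : 0 < t -> normc (X' t) <= expR (- kap * t) * ((4 * pi * t) `^ (- a) * W).
  move=> t0; rewrite 2!Normc.normcM normcN e1 mul1r normc_cexp alE.
  rewrite ler_wpM2l ?expR_ge0//.
  have := hop_interp c0 t0 cs1 q2 mD Doo w2 _ bh hD; rewrite pE pE' qr prefactor_power//.
  by move=> /(_ wp); rewrite -mulrA.
have bY' t : 0 < t -> `|Y' t| <= C1 * gamma_fun (gam / r) t.
  move=> t0; apply: (le_trans (normc_Re _)); rewrite 2!Normc.normcM om1 mul1r.
  rewrite normc_real ger0_norm ?(ltW ki0)//.
  have tk : 0 < kap^-1 * t by rewrite mulr_gt0.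
  apply: (le_trans (ler_wpM2l (ltW ki0) (X'bound _ tk))); apply: eq_ler.
  by apply: gamma_rescale => //; rewrite mulr_gt0// pi_gt0.
(* In the original time the comparison runs from (k + 1)^(-2) <= 1 to k + 2 > 1; the value at the
   later time is bounded by the L_2 contraction and the exponential decay. *)
have key k : complex.Re (om * X (k.+1%:R^-1 ^+ 2)) <=
    expR (- kap * k.+2%:R) * (lpow leb 2 h `^ 2^-1 * lpow leb 2 u `^ 2^-1) + C1 * Gamma (gam / r).
  have kk1 : k.+1%:R^-1 ^+ 2 <= 1 :> R by rewrite expr_le1// ?invf_le1// ?invr_ge0// ler1n.
  have ka0 : 0 < kap * k.+1%:R^-1 ^+ 2 by rewrite mulr_gt0// exprn_gt0// invr_gt0.
  have ab : kap * k.+1%:R^-1 ^+ 2 < kap * k.+2%:R.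
    by rewrite ltr_pM2l//; apply: (le_lt_trans kk1); rewrite ltr1n.
  have := gamma_gronwall nu01 C10 dY bY' ka0 ab.
  rewrite /Y !mulKf ?gt_eqF// => /le_trans; apply; rewrite lerD2r.
  apply: (le_trans (ler_norm _)); apply: (le_trans (normc_Re _)).
  rewrite 2!Normc.normcM om1 mul1r normc_cexp alE ler_wpM2l ?expR_ge0//.
  exact: hop_bilinear.
have t_cvg : k.+1%:R^-1 ^+ 2 @[k --> \oo] --> (0 : R).
  have cv : (k.+1%:R^-1 : R) * k.+1%:R^-1 @[k --> \oo] --> (0 : R) * 0.
    by apply: cvgM; exact: cvg_harmonic.
  by rewrite mulr0 in cv; under eq_fun do rewrite expr2.
have cE := cexp_seq_cvg al be t_cvg.
have cP := initial_value s c0 h2 u2.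
have cX : expR (- kap * k.+2%:R) @[k --> \oo] --> 0 by exact: expR_seq_cvg0.
rewrite -zE (_ : _ * Gamma _ * W = C1 * Gamma (gam / r)); last by rewrite /C1 /a; ring.
(* Three errors: the value at the large time, the distance to the initial value, and the distance of
   the factor exp(e lam t) to 1. *)
pose err k := expR (- kap * k.+2%:R) * (lpow leb 2 h `^ 2^-1 * lpow leb 2 u `^ 2^-1) +
  (normc (cint leb (fun x => h x * hop c s (k.+1%:R^-1 ^+ 2) u x) - z) +
   normc (cexp (al * k.+1%:R^-1 ^+ 2) (be * k.+1%:R^-1 ^+ 2) - 1) * normc z).
have cerr : err k @[k --> \oo] --> 0.
  have cv : err k @[k --> \oo] --> 0 * (lpow leb 2 h `^ 2^-1 * lpow leb 2 u `^ 2^-1) +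
      ((0 : R) + 0 * normc z).
    apply: cvgD; first by apply: cvgMl.
    by apply: cvgD; [exact: cP|apply: cvgMl].
  by rewrite !mul0r !addr0 in cv.
apply: (le_cvg0 _ cerr) => k.
pose t : R := k.+1%:R^-1 ^+ 2; have t0 : 0 <= t by rewrite exprn_ge0// invr_ge0.
have E : om * z = om * X t + om * (z - X t) by ring.
rewrite -omz E ReD.
have H1 : complex.Re (om * X t) <= expR (- kap * k.+2%:R) *
    (lpow leb 2 h `^ 2^-1 * lpow leb 2 u `^ 2^-1) + C1 * Gamma (gam / r) := key k.
have H2 : complex.Re (om * (z - X t)) <=
    normc (heat_form c s t h u - z) + normc (cexp (al * t) (be * t) - 1) * normc z.
  apply: (le_trans (ler_norm _)); apply: (le_trans (normc_Re _)).
  rewrite Normc.normcM om1 mul1r normc_sub.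
  have -> : X t - z = cexp (al * t) (be * t) * (heat_form c s t h u - z) +
      (cexp (al * t) (be * t) - 1) * z by rewrite /X; ring.
  apply: (le_trans (le_normcD _ _)); rewrite 2!Normc.normcM lerD2r normc_cexp.
  rewrite ler_piMl ?normc_ge0// -[leRHS]expR0 ler_expR alE mulNr oppr_le0 mulr_ge0//.
  exact: ltW.
by apply: (le_trans (lerD H1 H2)); apply: eq_ler; rewrite /err /heat_form; ring.
Qed.

End resolvent_form.

(** * The Birman-Schwinger operator *)

Lemma sqr_powR_half {R : realType} (y : R) : 0 <= y -> (y `^ 2^-1) ^+ 2 = y.
Proof. by move=> y0; rewrite -powR_mulrn ?powR_ge0// -powRrM mulVf// powRr1. Qed.

Section birman_schwinger_bound.
Context {R : realType} {n : nat}.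
Local Notation leb := (lebesgue_rV R n).
Local Notation normc := Normc.normc.
Implicit Types (f g h u m q : 'rV[R]_n -> R[i]) (r : R).

Lemma lpow_ae (p : R) f g : cmeas f -> cmeas g -> f = g %[ae leb] -> lpow leb p f = lpow leb p g.
Proof.
move=> mf mg fg; rewrite !lpowE; apply: rint_ae.
- exact: measurable_funpowR (measurable_normc mf).
- exact: measurable_funpowR (measurable_normc mg).
- by apply: filterS fg => x fgx _; rewrite fgx.
Qed.

Lemma Lp_ae (p : R) f g : cmeas g -> f = g %[ae leb] -> Lp leb p f -> Lp leb p g.
Proof.
move=> mg fg [mf /LoneP[mpf if_]]; split => //; apply/LoneP; split.
  exact: measurable_funpowR (measurable_normc mg).
apply: le_lt_trans if_; rewrite le_eqVlt; apply/orP; left; apply/eqP.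
apply: ae_eq_integral => //.
- apply/measurable_EFinP; apply: measurableT_comp => //.
  exact: measurable_funpowR (measurable_normc mg).
- by apply/measurable_EFinP; apply: measurableT_comp.
- by apply: filterS fg => x fgx _; rewrite fgx.
Qed.

(* Hoelder's inequality with exponents r + 1 and (r + 1) / r. *)
Lemma hoelder_potential r q m f : 0 < r -> Lp leb r q -> cmeas m ->
  (forall x, normc (m x) <= normc (q x) `^ 2^-1) -> Lp leb 2 f ->
  Lp leb (2 * r / (r + 1)) (fun x => m x * f x) /\
  lpow leb (2 * r / (r + 1)) (fun x => m x * f x) `^ ((r + 1) / (2 * r)) <=
    lpow leb r q `^ (2 * r)^-1 * lpow leb 2 f `^ 2^-1.
Proof.
move=> r0 [mq iq] mm mqb [mf if_]; have r10 : 0 < r + 1 by lra.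
set p := 2 * r / (r + 1); have p0 : 0 < p by rewrite divr_gt0 ?mulr_gt0.
pose P x := normc (q x) `^ (p / 2); pose Q x := normc (f x) `^ p.
have mP : measurable_fun setT P := measurable_funpowR (p / 2) (measurable_normc mq).
have mQ : measurable_fun setT Q := measurable_funpowR p (measurable_normc mf).
have le_ x : normc (m x * f x) `^ p <= P x * Q x.
  rewrite Normc.normcM powRM ?normc_ge0// ler_wpM2r ?powR_ge0//.
  rewrite /P (_ : p / 2 = 2^-1 * p); last by rewrite mulrC.
  by rewrite (powRrM _ 2^-1 p); apply: (ge0_ler_powR (ltW p0)); rewrite ?nnegrE ?normc_ge0 ?powR_ge0.
have a0 : 0 < (r + 1)^-1 by rewrite invr_gt0.
have b0 : 0 < r / (r + 1) by rewrite divr_gt0.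
have ab : (r + 1)^-1 + r / (r + 1) = 1 by field; rewrite gt_eqF.
have PE x : P x `^ (r + 1)^-1^-1 = normc (q x) `^ r.
  by rewrite /P -powRrM invrK; congr (_ `^ _); rewrite /p; field; rewrite gt_eqF.
have QE x : Q x `^ (r / (r + 1))^-1 = normc (f x) `^ 2.
  by rewrite /Q -powRrM; congr (_ `^ _); rewrite /p; field; rewrite !gt_eqF.
have P0 x : 0 <= P x by exact: powR_ge0.
have Q0 x : 0 <= Q x by exact: powR_ge0.
have iPQ : Lone leb (fun x => P x * Q x).
  apply: (@Lone_hoelder _ _ _ leb P Q (r + 1) ((r + 1) / r)) => //.
  - exact: divr_gt0.
  - by rewrite invf_div.
  - by move: iq; congr Lone; apply/funext => x; rewrite -PE invrK.
  - by move: if_; congr Lone; apply/funext => x; rewrite -QE invf_div.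
have mmf : cmeas (fun x => m x * f x) by exact: cmeasM.
have Lpm : Lp leb p (fun x => m x * f x).
  split => //; apply: (le_Lone _ _ iPQ); first exact: measurable_funpowR (measurable_normc mmf).
  by move=> x; rewrite ger0_norm ?powR_ge0.
split => //.
have H : lpow leb p (fun x => m x * f x) <=
    lpow leb r q `^ (r + 1)^-1 * lpow leb 2 f `^ (r / (r + 1)).
  rewrite !lpowE; apply: (le_trans (le_rint Lpm.2 iPQ le_)).
  exact: (rint_hoelder_eq a0 b0 ab mP mQ P0 Q0 PE QE iq if_).
have e0 : 0 <= (r + 1) / (2 * r) by rewrite divr_ge0 ?mulr_ge0 ?ltW.
have := ge0_ler_powR e0 _ _ H; rewrite !nnegrE !lpow_ge0 mulr_ge0 ?powR_ge0// => /(_ isT isT).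
rewrite powRM ?powR_ge0// -!powRrM.
rewrite (_ : (r + 1)^-1 * ((r + 1) / (2 * r)) = (2 * r)^-1); last by field; rewrite !gt_eqF.
by rewrite (_ : r / (r + 1) * ((r + 1) / (2 * r)) = 2^-1); last by field; rewrite !gt_eqF.
Qed.

Lemma fact_aE q (x : 'rV[R]_n) : fact_a q x = (normc (q x) `^ 2^-1)%:C.
Proof. by rewrite /fact_a /cabs powR12_sqrt// normc_ge0. Qed.

Lemma normc_fact_a q (x : 'rV[R]_n) : normc (fact_a q x) = normc (q x) `^ 2^-1.
Proof. by rewrite fact_aE normc_real ger0_norm ?powR_ge0. Qed.

Lemma cmeas_fact_a q : cmeas q -> cmeas (fact_a q).
Proof.
move=> mq; rewrite (funext (fact_aE q)); apply: cmeas_real.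
exact: measurable_funpowR (measurable_normc mq).
Qed.

(** A formula without case distinction, from which measurability of the sign is immediate; at z = 0
    the first factor vanishes. *)
Lemma csgnE (z : R[i]) : csgn z = z * (normc z `^ (-1))%:C.
Proof.
rewrite /csgn; case: eqP => [->|_]; first by rewrite mul0r.
by rewrite powR_inv1 ?normc_ge0// fmorphV.
Qed.

Lemma normc_csgn_le (z : R[i]) : normc (csgn z) <= 1.
Proof.
rewrite csgnE Normc.normcM normc_real ger0_norm ?powR_ge0// powR_inv1 ?normc_ge0//.
have [->|z0] := eqVneq (normc z) 0; first by rewrite mul0r.
by rewrite mulfV.
Qed.

Lemma cmeas_fact_b q : cmeas q -> cmeas (fact_b q).
Proof.
move=> mq; apply: cmeasM; last exact: cmeas_fact_a.
rewrite (_ : (fun x => _) = fun x => q x * (normc (q x) `^ (-1))%:C).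
  apply: cmeasM => //; apply: cmeas_real; exact: measurable_funpowR (measurable_normc mq).
by apply/funext => x; rewrite csgnE.
Qed.

Lemma normc_fact_b_le q (x : 'rV[R]_n) : normc (fact_b q x) <= normc (q x) `^ 2^-1.
Proof.
by rewrite /fact_b Normc.normcM normc_fact_a ler_piMl ?powR_ge0// normc_csgn_le.
Qed.

Lemma lpow2_cut_split (D : set 'rV[R]_n) f : measurable D -> Lp leb 2 f ->
  lpow leb 2 f = lpow leb 2 (cut D f) + lpow leb 2 (cut (~` D) f).
Proof.
move=> mD f2; rewrite !lpow2E -rintD; first last.
- by apply: Lp2_Lone_sqr; apply: Lp_cut => //; exact: measurableC.
- by apply: Lp2_Lone_sqr; exact: Lp_cut.
apply: eq_Rintegral => x _; rewrite !normc_cut !indicE in_setC.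
by case: (x \in D); rewrite ?mulr1 ?mulr0 ?expr0n ?addr0 ?add0r.
Qed.

(** Here v = b u and (H_0 - lam) u = a f. Pairing [u] with b times the conjugate of v produces the
    square norm of v; [hoelder_potential] on the two sides costs the square root of the L_r norm of
    q each, and one power of the norm of v cancels. *)
Lemma birman_schwinger_le q (lam : R[i]) f v (c s gam r kap : R) :
  0 < c -> c ^+ 2 + s ^+ 2 = 1 -> 0 < gam -> r = gam + n%:R / 2 -> 1 < r -> 0 < kap ->
  - complex.Re ((c +i* s) * lam) = kap -> Lp leb r q ->
  birman_schwinger q lam f v ->
  lpow leb 2 v `^ 2^-1 <= (4 * pi) `^ (- (n%:R / (2 * r))) * kap `^ (- (gam / r)) *
    Gamma (gam / r) * lpow leb r q `^ r^-1 * lpow leb 2 f `^ 2^-1.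
Proof.
move=> c0 cs1 g0 rE r1 k0 kE qr [u [w [/inL2P f2 /inL2P w2 wE] [_ [h0 Huh wE']]] [/inL2P u2 /inL2P v2 vE]].
have r0 : 0 < r by lra.
have [[_ _] /inL2P h02 _] := Huh.
have mq := qr.1.
pose wt x := h0 x - lam * u x.
have wt2 : Lp leb 2 wt by apply: LpB => //; exact: LpZ.
have maf : cmeas (fun x => fact_a q x * f x) by apply: cmeasM f2.1; exact: cmeas_fact_a.
have wtE : (fun x => fact_a q x * f x) = wt %[ae leb].
  by apply: filterS2 wE wE' => x h1 h2 _; rewrite -h1// h2.
have [af_p af_le] := hoelder_potential r0 qr (cmeas_fact_a mq)
  (fun x => eq_ler (normc_fact_a q x)) f2.
have wtp := Lp_ae wt2.1 wtE af_p.
rewrite (lpow_ae _ maf wt2.1 wtE) in af_le.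
pose bu x := fact_b q x * u x.
have mb := cmeas_fact_b mq.
have mbu : cmeas bu := cmeasM mb u2.1.
have bu2 : Lp leb 2 bu by exact: Lp_ae mbu vE v2.
rewrite (lpow_ae _ v2.1 mbu vE).
set K := _ * Gamma _; set I := lpow leb r q; set F := lpow leb 2 f.
(* On this set b and [u] are bounded and the measure is finite, so the truncated [h] below is
   admissible in [resolvent_form_bound]. *)
pose E k := [set x : 'rV[R]_n | sqn x <= k%:R] `&`
  ([set x | normc (q x) <= k%:R] `&` [set x | normc (u x) <= k%:R]).
have mE k : measurable (E k).
  apply: measurableI; first exact: measurable_sqn_ball.
  apply: measurableI; rewrite -[X in measurable X]setTI.
    by apply: (measurable_fun_le _ _ _) => //; exact: measurable_normc mq.
  by apply: (measurable_fun_le _ _ _) => //; exact: measurable_normc u2.1.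
have Eoo k : (leb (E k) < +oo)%E.
  apply: le_lt_trans (lebesgue_sqn_ball k); apply: le_measure; rewrite ?inE//.
    exact: measurable_sqn_ball.
  by move=> x [].
have cE x : \forall k \near \oo, E k x.
  exists (maxn (Num.truncn (sqn x)) (maxn (Num.truncn (normc (q x))) (Num.truncn (normc (u x))))).+1 => // k /=.
  move=> hk; have H (y : R) : (Num.truncn y < k)%N -> y <= k%:R.
    by move=> yk; apply: (le_trans (ltW (truncnS_gt _))); rewrite ler_nat.
  split; [|split]; rewrite /=; apply: H; apply: leq_trans hk; rewrite ltnS.
  - exact: leq_maxl.
  - by rewrite leq_max leq_maxl orbT.
  - by rewrite leq_max leq_maxr orbT.
have K0 : 0 <= K.
  rewrite mulr_ge0 ?mulr_ge0 ?powR_ge0//; apply: Rintegral_ge0 => t _.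
  by rewrite mulr_ge0 ?powR_ge0 ?expR_ge0.
have main k : lpow leb 2 (cut (E k) bu) `^ 2^-1 <= K * I `^ r^-1 * F `^ 2^-1.
  (* The pairing of [h] with [u] is then the square norm of b u on [E k], and g has the same norm as
     that truncation. *)
  pose g := cut (E k) (fun x => conjc (bu x)); pose h x := fact_b q x * g x.
  have g2 : Lp leb 2 g by apply: Lp_cut => //; exact: Lp_conj.
  pose S := lpow leb 2 (cut (E k) bu).
  have gS : lpow leb 2 g = S.
    by rewrite /S !lpowE; apply: eq_Rintegral => x _; rewrite !normc_cut normc_conj.
  have [hp h_le] := hoelder_potential r0 qr mb (normc_fact_b_le q) g2.
  rewrite gS in h_le.
  have hb : cbounded_meas h.
    split; first exact: cmeasM mb g2.1.
    exists (k%:R `^ 2^-1 * (k%:R `^ 2^-1 * k%:R)) => x.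
    have [Ex|nEx] := pselect (E k x); last first.
      rewrite /h /g /cut indicE memNset// mulr0 mulr0 Normc.normc0.
      by rewrite mulr_ge0 ?mulr_ge0 ?powR_ge0.
    have bk : normc (fact_b q x) <= k%:R `^ 2^-1.
      apply: le_trans (normc_fact_b_le q x) _.
      by apply: ge0_ler_powR; rewrite ?nnegrE ?normc_ge0//; exact: Ex.2.1.
    rewrite Normc.normcM; apply: ler_pM; rewrite ?normc_ge0//.
    apply: le_trans (normc_cut_le _ _ _) _; rewrite normc_conj Normc.normcM.
    by apply: ler_pM; rewrite ?normc_ge0//; exact: Ex.2.2.
  have h0E x : ~ E k x -> h x = 0.
    by move=> nEx; rewrite /h /g /cut indicE memNset// mulr0 mulr0.
  have := resolvent_form_bound c0 cs1 g0 rE r1 k0 kE (mE k) (Eoo k) hb h0E Huh wtp.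
  have -> : cint leb (fun x => h x * u x) = S%:C.
    rewrite /S lpow2E -cint_real; congr cint; apply/funext => x.
    rewrite normc_cut indicE /h /g /cut /bu indicE; case: (x \in E k).
      by rewrite mulr1 mulr1 -mulcJ; ring.
    by rewrite !mulr0 mul0r expr0n.
  rewrite normc_real ger0_norm ?lpow_ge0// -/K.
  have -> : K * I `^ r^-1 * F `^ 2^-1 = K * (I `^ (2 * r)^-1 * F `^ 2^-1 * I `^ (2 * r)^-1).
    rewrite -[K * _ * _]mulrA; congr (_ * _); rewrite mulrAC.
    have E2 : (2 * r)^-1 + (2 * r)^-1 = r^-1 by field; rewrite gt_eqF.
    by rewrite -powRD E2// invr_eq0 gt_eqF.
  set J := I `^ (2 * r)^-1; rewrite -/S => HS.
  have HS2 : S <= K * (J * F `^ 2^-1 * J) * S `^ 2^-1.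
    apply: le_trans HS _; rewrite -(mulrA K); apply: (ler_wpM2l K0).
    by rewrite -(mulrA (J * _)); apply: ler_pM => //; exact: powR_ge0.
  (* The factor to be cancelled may vanish, and then the bound is trivial. *)
  have [S0|S0] := eqVneq (S `^ 2^-1) 0.
    by rewrite S0 mulr_ge0// mulr_ge0 ?powR_ge0// mulr_ge0 ?powR_ge0.
  have Sp : 0 < S `^ 2^-1 by rewrite lt_def S0 powR_ge0.
  by rewrite -(ler_pM2r Sp) -expr2 sqr_powR_half ?lpow_ge0.
have C0 : 0 <= K * I `^ r^-1 * F `^ 2^-1 by rewrite mulr_ge0 ?powR_ge0// mulr_ge0 ?powR_ge0.
rewrite -(@ler_pXn2r _ 2)// ?nnegrE ?powR_ge0// sqr_powR_half ?lpow_ge0//.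
(* The bound is uniform in k, and the part of b u outside [E k] tends to 0 in L_2. *)
apply: (le_cvg0 _ (lpow_cutC_cvg0 mE cE bu2)) => k.
rewrite (lpow2_cut_split (mE k) bu2) lerD2r -(sqr_powR_half (lpow_ge0 _ (cut _ _))).
by rewrite ler_pXn2r// nnegrE powR_ge0.
Qed.

End birman_schwinger_bound.

(** * From the operator bound to the eigenvalue bound *)

Section eigenvalue_bound.
Context {R : realType} {n : nat}.
Local Notation leb := (lebesgue_rV R n).
Local Notation normc := Normc.normc.
Implicit Types (f g h q : 'rV[R]_n -> R[i]).

(** Pointwise domination of the moduli replaces an equation f = g + h, so sums and differences are
    both covered. *)
Lemma lpow2_triangle f g h : Lp leb 2 f -> Lp leb 2 g -> Lp leb 2 h ->
  (forall x, normc (f x) <= normc (g x) + normc (h x)) ->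
  lpow leb 2 f `^ 2^-1 <= lpow leb 2 g `^ 2^-1 + lpow leb 2 h `^ 2^-1.
Proof.
move=> f2 g2 h2 fgh.
have gh1 : Lone leb (fun x => normc (g x) * normc (h x)).
  have [_] := Lp2_mul g2 h2; congr Lone; apply/funext => x; exact: Normc.normcM.
have g1 := Lp2_Lone_sqr g2; have h1 := Lp2_Lone_sqr h2.
rewrite -(@ler_pXn2r _ 2)// ?nnegrE ?addr_ge0 ?powR_ge0// sqr_powR_half ?lpow_ge0//.
have i2 := LoneD (LoneD g1 h1) (LoneZ 2 gh1).
have H : lpow leb 2 f <= lpow leb 2 g + lpow leb 2 h +
    2 * \int[leb]_x (normc (g x) * normc (h x)).
  rewrite !lpow2E -(rintD g1 h1) -(rintZ 2 gh1) -(rintD (LoneD g1 h1) (LoneZ 2 gh1)).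
  apply: (le_rint (Lp2_Lone_sqr f2) i2) => x.
  have -> : normc (g x) ^+ 2 + normc (h x) ^+ 2 + 2 * (normc (g x) * normc (h x)) =
    (normc (g x) + normc (h x)) ^+ 2 by ring.
  by rewrite ler_pXn2r// ?nnegrE ?addr_ge0 ?normc_ge0.
apply: (le_trans H); rewrite sqrrD sqr_powR_half ?lpow_ge0// sqr_powR_half ?lpow_ge0//.
have := cauchy_schwarz g2 h2; lra.
Qed.

Lemma lpow2_eq0 f : Lp leb 2 f -> lpow leb 2 f = 0 -> f = cst 0 %[ae leb].
Proof.
move=> f2; have f1 := Lp2_Lone_sqr f2; rewrite lpow2E => i0.
have m1 : measurable_fun setT (fun x => (normc (f x) ^+ 2)%:E).
  by apply/measurable_EFinP; exact: Lone_meas f1.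
have : (\int[leb]_(x in setT) `|(normc (f x) ^+ 2)%:E| = 0)%E.
  rewrite (eq_integral (fun x => (normc (f x) ^+ 2)%:E)); last first.
    by move=> x _; rewrite gee0_abs// lee_fin sqr_ge0.
  by rewrite -rint_EFin// i0.
move=> /(ae_eq_integral_abs _ measurableT m1); apply: filterS => x /(_ I) /= [] fx _.
by apply: Normc.eq0_normc; apply/eqP; rewrite -sqrf_eq0 fx.
Qed.

(* An operator that is bounded by [C] on a dense set has no eigenvalue of
   modulus larger than [C]. *)
Lemma dense_bound_eigenvalue (C : R) (S Q : oper R n) : 0 <= C ->
  densely_defined S -> bounded_operator Q -> extends Q S ->
  (forall f v, S f v -> lpow leb 2 v `^ 2^-1 <= C * lpow leb 2 f `^ 2^-1) ->
  is_eigenvalue Q (-1) -> 1 <= C.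
Proof.
move=> C0 dS [[QL Qae Q0 Qlin Qfun] Qtot [cc Qcc]] QS SC [g Qg gn0].
have [/inL2P g2 _] := QL _ _ Qg.
pose nrm f := lpow leb 2 f `^ 2^-1; have nrm0 f : 0 <= nrm f := powR_ge0 _ _.
have gpos : 0 < nrm g.
  apply: powR_gt0; rewrite lt_def lpow_ge0 andbT; apply/eqP => g0.
  exact/gn0/lpow2_eq0.
suff : nrm g <= C * nrm g by rewrite -{1}[nrm g]mul1r ler_pM2r.
have key (k : nat) : nrm g <= C * nrm g + (C + `|cc|) * k.+1%:R^-1.
  set e : R := k.+1%:R^-1; have e0 : 0 < e by rewrite invr_gt0.
  have [f [v [Sfv]]] := dS g e (proj2 (inL2P g) g2) e0.
  have [/inL2P f2 /inL2P v2] := QL _ _ (QS _ _ Sfv).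
  have gf2 : Lp leb 2 (fun x => g x - f x) by exact: LpB.
  rewrite (L2norm_lpow gf2) -/(nrm _) => gfe.
  (* The vector g - f, small in norm, is mapped to -v - g; the continuity constant may be negative,
     whence its absolute value below. *)
  have Qw := Qlin (-1) _ _ _ _ (QS _ _ Sfv) Qg.
  have [/inL2P d2 /inL2P w2] := QL _ _ Qw.
  have := Qcc _ _ Qw; rewrite (L2norm_lpow d2) (L2norm_lpow w2) -!/(nrm _) => Hw.
  have dE : nrm (fun x => -1 * f x + g x) = nrm (fun x => g x - f x).
    by congr nrm; apply/funext => x; rewrite mulN1r addrC.
  rewrite dE in Hw.
  have h1 : nrm g <= nrm v + nrm (fun x => -1 * v x + -1 * g x).
    apply: lpow2_triangle => // x.
    have {1}-> : g x = - v x + - (-1 * v x + -1 * g x) by ring.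
    by apply: le_trans (le_normcD _ _) _; rewrite !normcN.
  have h2 : nrm f <= nrm g + nrm (fun x => g x - f x).
    apply: lpow2_triangle => // x.
    have {1}-> : f x = g x + - (g x - f x) by ring.
    by apply: le_trans (le_normcD _ _) _; rewrite normcN.
  have h3 := SC _ _ Sfv; rewrite -!/(nrm _) in h3.
  have h4 : nrm (fun x => -1 * v x + -1 * g x) <= `|cc| * e.
    apply: (le_trans Hw); apply: (le_trans (ler_wpM2r (nrm0 _) (ler_norm cc))).
    by apply: ler_wpM2l; [exact: normr_ge0|exact: ltW].
  have h5 : C * nrm f <= C * (nrm g + e).
    by apply: (ler_wpM2l C0); apply: (le_trans h2); rewrite lerD2l ltW.
  by apply: (le_trans h1); rewrite mulrDl addrA -mulrDr; apply: lerD h4; exact: le_trans h3 h5.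
apply: (le_cvg0 key).
have cv : (C + `|cc|) * k.+1%:R^-1 @[k --> \oo] --> (C + `|cc|) * 0.
  by apply: cvgMr; exact: cvg_harmonic.
by rewrite mulr0 in cv.
Qed.

(** The operator bound C is a constant times kap^(-gamma/r), and the eigenvalue -1 forces C >= 1;
    this is solved for [kap]. *)
Lemma birman_schwinger_rotated (gam r : R) q lam Q (c s kap : R) :
  0 < c -> c ^+ 2 + s ^+ 2 = 1 -> 0 < gam -> r = gam + n%:R / 2 -> 1 < r -> 0 < kap ->
  - complex.Re ((c +i* s) * lam) = kap -> Lp leb r q ->
  birman_schwinger_closure q lam Q -> is_eigenvalue Q (-1) ->
  kap <= ((4 * pi) `^ (- (n%:R / (2 * r))) * Gamma (gam / r) * lpow leb r q `^ r^-1)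
    `^ (r / gam).
Proof.
move=> c0 cs1 g0 rE r1 k0 kE qr [dS bQ QS] eQ; have r0 : 0 < r by lra.
have Ga : 0 <= Gamma (gam / r).
  by apply: Rintegral_ge0 => t _; rewrite mulr_ge0 ?powR_ge0 ?expR_ge0.
set A := _ `^ (- _); set G := Gamma _; set I := _ `^ r^-1.
have A0 : 0 <= A := powR_ge0 _ _; have I0 : 0 <= I := powR_ge0 _ _.
have B0 : 0 <= A * G * I by rewrite mulr_ge0 ?mulr_ge0.
have C0 : 0 <= A * kap `^ (- (gam / r)) * G * I.
  by rewrite mulr_ge0// mulr_ge0// mulr_ge0 ?powR_ge0.
have := dense_bound_eigenvalue C0 dS bQ QS
  (fun f v => birman_schwinger_le c0 cs1 g0 rE r1 k0 kE qr) eQ.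
rewrite powRN (_ : A * _ * G * I = A * G * I * (kap `^ (gam / r))^-1); last by ring.
rewrite ler_pdivlMr ?powR_gt0// mul1r => H.
have e0 : 0 <= r / gam by rewrite divr_ge0 ?ltW.
have := ge0_ler_powR e0 _ _ H; rewrite !nnegrE powR_ge0 => /(_ isT B0).
by rewrite -powRrM (_ : gam / r * (r / gam) = 1) ?(powRr1 (ltW k0))//; field; rewrite !gt_eqF.
Qed.

End eigenvalue_bound.

(* [2 x / (1 + x^2)] and [(1 - x^2) / (1 + x^2)] parametrize the unit circle; for
   [x -> 0] the rotation by [c +i s] tends to the one that maximizes
   [- Re ((c +i s) lam)]. *)
Lemma le_Im_of_rotations {R : realType} (lam : R[i]) (W : R) : 0 <= W ->
  (forall c s, 0 < c -> c ^+ 2 + s ^+ 2 = 1 -> 0 < - complex.Re ((c +i* s) * lam) ->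
    - complex.Re ((c +i* s) * lam) <= W) ->
  `|complex.Im lam| <= W.
Proof.
move=> W0 HW; case: lam HW => a b HW /=.
(* For x = 1/(k + 1) the rotated bound reads |b| (1 - x^2) - 2 x a <= W (1 + x^2); with x^2 <= x the
   error terms are at most (2 |a| + W + |b|) x. *)
have key (k : nat) : `|b| <= W + (2 * `|a| + W + `|b|) * k.+1%:R^-1.
  pose x : R := k.+1%:R^-1; rewrite -/x.
  have x0 : 0 < x by rewrite invr_gt0.
  have x1 : x <= 1 by rewrite invf_le1// ler1n.
  have d0 : 0 < 1 + x ^+ 2 by rewrite ltr_pwDl ?sqr_ge0.
  pose c := 2 * x / (1 + x ^+ 2); pose s := Num.sg b * ((1 - x ^+ 2) / (1 + x ^+ 2)).
  have [->|b0] := eqVneq b 0.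
    by rewrite normr0 addr_ge0// mulr_ge0 ?(ltW x0)// !addr_ge0// mulr_ge0.
  have c0 : 0 < c by rewrite divr_gt0 ?mulr_gt0.
  have sg2 : Num.sg b ^+ 2 = 1 by rewrite sqr_sg b0.
  have cs1 : c ^+ 2 + s ^+ 2 = 1.
    by rewrite /s (exprMn 2 (Num.sg b)) sg2 /c; field; rewrite gt_eqF.
  have kE : - complex.Re ((c +i* s) * (a +i* b)) =
      (`|b| * (1 - x ^+ 2) - 2 * x * a) / (1 + x ^+ 2).
    by rewrite /= /s /c normrEsg; field; rewrite gt_eqF.
  have H : (`|b| * (1 - x ^+ 2) - 2 * x * a) / (1 + x ^+ 2) <= W.
    (* Rotations with nonpositive value are outside the hypothesis but satisfy the bound because W
       >= 0. *)
    rewrite -kE; have [k0|k0] := ltP 0 (- complex.Re ((c +i* s) * (a +i* b))).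
      exact: HW c0 cs1 k0.
    exact: le_trans k0 W0.
  rewrite ler_pdivrMr// in H.
  have xx : x ^+ 2 <= x by rewrite expr2 ler_piMl// ltW.
  have h1 : W * x ^+ 2 <= W * x := ler_wpM2l W0 xx.
  have h2 : `|b| * x ^+ 2 <= `|b| * x := ler_wpM2l (normr_ge0 b) xx.
  have h3 : x * a <= x * `|a| := ler_wpM2l (ltW x0) (ler_norm a).
  by move: H h1 h2 h3; rewrite !mulrDr !mulrDl mulrN !mulr1 -!mulrA (mulrC `|a|); lra.
apply: (le_cvg0 key).
have cv : (2 * `|a| + W + `|b|) * k.+1%:R^-1 @[k --> \oo] --> (2 * `|a| + W + `|b|) * 0.
  by apply: cvgMr; exact: cvg_harmonic.
by rewrite mulr0 in cv.
Qed.

Theorem corollary4p9 (R : realType) (n : nat) (gamma : R)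
    (q : 'rV[R]_n -> R[i]) (H : oper R n) (lambda : R[i]) :
  (3 <= n)%N ->
  0 < gamma ->
  standing_assumptions q ->
  inLp (gamma + n%:R / 2) q ->
  schrodinger_operator q H ->
  is_eigenvalue H lambda ->
  complex.Im lambda != 0 ->
  ((`|complex.Im lambda| `^ gamma)%:E <=
   ((4 * pi) `^ (- (n%:R / 2)) *
    Gamma (2 * gamma / (2 * gamma + n%:R)) `^ (gamma + n%:R / 2))%:E *
   \int[lebesgue_rV R n]_x (cabs q x `^ (gamma + n%:R / 2))%:E)%E.
Proof.
move=> n3 g0 _ qL [_ _ _ _ HQ] eH im0; set r := gamma + n%:R / 2 in qL *.
have n3' : 3 <= n%:R :> R by rewrite (ler_nat R 3 n).
(* The dimension enters here: n/2 >= 3/2, so the conjugate exponent 2r / (r - 1) is finite. *)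
have r1 : 1 < r by rewrite /r; lra.
have r0 : 0 < r by lra.
have qr := inLp_Lp r0 qL.
have nl : ~~ (0 <= lambda).
  by apply: contra im0; rewrite lecE => /andP[].
have [Q cQ eQ] := (HQ _ nl).1 eH.
(* The integral on the right is finite by the hypothesis on [q], so the inequality is one between
   real numbers. *)
rewrite -(rint_EFin qr.2) -EFinM lee_fin.
have -> : \int[lebesgue_rV R n]_x (cabs q x `^ r) = lpow (lebesgue_rV R n) r q by rewrite lpowE.
have -> : 2 * gamma / (2 * gamma + n%:R) = gamma / r.
  by rewrite /r; field; rewrite !gt_eqF//; lra.
set G := Gamma _; set I := lpow _ _ _.
have G0 : 0 <= G by apply: Rintegral_ge0 => t _; rewrite mulr_ge0 ?powR_ge0 ?expR_ge0.
have I0 : 0 <= I := lpow_ge0 _ _.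
pose W := ((4 * pi) `^ (- (n%:R / (2 * r))) * G * I `^ r^-1) `^ (r / gamma).
have : `|complex.Im lambda| <= W.
  apply: le_Im_of_rotations => [|c s c0 cs1 k0]; first exact: powR_ge0.
  exact: birman_schwinger_rotated c0 cs1 g0 (erefl r) r1 k0 (erefl _) qr cQ eQ.
move=> /(ge0_ler_powR (ltW g0)); rewrite !nnegrE powR_ge0 normr_ge0 => /(_ isT isT).
(* Raising to the power gamma leaves the exponent r on the bracket, which turns (4 pi)^(-n/(2r))
   into (4 pi)^(-n/2) and the L_r norm into the integral. *)
rewrite /W -powRrM (_ : r / gamma * gamma = r); last by field; rewrite gt_eqF.
rewrite powRM ?mulr_ge0 ?powR_ge0// powRM ?powR_ge0// -!powRrM.
rewrite (_ : r^-1 * r = 1) ?powRr1//; last by field; rewrite gt_eqF.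
by rewrite (_ : - (n%:R / (2 * r)) * r = - (n%:R / 2))//; field; rewrite gt_eqF.
Qed.
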